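(* Let $Q$ be any path measure on $\Omega$ and take any $u,v$ in the class $$\mathcal{U}^Q_2:=\Big\{u\in\mathcal{U};\ \overrightarrow{\mathcal{L}}^Qu(X)\in L^2(\bar Q),\ \overrightarrow{\Gamma}^Q(u,u)(X)\in L^1(\bar Q)\Big\}.$$ (a) The following limit holds: $$\lim_{h\to0^+}E_Q\int_0^{T-h}\Big|E_Q\big[h^{-1}\{u(X_{t+h})-u(X_t)\}\{v(X_{t+h})-v(X_t)\}\mid X_{[0,t]}\big]-\overrightarrow{\Gamma}^Q_t(u,v)(X)\Big|\,dt=0.$$ (b) If in addition $Q$ is Markov and $(t,x)\mapsto\overrightarrow{\Gamma}^Q_t(u,v)[x]$ is continuous, then $$\lim_{h\to0^+}E_Q\int_h^T\Big|E_Q\big[h^{-1}\{u(X_t)-u(X_{t-h})\}\{v(X_t)-v(X_{t-h})\}\mid X_{t-h}\big]-\overrightarrow{\Gamma}^Q_t(u,v)[X_t]\Big|\,dt=0.$$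
   Context: $T>0$; $\mathcal{X}$ is a Polish space; $\Omega=D([0,T],\mathcal{X})$ is the set of càdlàg paths with canonical process $X$ and canonical $\sigma$-field and filtration. A path measure is a positive, possibly unbounded, $\sigma$-finite measure $Q$ on $\Omega$, assumed conditionable: $Q_t=(X_t)_\#Q$ is $\sigma$-finite for all $t$ (so that conditional expectations given $X_t$ or $X_{[0,t]}$ make sense). $E_Q$ denotes integration with respect to $Q$; $\bar Q(dtd\omega)=dt\,Q(d\omega)$ on $[0,T]\times\Omega$. $Q$ is Markov if it is conditionable and $Q(X_{[t,T]}\in\cdot\mid X_{[0,t]})=Q(X_{[t,T]}\in\cdot\mid X_t)$ for all $t$. Extended forward generator: a measurable $u$ on $\mathcal{X}$ is in $\mathrm{dom}\,\overrightarrow{\mathcal{L}}^Q$ if there is an adapted process $\overrightarrow{\mathcal{L}}^Q_tu(X)=\overrightarrow{\mathcal{L}}^Qu(t,X_{[0,t]})$ with $\int_0^T|\overrightarrow{\mathcal{L}}^Q_tu(X)|dt<\infty$ $Q$-a.e. such that $u(X_t)-u(X_0)-\int_0^t\overrightarrow{\mathcal{L}}^Q_su(X)ds$ is a local $Q$-martingale. Forward carré du champ (an adapted process): $\overrightarrow{\Gamma}^Q_t(u,v)=\overrightarrow{\mathcal{L}}^Q_t(uv)-u\overrightarrow{\mathcal{L}}^Q_tv-v\overrightarrow{\mathcal{L}}^Q_tu$. If $Q$ is Markov it depends only on the current position, and $\overrightarrow{\Gamma}^Q_t(u,v)[x]=E_Q(\overrightarrow{\Gamma}^Q_t(u,v)(X)\mid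 X_t=x)$. Standing assumption on $\mathcal{U}$: it is a class of functions on $\mathcal{X}$ with $\mathcal{U}\subset\mathrm{dom}\,\overrightarrow{\mathcal{L}}^Q\cap C_b(\mathcal{X})$ which is an algebra: $u,v\in\mathcal{U}\Rightarrow uv\in\mathcal{U}$. *)

(* Defs.v *)
From HB Require Import structures.
From mathcomp Require Import all_boot all_order all_algebra.
From mathcomp Require Import all_classical all_reals all_analysis.
Set Implicit Arguments.
Unset Strict Implicit.
Unset Printing Implicit Defensive.
Import Order.TTheory GRing.Theory Num.Theory.
Import numFieldNormedType.Exports.
Local Open Scope classical_set_scope.
Local Open Scope ring_scope.

Definition polish_space (R : realType) (X : topologicalType) : Prop :=
  (exists2 D : set X, countable D & dense D) /\
  exists d : X -> X -> R,
    [/\ forall x y, 0 <= d x y,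
        forall x y, d x y = 0 <-> x = y,
        forall x y, d x y = d y x &
        forall x y z, d x z <= d x y + d y z] /\
    (forall (x : X) (A : set X),
        nbhs x A <-> exists2 e : R, 0 < e & [set y | d x y < e] `<=` A) /\
    (forall s : nat -> X,
        (forall e : R, 0 < e -> \forall m & n \near \oo, d (s m) (s n) < e) ->
        exists l : X, s n @[n --> \oo] --> l).

Definition borel (X : ptopologicalType) := g_sigma_algebraType (@open X).

Section PathSpace.
Context {R : realType}.
Variables (T : R) (X : ptopologicalType).

(* An element of D([0,T],X) is encoded by its unique extension to the real line
   that is constant on ]-oo,0] and on [T,+oo[. *)
Definition cadlag (w : R -> X) : Prop :=
  [/\ forall t, 0 <= t < T -> w s @[s --> t^'+] --> w t,
      forall t, 0 < t <= T -> exists l : X, w s @[s --> t^'-] --> l,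
      forall t, t <= 0 -> w t = w 0 &
      forall t, T <= t -> w t = w T].

Record cadlag_path :=
  CadlagPath { path_fun : R -> X ; cadlag_pathP : cadlag path_fun }.

Definition position (t : R) (w : cadlag_path) : borel X := path_fun w t.

HB.instance Definition _ := gen_eqMixin cadlag_path.
HB.instance Definition _ := gen_choiceMixin cadlag_path.

Lemma cadlag_cst (x : X) : cadlag (fun=> x).
Proof.
by split=> // t _; [exact: cvg_cst | exists x; exact: cvg_cst].
Qed.

HB.instance Definition _ := isPointed.Build cadlag_path (CadlagPath (cadlag_cst point)).

(* <<s position_gen I>> is the sigma-field generated by X_s, s in I: the whole
   canonical one for I = [0,T], and the canonical filtration, neither completed
   nor made right-continuous, for I = [0,t]. *)
Definition position_gen (I : set R) : set (set cadlag_path) :=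
  \bigcup_(s in I) preimage_set_system setT (position s) measurable.

HB.instance Definition _ := @isMeasurable.Build
  (sigma_display (position_gen `[0, T])) cadlag_path
  <<s position_gen `[0, T] >> (@sigma_algebra0 _ setT _)
  (@sigma_algebraC _ (position_gen `[0, T])) (@sigma_algebra_bigcup _ setT _).

Definition position_measurable (I : set R) (f : cadlag_path -> R) : Prop :=
  measurable_fun setT (f : g_sigma_algebraType (position_gen I) -> R).

End PathSpace.
Arguments position {R T X} t w.
Arguments position_gen {R T X} I.
Arguments position_measurable {R T X} I f.

Section PathMeasure.
Context {R : realType} {T : R} {X : ptopologicalType}.
Local Notation Omega := (cadlag_path T X).
Local Notation mu := (@lebesgue_measure R).
Variable Q : {sigma_finite_measure set Omega -> \bar R}.

Definition conditionable : Prop :=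
  forall t, 0 <= t <= T -> sigma_finite setT (pushforward Q (position t)).

(* g is a version of E_Q[f | X_s, s in I].  Q may be infinite, so the defining
   identity is tested on the conditioning events of finite measure only, on
   which f is required to be integrable. *)
Definition cond_exp (I : set R) (f g : Omega -> R) : Prop :=
  position_measurable I g /\
  forall A : set Omega, <<s position_gen I >> A -> (Q A < +oo)%E ->
    [/\ Q.-integrable A (EFin \o f), Q.-integrable A (EFin \o g) &
        (\int[Q]_(w in A) (g w)%:E = \int[Q]_(w in A) (f w)%:E)%E].

(* Q(B | X_t) and Q(B | X_[0,t]) have a common version for all B in
   sigma(X_[t,T]). *)
Definition markov_measure : Prop :=
  conditionable /\
  forall t, 0 <= t <= T -> forall B : set Omega, <<s position_gen `[t, T] >> B ->
    exists g : Omega -> R,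
      cond_exp `[0, t] (\1_B) g /\ cond_exp [set t] (\1_B) g.

Definition martingale (M : R -> Omega -> R) : Prop :=
  (forall t, 0 <= t <= T ->
     position_measurable `[0, t] (M t) /\ Q.-integrable setT (EFin \o M t)) /\
  (forall s t, 0 <= s -> s <= t -> t <= T -> cond_exp `[0, s] (M t) (M s)).

Definition stopping_time (tau : Omega -> R) : Prop :=
  (forall w, 0 <= tau w) /\
  forall t, 0 <= t <= T -> <<s position_gen `[0, t] >> [set w | tau w <= t].

Definition stopped (tau : Omega -> R) (M : R -> Omega -> R) : R -> Omega -> R :=
  fun t w => M (Num.min (tau w) t) w.

(* The time interval [0,T] is closed, so the localizing sequence has to reach T
   after finitely many steps. *)
Definition local_martingale (M : R -> Omega -> R) : Prop :=
  exists tau : nat -> Omega -> R,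
    [/\ forall n, stopping_time (tau n),
        forall w, nondecreasing_seq (fun n => tau n w),
        {ae Q, forall w, exists n, T <= tau n w} &
        forall n, martingale (stopped (tau n) M)].

(* The values of a process outside of the time set I are irrelevant. *)
Definition measurable_process (I : set R) (K : R -> Omega -> R) : Prop :=
  measurable_fun (I `*` [set: Omega]) (fun p : R * Omega => K p.1 p.2).

Definition adapted_process (K : R -> Omega -> R) : Prop :=
  measurable_process `[0, T] K /\
  forall t, 0 <= t <= T -> position_measurable `[0, t] (K t).

(* K is a version of the process t |-> L^Q_t u(X). *)
Definition generator_version (u : X -> R) (K : R -> Omega -> R) : Prop :=
  [/\ adapted_process K,
      {ae Q, forall w, (\int[mu]_(t in `[0%R, T]) `|K t w|%:E < +oo)%E} &
      local_martingale (fun t w => u (position t w) - u (position 0 w)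
                                   - \int[mu]_(s in `[0, t]) (K s w))].

Definition dom_generator : set (X -> R) :=
  [set u | measurable_fun setT (u : borel X -> R) /\
           exists K, generator_version u K].

(* L^Q u is determined up to a null set; L is any selection of versions. *)
Definition extended_generator (L : (X -> R) -> R -> Omega -> R) : Prop :=
  forall u, dom_generator u -> generator_version u (L u).

Definition carre_du_champ (L : (X -> R) -> R -> Omega -> R) (u v : X -> R) :
    R -> Omega -> R :=
  fun t w => L (u \* v) t w - u (position t w) * L v t w - v (position t w) * L u t w.

(* Only the stability under products is required; U may or may not be a linear
   space. *)
Definition admissible_class (U : set (X -> R)) : Prop :=
  [/\ U `<=` dom_generator,
      forall u, U u -> continuous u /\ exists C : R, forall x, `|u x| <= C &
      forall u v, U u -> U v -> U (u \* v)].

Definition integrable_process (K : R -> Omega -> R) : Prop :=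
  ((mu \x Q)%E).-integrable (`[0, T] `*` [set: Omega])
    (fun p : R * Omega => (K p.1 p.2)%:E).

Definition class2 (L : (X -> R) -> R -> Omega -> R) (U : set (X -> R)) :
    set (X -> R) :=
  [set u | [/\ U u, integrable_process (fun t w => L u t w ^+ 2) &
               integrable_process (carre_du_champ L u u)]].

(* gamma t x is a version of E_Q(Gamma_t(u,v)(X) | X_t = x), for almost every t
   since Gamma(u,v) is itself only determined for almost every t. *)
Definition carre_du_champ_at (L : (X -> R) -> R -> Omega -> R) (u v : X -> R)
    (gamma : R -> X -> R) : Prop :=
  {ae mu, forall t, 0 <= t <= T ->
    cond_exp [set t] (carre_du_champ L u v t) (fun w => gamma t (position t w))}.

Definition incr_quotient (u v : X -> R) (h s : R) (w : Omega) : R :=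
  h^-1 * (u (position (s + h) w) - u (position s w))
       * (v (position (s + h) w) - v (position s w)).

End PathMeasure.

(* Main.v *)
Require Import Defs.
From HB Require Import structures.
From mathcomp Require Import all_boot all_order all_algebra.
From mathcomp Require Import all_classical all_reals all_analysis.
From mathcomp Require Import measurable_realfun ring lra.
Set Implicit Arguments.
Unset Strict Implicit.
Unset Printing Implicit Defensive.
Import Order.TTheory GRing.Theory Num.Theory.
Import numFieldNormedType.Exports.
Local Open Scope classical_set_scope.
Local Open Scope ring_scope.

(** Write u_t for u(X_t). Let B be an event of finite measure in the past of t.
    Expanding the product of increments by means of the generators of u, v and
    uv gives the energy identity ([energy_identity])

      E 1_B (u_{t+h} - u_t) (v_{t+h} - v_t)
        = E 1_B int_t^{t+h} (Gamma_r(u,v) + (u_r - u_t) Lv_r + (v_r - v_t) Lu_r) dr.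

    After division by h the first term is a moving average of Gamma(u,v), which
    converges to Gamma(u,v) in L1 ([forward_average_process_cvg]). The two other
    terms are small. Indeed the identity for v = u bounds
    E 1_B int_t^{t+h} (u_r - u_t)^2 dr by 2h times the integral of
    |Gamma(u,u)| + (Lu)^2 on the same strip, because its own error term is
    absorbed by the left-hand side ([oscillation_le]). A Cauchy-Schwarz
    inequality with weights sqrt h and 1 / sqrt h then bounds the error terms by
    4 sqrt h times the integral of
    G = 2 (|Gamma(u,u)| + (Lu)^2 + |Gamma(v,v)| + (Lv)^2) on the strip
    ([carre_error_le]). The class of u and v makes G integrable on
    [0,T] x Omega, and integrating over t turns a strip of width h into a factor
    h, so that the total error is O(sqrt h).

    These are inequalities between integrals over test events. They pass to the
    L1 distance of two functions that are measurable with respect to the test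
    events, by testing on the two sets where the difference has a sign
    ([integral_norm_le_test]). The test events may be those of any sigma-field
    between the one of X_t and the one of X_[0,t] ([cond_exp_rate_le]). With
    X_[0,t] this is (a). With X_t it is (b), up to the replacement of
    gamma_t(X_t) by gamma_{t+h}(X_{t+h}): as gamma is continuous and the paths
    are right-continuous, the difference tends to 0 pointwise, and a time shift
    preserves the L1 norm, so it tends to 0 in L1 ([scheffe],
    [live_path_drift_cvg]).

    The delicate point is that Gamma(u,v) is integrable ([carre_integrable]).
    The hypotheses control Gamma(u,u) and Gamma(v,v) only, L(uv) is only
    integrable along almost every path, and U need not contain u + v, so that
    Gamma(u,v) cannot be polarized. One stops at the exit times of the integral
    of |Lu| + |Lv| + |L(uu)| + |L(vv)| + |L(uv)|, where the energy identities
    hold ([generator_stop]). For eps = 1 or -1, the inequality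
    eps du dv <= (du^2 + dv^2) / 2 between increments becomes, through the
    three identities, an upper bound 12 sqrt h int G for the integral of
    eps Gamma(u,v) - (Gamma(u,u) + Gamma(v,v)) / 2 over a strip starting at s
    and over any event of finite measure of the past of s on which the exit time
    is not reached before s ([polarized_energy_le]). Choosing the
    event where eps Gamma_s(u,v) >= 0, dividing by h, integrating over s and
    letting h tend to 0 bounds the integral of the positive part of
    eps Gamma(u,v) before the exit time by the one of G, and the exit times
    reach T. *)

(** * Convergence in L1 and moving averages *)

Section scheffe.
Context d (S : measurableType d) (R : realType).
Variable m : {measure set S -> \bar R}.

(** The sequence |f_n - f| - |f_n| + |f| is dominated by 2|f| and tends to 0
    almost everywhere. The bound on the norms is required for every n, instead
    of their convergence: a moving average or a translate satisfies it for
    free. *)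
Lemma scheffe (f_ : nat -> S -> R) (f : S -> R) :
  (forall n, measurable_fun setT (f_ n)) ->
  m.-integrable setT (EFin \o f) ->
  {ae m, forall x, f_ n x @[n --> \oo] --> f x} ->
  (forall n, (\int[m]_x `|f_ n x|%:E <= \int[m]_x `|f x|%:E)%E) ->
  (\int[m]_x `|f_ n x - f x|%:E)%E @[n --> \oo] --> 0%E.
Proof.
move=> mf_ fi cf le_f.
have mf : measurable_fun setT f by exact/measurable_EFinP/(measurable_int _ fi).
have nfi : m.-integrable setT (EFin \o (Num.norm \o f)) by exact: integrable_norm.
have nf_i n : m.-integrable setT (EFin \o (Num.norm \o f_ n)).
  apply/integrableP; split.
    by apply/measurable_EFinP; exact: measurableT_comp.
  rewrite (le_lt_trans _ (integrable_lty _ nfi))//.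
  by apply: le_trans (le_f n); under eq_integral do rewrite /= normr_id.
have di n : m.-integrable setT (EFin \o (fun x => `|f_ n x - f x|)).
  apply: le_integrable (integrableD _ (nf_i n) nfi) => //.
    apply/measurable_EFinP; apply: measurableT_comp => //.
    exact: measurable_funB.
  move=> x _ /=; rewrite lee_fin normr_id [leRHS]ger0_norm ?addr_ge0//.
  exact: ler_normB.
pose g n x := (`|f_ n x - f x| - `|f_ n x| + `|f x|)%:E.
have mg n : measurable_fun setT (g n).
  apply/measurable_EFinP; apply: measurable_funD; last exact: measurableT_comp.
  apply: measurable_funB; last exact: measurableT_comp.
  by apply: measurableT_comp => //; exact: measurable_funB.
have Hg : (\int[m]_x g n x)%E @[n --> \oo] --> (\int[m]_x (cst 0 x))%E.
  (* The bound |g n| <= 2|f| is the triangle inequality, used on both sides. *)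
  have [] := @dominated_convergence _ _ _ m setT measurableT g (cst 0)
     (fun x => (2 * `|f x|)%:E) => //.
  - apply: filterS cf => x cfx _; rewrite /g.
    have -> : (cst 0 x : \bar R) = (`|f x - f x| - `|f x| + `|f x|)%:E.
      by rewrite subrr normr0 sub0r addNr.
    apply: cvg_EFin; first exact: nearW.
    apply: cvgD; last exact: cvg_cst.
    apply: cvgB; last exact: cvg_norm.
    by apply: cvg_norm; apply: cvgB => //; exact: cvg_cst.
  - exact: (integrableZl measurableT 2 nfi).
  - apply: nearW => x n _; rewrite /g abse_EFin lee_fin ler_norml.
    have h1 := ler_normB (f_ n x) (f x).
    have h3 : `|f_ n x| <= `|f_ n x - f x| + `|f x|.
      by rewrite -{1}(subrK (f x) (f_ n x)) ler_normD.
    by have := normr_ge0 (f x); lra.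
rewrite integral_cst//= mul0e in Hg.
apply: (squeeze_cvge _ (cvg_cst 0%E) Hg); apply: nearW => n.
rewrite integral_ge0//=.
have -> : (\int[m]_x g n x = (\int[m]_x `|f_ n x - f x|%:E)
    - (\int[m]_x `|f_ n x|%:E) + (\int[m]_x `|f x|%:E))%E.
  have i1 : m.-integrable setT (EFin \o (fun x => `|f_ n x - f x| - `|f_ n x|)).
    exact: (integrableB measurableT (di n) (nf_i n)).
  rewrite -integralB_EFin//; first exact: (integralD_EFin measurableT i1 nfi).
  exact: nf_i.
have finf : (\int[m]_x `|f x|%:E)%E \is a fin_num.
  exact: (integrable_fin_num _ nfi).
have finf_ : (\int[m]_x `|f_ n x|%:E)%E \is a fin_num.
  exact: (integrable_fin_num _ (nf_i n)).
by rewrite -addeA leeDl// addeC sube_ge0 ?finf_//.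
Qed.

End scheffe.

Section translation.
Context {R : realType}.
Local Notation TR := (measurableTypeR R).
Local Notation mu := (@lebesgue_measure R).

Lemma measurable_shift (a : R) : measurable_fun setT (fun x : TR => x + a : TR).
Proof. exact: measurable_funD. Qed.

Lemma lebesgue_measure_shift (a : R) (A : set R) : measurable A ->
  pushforward mu (fun x : TR => x + a : TR) A = mu A.
Proof.
move=> mA; apply/esym/lebesgue_measure_unique => //=.
  exact: measurable_shift.
move=> ms _ [[b c]] _ <-; rewrite /pushforward.
have -> : (fun x : R => x + a) @^-1` `]b, c]%classic = `]b - a, c - a]%classic.
  by apply/seteqP; split=> x /=; rewrite !in_itv/= ltrBlDr lerBrDr.
rewrite !lebesgue_measure_itv/= !lte_fin ltrBlDr subrK.
by case: ifP => // _; rewrite -!EFinB; congr EFin; ring.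
Qed.

Lemma ge0_integral_shift (a : R) (f : TR -> \bar R) :
  measurable_fun setT f -> (forall x, 0 <= f x)%E ->
  (\int[mu]_x f (x + a)%R = \int[mu]_x f x)%E.
Proof.
move=> mf f0.
have /= <- := ge0_integral_pushforward (measurable_shift a) mu measurableT mf (fun x _ => f0 x).
by apply: eq_measure_integral => [|ms A mA _]; [exact: measurable_shift|exact: lebesgue_measure_shift].
Qed.

End translation.

(** Indicators of a set and of its sections or preimages live on different
    types, so the equality is reduced to an equivalence between two points. *)
Lemma eq_indic (R : pzRingType) (S1 S2 : Type) (A : set S1) (B : set S2) x y :
  (A x <-> B y) -> \1_A x = \1_B y :> R.
Proof. by move=> AB; rewrite !indicE; congr (_ _)%:R; apply/idP/idP; rewrite !inE => /AB. Qed.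

Section average.
Context {R : realType}.
Local Notation TR := (measurableTypeR R).
Local Notation mu := (@lebesgue_measure R).

Context d (S : measurableType d).

(** The endpoints of the interval are variables here: integrals up to a random
    time are compositions with this function. *)
Lemma measurable_itv_integrand (g : TR * S -> \bar R) :
  measurable_fun setT g ->
  measurable_fun setT (fun p : ((TR * TR) * S) * TR =>
    ((fun s => g (s, p.1.2)) \_ `[p.1.1.1, p.1.1.2]) p.2).
Proof.
move=> mg.
pose D : set (((TR * TR) * S) * TR) := [set p | p.1.1.1 <= p.2] `&` [set p | p.2 <= p.1.1.2].
have mD : measurable D.
  have m1 : measurable_fun setT (fun p : ((TR * TR) * S) * TR => p.1.1).
    exact: measurableT_comp measurable_fst.
  have le_measurable (f1 f2 : ((TR * TR) * S) * TR -> R) : measurable_fun setT f1 ->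
      measurable_fun setT f2 -> measurable [set p | f1 p <= f2 p].
    move=> mf1 mf2; rewrite -[X in measurable X]setTI.
    by apply: measurable_fun_le.
  apply: measurableI; apply: le_measurable => //; first exact: (measurableT_comp measurable_fst m1).
  exact: (measurableT_comp measurable_snd m1).
have -> : (fun p : ((TR * TR) * S) * TR =>
    ((fun s => g (s, p.1.2)) \_ `[p.1.1.1, p.1.1.2]) p.2) =
    (fun p => (g (p.2, p.1.2) * (\1_D p)%:E)%E).
  apply/funext => p; rewrite epatch_indic/=; congr (_ * (_)%:E)%E.
  by apply: eq_indic; rewrite /= in_itv/=; split=> [/andP[]|[-> ->]].
apply: emeasurable_funM; last by apply/measurable_EFinP; exact: measurable_indic.
apply: measurableT_comp => //; apply/measurable_fun_pair => //.
exact: measurableT_comp measurable_fst.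
Qed.

Lemma measurable_itv_integral (g : TR * S -> R) :
  measurable_fun setT g ->
  measurable_fun setT (fun p : (TR * TR) * S =>
    (\int[mu]_(s in `[p.1.1, p.1.2]) (g (s, p.2))%:E)%E).
Proof.
move=> mg.
have mint (f : TR * S -> \bar R) : measurable_fun setT f -> (forall x, 0 <= f x)%E ->
  measurable_fun setT (fun p : (TR * TR) * S => (\int[mu]_(s in `[p.1.1, p.1.2]) f (s, p.2))%E).
  move=> mf f0; under eq_fun do rewrite integral_mkcond.
  apply: (measurable_fun_fubini_tonelli_F (fun p : ((TR * TR) * S) * TR =>
    ((fun s => f (s, p.1.2)) \_ `[p.1.1.1, p.1.1.2]) p.2)).
  - exact: measurable_itv_integrand.
  - by move=> p; rewrite patchE; case: ifP.
have mEg : measurable_fun setT (EFin \o g) by exact/measurable_EFinP.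
have mp := mint _ (measurable_funepos mEg) (fun x => funepos_ge0 _ x).
have mn := mint _ (measurable_funeneg mEg) (fun x => funeneg_ge0 _ x).
move: (emeasurable_funB mp mn); apply: eq_measurable_fun => p _.
by apply/esym; rewrite integralE; congr (_ - _)%E; apply: eq_integral => s _; rewrite ?funeposE ?funenegE.
Qed.

Lemma measurable_strip_integral (h : R) (g : TR * S -> R) :
  measurable_fun setT g ->
  measurable_fun setT (fun p : TR * S => (\int[mu]_(s in `[p.1, (p.1 + h)%R]) (g (s, p.2))%:E)%E).
Proof.
move=> /measurable_itv_integral mg.
have mp : measurable_fun setT (fun p : TR * S => ((p.1, p.1 + h), p.2) : (TR * TR) * S).
  by do 2 apply/measurable_fun_pair => //; exact: measurable_funD.
exact: (measurableT_comp mg mp).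
Qed.

Lemma measurable_strip (h : R) :
  measurable [set p : TR * TR | p.1 <= p.2 <= p.1 + h].
Proof.
have -> : [set p : TR * TR | p.1 <= p.2 <= p.1 + h] =
    (fun p : TR * TR => p.2 - p.1) @^-1` `[0, h].
  by apply/seteqP; split=> p /=; rewrite in_itv/= subr_ge0 lerBlDl.
rewrite -[X in measurable X]setTI.
by apply: (measurable_funB measurable_snd measurable_fst).
Qed.

(** By Tonelli, each s is counted for the t in [s - h, s]. *)
Lemma ge0_integral_strip (h : R) (f : TR -> \bar R) : 0 <= h ->
  measurable_fun setT f -> (forall x, 0 <= f x)%E ->
  (\int[mu]_t \int[mu]_(s in `[t, (t + h)%R]) f s = h%:E * \int[mu]_s f s)%E.
Proof.
move=> h0 mf f0.
under eq_integral do rewrite integral_mkcond.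
have mst := measurable_strip h.
pose F := (fun p : TR * TR => f p.2 * (\1_[set q : TR * TR | (q.1 <= q.2 <= q.1 + h)%R] p)%:E)%E.
have mF : measurable_fun setT F.
  apply: emeasurable_funM; first exact: measurableT_comp.
  by apply/measurable_EFinP; exact: measurable_indic.
have F0 p : (0 <= F p)%E by rewrite /F mule_ge0// lee_fin.
have FE t s : (f \_ `[t, t + h]) s = F (t, s).
  rewrite epatch_indic /F; congr (_ * (_)%:E)%E.
under eq_integral do under eq_integral do rewrite FE.
rewrite fubini_tonelli//.
rewrite -ge0_integralZl//.
apply: eq_integral => s _; rewrite /F/= ge0_integralZl//; last first.
  apply/measurable_EFinP; apply: measurableT_comp; first exact: measurable_indic.
  exact: measurable_pair2.
rewrite muleC; congr (_ * _)%E.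
transitivity (\int[mu]_t (\1_(`[s - h, s]%classic) t)%:E)%E.
  apply: eq_integral => t _; congr (_)%:E.
  by apply: eq_indic; rewrite /= in_itv/= lerBlDr andbC.
rewrite integral_indic// setIT -[LHS]/(mu `[s - h, s]%classic) lebesgue_measure_itv/= lte_fin.
case: ltP => [_|]; first by rewrite -EFinB; congr EFin; ring.
by rewrite lerBrDr gerDl => hle; rewrite (@le_anti _ _ h 0)// h0 hle.
Qed.

End average.

Lemma dominated_integral_cvg d (S : measurableType d) (R : realType)
    (m : {measure set S -> \bar R}) (D : set S) (f_ : nat -> S -> \bar R)
    (f g : S -> \bar R) :
  measurable D -> (forall n, measurable_fun D (f_ n)) -> measurable_fun D f ->
  {ae m, forall x, D x -> f_ n x @[n --> \oo] --> f x} ->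
  m.-integrable D g ->
  {ae m, forall x n, D x -> (`|f_ n x| <= g x)%E} ->
  (\int[m]_(x in D) f_ n x)%E @[n --> \oo] --> (\int[m]_(x in D) f x)%E.
Proof.
by move=> mD mf_ mf cf gi fg; have [] := dominated_convergence mD mf_ mf cf gi fg.
Qed.

Section forward_average.
Context {R : realType}.
Local Notation TR := (measurableTypeR R).
Local Notation mu := (@lebesgue_measure R).

(** On a closed interval to the right of t, so that the average at t involves
    the future of t only. *)
Definition forward_average (h : R) (f : R -> R) (t : R) : R :=
  h^-1 * \int[mu]_(s in `[t, t + h]) f s.

Lemma measurable_forward_average d (S : measurableType d) (h : R) (g : TR * S -> R) :
  measurable_fun setT g ->
  measurable_fun setT (fun p : TR * S => forward_average h (fun s => g (s, p.2)) p.1).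
Proof.
move=> mg; apply: measurable_funM => //.
have := measurable_strip_integral h mg.
exact: (measurableT_comp (fine_measurable measurableT)).
Qed.

Lemma forward_average_ae_cvg (h_ : nat -> R) (f : R -> R) :
  (forall n, 0 < h_ n) -> h_ n @[n --> \oo] --> 0 ->
  mu.-integrable setT (EFin \o f) ->
  {ae mu, forall t, forward_average (h_ n) f t @[n --> \oo] --> f t}.
Proof.
move=> h0 hc fi.
have locf : locally_integrable setT f by apply: open_integrable_locally => //; exact: openT.
have Hf := lebesgue_differentiation locf.
pose E (x : R) n : set R := `[x, x + h_ n]%classic.
have muE x n : mu (E x n) = (h_ n)%:E.
  rewrite lebesgue_measure_itv/= lte_fin ltrDl h0 -EFinB.
  by congr EFin; ring.
have hE x : nicely_shrinking x (E x).
  split=> [n|]; first exact: measurable_itv.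
  have r0 n : 0 < 2 * h_ n by rewrite mulr_gt0.
  exists (4, fun n => PosNum (r0 n)); split => //=.
  - by rewrite -(mulr0 2); apply: cvgM => //; exact: cvg_cst.
  - move=> n y; rewrite /E/= in_itv/= /ball/= => /andP[y1 y2].
    by rewrite ltr_norml; have := h0 n; lra.
  - move=> n; rewrite muE lebesgue_measure_ball; last exact: ltW.
    by rewrite -EFinM lee_fin; have := h0 n; lra.
move: Hf; apply: filterS; first exact: (ae_filter_ringOfSetsType mu).
move=> x /(nice_lebesgue_differentiation hE locf).
under eq_fun do rewrite muE.
have -> : (fun n => ((h_ n)%:E^-1 * \int[mu]_(y in E x n) (f y)%:E)%E) =
          EFin \o (fun n => forward_average (h_ n) f x).
  apply/funext => n /=; rewrite /forward_average EFinM inver (gt_eqF (h0 n)).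
  congr (_ * _)%E; rewrite /Rintegral fineK//; apply: integrable_fin_num => //.
  by apply: integrableS fi => //; exact: measurable_itv.
by move/fine_cvgP => -[].
Qed.

(** The average of |f| over [t, t + h], integrated over t, is the integral of
    |f|. *)
Lemma forward_average_norm_le (h : R) (f : R -> R) : 0 < h ->
  mu.-integrable setT (EFin \o f) ->
  (\int[mu]_t `|forward_average h f t|%:E <= \int[mu]_t `|f t|%:E)%E.
Proof.
move=> h0 fi.
have mf : measurable_fun setT (f : TR -> R).
  by apply/measurable_EFinP; exact: measurable_int fi.
have nfi := integrable_norm fi.
have mnf : measurable_fun setT (fun t : TR => `|f t|%:E).
  exact: measurable_int nfi.
have mI : measurable_fun setT (fun t : TR => (\int[mu]_(s in `[t, (t + h)%R]) `|f s|%:E)%E).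
  have := @measurable_strip_integral R _ TR h (fun p => `|f p.1|).
  move=> /(_ (measurableT_comp (@normr_measurable _ setT) (measurableT_comp mf measurable_fst))).
  by move=> H; exact: (measurableT_comp H (measurable_pair2 (0 : TR))).
apply: (@le_trans _ _ (\int[mu]_t ((h^-1)%:E * \int[mu]_(s in `[t, (t + h)%R]) `|f s|%:E)))%E; last first.
  rewrite ge0_integralZl//; last 2 first.
  - by move=> t _; exact: integral_ge0.
  - by rewrite lee_fin invr_ge0 ltW.
  rewrite ge0_integral_strip//; last exact: ltW.
  by rewrite muleA -EFinM mulVf ?gt_eqF// mul1e.
apply: ge0_le_integral => //.
- apply/measurable_EFinP; apply: measurableT_comp => //.
  have := @measurable_forward_average _ TR h (fun p => f p.1) (measurableT_comp mf measurable_fst).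
  by move=> H; exact: (measurableT_comp H (measurable_pair2 (0 : TR))).
- apply: emeasurable_funM => //.
- move=> t _; rewrite /forward_average normrM EFinM (ger0_norm (_ : 0 <= h^-1)); last first.
    by rewrite invr_ge0 ltW.
  apply: lee_wpmul2l; first by rewrite lee_fin invr_ge0 ltW.
  have fit : mu.-integrable `[t, t + h] (EFin \o f).
    by apply: integrableS fi => //; exact: measurable_itv.
  rewrite EFin_normr_Rintegral//.
  apply: le_abse_integral; first exact: measurable_itv.
  exact: measurable_int fit.
Qed.

(** Lebesgue differentiation gives convergence almost everywhere, and averages do
    not increase the norm. *)
Lemma forward_average_cvg (h_ : nat -> R) (f : R -> R) :
  (forall n, 0 < h_ n) -> h_ n @[n --> \oo] --> 0 ->
  mu.-integrable setT (EFin \o f) ->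
  (\int[mu]_t `|forward_average (h_ n) f t - f t|%:E)%E @[n --> \oo] --> 0%E.
Proof.
move=> h0 hc fi; apply: scheffe => //.
- move=> n.
  have mf : measurable_fun setT (f : TR -> R).
  by apply/measurable_EFinP; exact: measurable_int fi.
  have := @measurable_forward_average _ TR (h_ n) (fun p => f p.1) (measurableT_comp mf measurable_fst).
  by move=> H; exact: (measurableT_comp H (measurable_pair2 (0 : TR))).
- exact: forward_average_ae_cvg.
- by move=> n; exact: forward_average_norm_le.
Qed.

(** For almost every w the averages of g(., w) converge in L1(mu); the distance
    is dominated by twice the norm of g(., w). *)
Lemma forward_average_process_cvg d (S : measurableType d)
    (Q : {sigma_finite_measure set S -> \bar R}) (h_ : nat -> R) (g : TR * S -> R) :
  (forall n, 0 < h_ n) -> h_ n @[n --> \oo] --> 0 ->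
  (mu \x Q)%E.-integrable setT (EFin \o g) ->
  (\int[Q]_w \int[mu]_t `|forward_average (h_ n) (fun s => g (s, w)) t - g (t, w)|%:E)%E
     @[n --> \oo] --> 0%E.
Proof.
move=> h0 hc gi.
have mg : measurable_fun setT g by apply/measurable_EFinP; exact: measurable_int gi.
have mD n : measurable_fun setT (fun p : TR * S =>
    `|forward_average (h_ n) (fun s => g (s, p.2)) p.1 - g p|%:E).
  apply/measurable_EFinP; apply: measurableT_comp => //.
  by apply: measurable_funB => //; exact: measurable_forward_average.
have mng : measurable_fun setT (fun p : TR * S => `|g p|%:E).
  by apply/measurable_EFinP; apply: measurableT_comp.
have aei := ae_integrable2 gi.
rewrite -[X in _ --> X](_ : \int[Q]_w cst 0 w = 0)%E; last by rewrite integral_cst// mul0e.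
apply: (dominated_integral_cvg (g := fun w => 2%:E * \int[mu]_t `|g (t, w)|%:E)%E) => //.
- move=> n.
  exact: (measurable_fun_fubini_tonelli_G (fun p : TR * S =>
    `|forward_average (h_ n) (fun s => g (s, p.2)) p.1 - g p|%:E)).
- by apply: filterS aei => w wi _; exact: forward_average_cvg.
- apply: integrableZl => //; apply/integrableP; split.
    exact: (measurable_fun_fubini_tonelli_G (fun p : TR * S => `|g p|%:E)).
  have /integrableP[_] := gi.
  rewrite (fubini_tonelli2 (m1 := mu) (m2 := Q) (fun p => `|(EFin \o g) p|%E))//=.
  apply: le_lt_trans; apply: ge0_le_integral => //.
  + by apply: measurableT_comp => //; exact: (measurable_fun_fubini_tonelli_G (fun p : TR * S => `|g p|%:E)).
  + exact: (measurable_fun_fubini_tonelli_G (fun p : TR * S => `|g p|%:E)).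
  + by move=> w _; rewrite gee0_abs// integral_ge0.
- apply: filterS aei => w wi n _.
  rewrite gee0_abs ?integral_ge0//.
  have mw : measurable_fun setT (fun t : TR => g (t, w)).
    exact: measurableT_comp.
  have mA : measurable_fun setT (fun t : TR => forward_average (h_ n) (fun s => g (s, w)) t).
    exact: (measurableT_comp (measurable_forward_average (h_ n) mg) (measurable_pair2 w)).
  apply: (@le_trans _ _ (\int[mu]_t (`|forward_average (h_ n) (fun s => g (s, w)) t|%:E
      + `|g (t, w)|%:E)))%E.
    apply: ge0_le_integral => //.
    + by apply/measurable_EFinP; apply: measurableT_comp => //; exact: measurable_funB.
    + by apply: emeasurable_funD; apply/measurable_EFinP; apply: measurableT_comp.
    + by move=> t _; rewrite -EFinD lee_fin ler_normB.
  rewrite ge0_integralD//; last 2 first.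
  + by apply/measurable_EFinP; apply: measurableT_comp.
  + by apply/measurable_EFinP; apply: measurableT_comp.
  rewrite mule_natl mule2n leeD2r//.
  exact: (@forward_average_norm_le (h_ n) (fun t => g (t, w))).
Qed.

End forward_average.

(** * Cadlag paths and their filtration *)

Section right_continuous_processes.
Context {R : realType} d (S : measurableType d).
Local Notation TR := (measurableTypeR R).

(** The process is the limit of its values at the next multiple of 1/(n+1) after
    t, and these approximations are countable gluings of measurable functions. *)
Lemma measurable_right_continuous (f : R -> S -> R) :
  (forall t, measurable_fun setT (f t)) ->
  (forall w t, f s w @[s --> t^'+] --> f t w) ->
  measurable_fun setT (fun p : TR * S => f p.1 p.2).
Proof.
move=> mf cf.
(* The next grid time, strictly after t, so that only right-continuity is used. *)
pose c n (t : R) : R := (Num.floor (t * n.+1%:R) + 1)%:~R / n.+1%:R.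
have n0 n : (0 : R) < n.+1%:R by rewrite ltr0n.
have c_gt n t : t < c n t.
  by rewrite /c ltr_pdivlMr//; have /andP[] := floor_itv (t * n.+1%:R).
have c_le n t : c n t <= t + n.+1%:R^-1.
  rewrite /c ler_pdivrMr// mulrDl mulVf ?gt_eqF// intrD lerD2r.
  by have /andP[] := floor_itv (t * n.+1%:R).
apply: (@measurable_fun_cvg _ _ _ _ (fun n p => f (c n p.1) p.2)) => [n|[t w] _]; last first.
  have /cvg_at_rightP := cf w t; apply; split=> [n|]; first exact: c_gt.
  apply: (@squeeze_cvgr _ _ _ _ (cst t) (fun n => t + n.+1%:R^-1)).
  - by apply: nearW => n; rewrite c_le ltW ?c_gt.
  - exact: cvg_cst.
  - rewrite -[X in _ --> X]addr0; apply: cvgD; first exact: cvg_cst.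
    exact: cvg_harmonic.
move=> _ A mA; rewrite setTI.
have -> : (fun p : TR * S => f (c n p.1) p.2) @^-1` A =
   \bigcup_(z : int) ([set t | Num.floor (t * n.+1%:R) = z] `*`
                      (f ((z + 1)%:~R / n.+1%:R) @^-1` A)).
  apply/seteqP; split=> [[t w] /= Aw|[t w] [z _ /=[<-]]//].
  by exists (Num.floor (t * n.+1%:R)).
apply: countable_bigcupT_measurable => [|z]; first exact: countableP.
apply: measurableX; last by rewrite -[X in measurable X]setTI; exact: mf.
have -> : [set t | Num.floor (t * n.+1%:R) = z] =
   `[z%:~R / n.+1%:R, (z + 1)%:~R / n.+1%:R[%classic :> set R.
  apply/seteqP; split => t /=.
    by move/eqP; rewrite floor_eq in_itv/= ler_pdivrMr// ltr_pdivlMr.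
  by move=> tz; apply/eqP; rewrite floor_eq; move: tz; rewrite in_itv/= ler_pdivrMr// ltr_pdivlMr.
exact: measurable_itv.
Qed.

End right_continuous_processes.

Section path_space.
Context {R : realType} {T : R} {X : ptopologicalType}.
Local Notation Om := (cadlag_path T X).
Local Notation TR := (measurableTypeR R).
Local Notation mu := (@lebesgue_measure R).
Implicit Types w : Om.

Lemma path_right_cvg w t : path_fun w s @[s --> t^'+] --> path_fun w t.
Proof.
have [wr _ w0 wT] := cadlag_pathP w.
have [t0|t0] := ltP t 0.
  apply: cvg_near_cst; near=> s; rewrite (w0 t (ltW t0)) w0//.
  by near: s; exact: nbhs_right_le.
have [tT|tT] := ltP t T; first by apply: wr; rewrite t0.
apply: cvg_near_cst; near=> s; rewrite (wT t tT) wT// (le_trans tT)//.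
Unshelve. all: by end_near. Qed.

Lemma position_gen_sub (I J : set R) : I `<=` J ->
  <<s @position_gen R T X I >> `<=` <<s @position_gen R T X J >>.
Proof. by move=> IJ; apply: sub_smallest2r; [exact: smallest_sigma_algebra|] => A [s Is sA]; exists s => //; exact: IJ. Qed.

Lemma position_gen_measurable (I : set R) (A : set Om) : I `<=` `[0, T] ->
  <<s position_gen I >> A -> measurable A.
Proof. by move=> IT; exact: position_gen_sub. Qed.

Lemma position_measurable_measurable (I : set R) (f : Om -> R) : I `<=` `[0, T] ->
  position_measurable I f -> measurable_fun setT f.
Proof.
move=> IT mf _ A mA; apply: (position_gen_measurable IT); exact: mf.
Qed.

(** An event of the sigma-field of X_s, s in I, cannot separate two paths that
    agree on I. *)
Lemma position_genP (I : set R) (A : set Om) w w' :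
  (forall s, I s -> path_fun w s = path_fun w' s) ->
  <<s position_gen I >> A -> A w -> A w'.
Proof.
move=> ww'.
have H : <<s position_gen I >> `<=` [set A : set Om | A w <-> A w'].
  apply: smallest_sub; first split => //=.
  - by move=> B Bw; rewrite /setD/=; tauto.
  - by move=> F FB; split=> -[n _ Fn]; exists n => //; apply/FB.
  - by move=> _ [s Is [B mB <-]]; rewrite /= /position ww'.
by move=> sA; exact: (proj1 (H A sA)).
Qed.

Lemma position_measurable_eq (I : set R) (f : Om -> R) w w' :
  (forall s, I s -> path_fun w s = path_fun w' s) ->
  position_measurable I f -> f w = f w'.
Proof.
move=> ww' mf; apply/esym.
have H : <<s position_gen I >> (f @^-1` [set f w]).
  by rewrite -[X in smallest _ _ X]setTI; apply: mf => //; exact: measurable_set1.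
exact: (position_genP ww' H).
Qed.

(** Freezing a path at a time t keeps it in the path space; this is what allows
    one to recognize the functions of the past of t as those that factor through
    the frozen path. *)
Lemma cadlag_stop (t : R) w : 0 <= t -> cadlag T (fun s => path_fun w (Num.min s t)).
Proof.
move=> t0; have [wr wl w0 wT] := cadlag_pathP w; split.
- move=> s s0T; have [st|ts] := ltP s t.
    apply: cvg_trans (wr s s0T); apply: near_eq_cvg; near=> r.
    by rewrite min_l//; near: r; exact: nbhs_right_le.
  apply: cvg_near_cst; near=> r; rewrite min_r//.
  by apply: le_trans ts _; near: r; exact: nbhs_right_ge.
- move=> s s0T; have [st|ts] := leP s t.
    have [l wl'] := wl s s0T; exists l.
    apply: cvg_trans wl'; apply: near_eq_cvg; near=> r.
    rewrite min_l// ltW//; apply: lt_le_trans st.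
    by near: r; exact: nbhs_left_lt.
  exists (path_fun w t); apply: cvg_near_cst; near=> r; rewrite min_r//.
  by near: r; exact: nbhs_left_ge.
- by move=> s s0; rewrite !min_l ?(le_trans s0)//; exact: w0.
- move=> s Ts; have [tT|Tt] := leP t T; first by rewrite (min_r (le_trans tT Ts)).
  rewrite (wT (Num.min s t))//; last by rewrite le_min Ts ltW.
Unshelve. all: by end_near. Qed.

Definition stop_path (t : R) (t0 : 0 <= t) w : Om := CadlagPath (cadlag_stop w t0).

Lemma measurable_stop_path (t : R) (t0 : 0 <= t) :
  measurable_fun setT (stop_path t0 : g_sigma_algebraType (@position_gen R T X `[0, t]) -> Om).
Proof.
apply: (measurability (@position_gen R T X `[0, T])) => // _ [_ [s s0T [B mB <-]] <-].
rewrite !setTI; apply: sub_sigma_algebra; exists (Num.min s t).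
  by move: s0T; rewrite /= !in_itv/= ge_min lexx orbT le_min t0 !andbT => /andP[].
by exists B => //; rewrite setTI.
Qed.

(** The integral up to t is globally measurable by Tonelli, and takes the same
    value at w and at w frozen at t, because K is adapted. Composition with the
    freezing map, measurable from the past of t, gives the claim without any
    progressive measurability. *)
Lemma adapted_integral_measurable (K : R -> Om -> \bar R) (t : R) :
  measurable_fun setT (fun p : TR * Om => K p.1 p.2) ->
  (forall s w, 0 <= K s w)%E ->
  (forall s w w', 0 <= s <= t -> (forall r, 0 <= r <= s -> path_fun w r = path_fun w' r) ->
     K s w = K s w') ->
  0 <= t ->
  measurable_fun setT ((fun w => \int[mu]_(s in `[0%R, t]) K s w)%E :
      g_sigma_algebraType (@position_gen R T X `[0, t]) -> \bar R).
Proof.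
move=> mK K0 aK t0.
have mV : measurable_fun setT (fun w : Om => \int[mu]_(s in `[0%R, t]) K s w)%E.
  apply: (eq_measurable_fun (fun w => \int[mu]_s ((K ^~ w) \_ `[0%R, t]) s)%E).
    by move=> w _; rewrite -integral_mkcond.
  have mKr : measurable_fun setT (fun p : TR * Om => ((K ^~ p.2) \_ `[0, t]) p.1).
    rewrite (_ : (fun p : TR * Om => _) =
       (fun p : TR * Om => (K p.1 p.2 * (\1_(`[0, t]%classic : set R) p.1)%:E)%E)); last first.
      by apply/funext => p; rewrite epatch_indic.
    apply: emeasurable_funM => //; apply/measurable_EFinP.
    by apply: measurableT_comp => //; exact: measurable_indic.
  apply: (measurable_fun_fubini_tonelli_G _ mKr) => p.
  by rewrite patchE; case: ifP.
have := measurableT_comp mV (measurable_stop_path t0).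
apply: eq_measurable_fun => w _ /=; apply: eq_integral => s.
rewrite inE/= in_itv/= => /andP[s0 st]; apply: aK; rewrite ?s0//.
by move=> r /andP[r0 rs]; rewrite /= min_l// (le_trans rs).
Qed.

End path_space.

(** * Functions with zero integral on test events *)

Section primitive.
Context {R : realType}.
Local Notation mu := (@lebesgue_measure R).

Lemma primitive_right_cvg (T a : R) (f : R -> R) : 0 <= a < T ->
  mu.-integrable `[0, T] (EFin \o f) ->
  \int[mu]_(s in `[0, r]) f s @[r --> a^'+] --> \int[mu]_(s in `[0, a]) f s.
Proof.
move=> /andP[a0 aT] fi.
have T0 : 0 < T by exact: le_lt_trans aT.
have := parameterized_integral_continuous (ltW T0) fi.
move/(continuous_within_itvP _ T0) => [ci c0 _].
move: a0; rewrite le_eqVlt => /predU1P[<-//|a0].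
apply: cvg_at_right_filter; apply: ci.
by rewrite in_itv/= a0.
Qed.

Lemma primitive_left_cvg (T a : R) (f : R -> R) : 0 < a <= T ->
  mu.-integrable `[0, T] (EFin \o f) ->
  \int[mu]_(s in `[0, r]) f s @[r --> a^'-] --> \int[mu]_(s in `[0, a]) f s.
Proof.
move=> /andP[a0 aT] fi.
have T0 : 0 < T by exact: lt_le_trans aT.
have := parameterized_integral_continuous (ltW T0) fi.
move/(continuous_within_itvP _ T0) => [ci _ cT].
move: aT; rewrite le_eqVlt => /predU1P[->//|aT].
apply: cvg_at_left_filter; apply: ci.
by rewrite in_itv/= a0.
Qed.

Lemma primitiveB (T a b : R) (f : R -> R) : 0 <= a -> a <= b -> b <= T ->
  mu.-integrable `[0, T] (EFin \o f) ->
  \int[mu]_(s in `[0, b]) f s - \int[mu]_(s in `[0, a]) f s = \int[mu]_(s in `[a, b]) f s.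
Proof.
move=> a0 ab bT fi.
have fib : mu.-integrable `[0, b] (EFin \o f).
  apply: integrableS fi; [exact: measurable_itv|exact: measurable_itv|].
  by apply: subset_itvl; rewrite bnd_simp.
rewrite Rintegral_itvB//.
apply: Rintegral_itv_obnd_cbnd.
apply: integrableS fib; [exact: measurable_itv|exact: measurable_itv|].
by apply: subset_itvr; rewrite bnd_simp.
Qed.

End primitive.

Section mean_zero.
Context d (S : measurableType d) (R : realType).
Variable m : {measure set S -> \bar R}.

(** The measure may be infinite, so centering given the past is expressed on one
    event B of finite measure at a time. *)
Definition mean_zero (B : set S) (D : S -> R) : Prop :=
  m.-integrable B (EFin \o D) /\ (\int[m]_(w in B) (D w)%:E = 0)%E.

Lemma mean_zero_sub B (f g : S -> R) : measurable B ->
  m.-integrable B (EFin \o f) -> m.-integrable B (EFin \o g) ->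
  (\int[m]_(w in B) (f w)%:E = \int[m]_(w in B) (g w)%:E)%E ->
  mean_zero B (fun w => f w - g w).
Proof.
move=> mB fi gi e; split; first exact: (integrableB mB fi gi).
rewrite -(subee (x := (\int[m]_(w in B) (g w)%:E)%E)); last exact: (integrable_fin_num mB gi).
by rewrite -[X in (X - _)%E]e -integralB_EFin.
Qed.

Lemma mean_zeroD B D1 D2 : measurable B ->
  mean_zero B D1 -> mean_zero B D2 -> mean_zero B (fun w => D1 w + D2 w).
Proof.
move=> mB [i1 e1] [i2 e2]; split; first exact: (integrableD mB i1 i2).
transitivity (\int[m]_(w in B) ((EFin \o D1) w + (EFin \o D2) w))%E => //.
by rewrite (integralD_EFin mB i1 i2)/= e1 e2 adde0.
Qed.

Lemma mean_zeroN B D : measurable B -> mean_zero B D -> mean_zero B (fun w => - D w).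
Proof.
move=> mB [i1 e1]; split; first by have := integrableN i1.
transitivity (\int[m]_(w in B) ((-1)%:E * (EFin \o D) w))%E.
  by apply: eq_integral => w _; rewrite /= -EFinM mulN1r.
by rewrite integralZl//= e1 mule0.
Qed.

Lemma mean_zeroB B D1 D2 : measurable B ->
  mean_zero B D1 -> mean_zero B D2 -> mean_zero B (fun w => D1 w - D2 w).
Proof. by move=> mB h1 h2; apply: mean_zeroD => //; exact: mean_zeroN. Qed.

Lemma mean_zero0 B : mean_zero B (fun=> 0).
Proof. by split; [exact: integrable0|rewrite integral0]. Qed.

Lemma mean_zero_sum n B (D : 'I_n -> S -> R) : measurable B ->
  (forall i, mean_zero B (D i)) -> mean_zero B (fun w => \sum_(i < n) D i w).
Proof.
elim: n D => [|n IHn] D mB HD.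
  rewrite (_ : (fun=> _) = (fun=> 0)); last by apply/funext => w; rewrite big_ord0.
  exact: mean_zero0.
rewrite (_ : (fun=> _) = (fun w => \sum_(i < n) D (widen_ord (leqnSn n) i) w + D ord_max w)).
  by apply: mean_zeroD => //; exact: IHn.
by apply/funext => w; rewrite big_ord_recr.
Qed.

Lemma mean_zero_indic B C D : measurable B -> measurable C ->
  mean_zero (B `&` C) D -> mean_zero B (fun w => \1_C w * D w).
Proof.
move=> mB mC [i1 e1].
have E : (EFin \o (fun w => \1_C w * D w)) = (EFin \o D) \_ C.
  by apply/funext => w; rewrite epatch_indic/= EFinM muleC.
split; first by rewrite E; apply: (proj1 (integrable_restrict _ _ mB _)); rewrite ?i1.
rewrite -e1 integral_mkcondr.
by apply: eq_integral => w _; rewrite -[RHS](congr1 (fun f => f w) E).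
Qed.

Lemma mean_zero_eq B D1 D2 : measurable B -> (forall w, B w -> D1 w = D2 w) ->
  mean_zero B D1 -> mean_zero B D2.
Proof.
move=> mB D12 [i1 e1]; split.
  by apply: eq_integrable i1 => // w /set_mem Bw /=; rewrite D12.
by rewrite -e1; apply: eq_integral => w /set_mem Bw; rewrite D12.
Qed.

Lemma mean_zero_lim B (D_ : nat -> S -> R) (D g : S -> R) : measurable B ->
  (forall n, mean_zero B (D_ n)) -> measurable_fun B D ->
  {ae m, forall w, B w -> D_ n w @[n --> \oo] --> D w} ->
  m.-integrable B (EFin \o g) ->
  {ae m, forall w n, B w -> `|D_ n w| <= g w} -> mean_zero B D.
Proof.
move=> mB D0 mD cD gi Dg.
have mED : measurable_fun B (EFin \o D) by exact/measurable_EFinP.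
have cE : {ae m, forall w, B w -> (EFin \o D_ n) w @[n --> \oo] --> (EFin \o D) w}.
  by apply: filterS cD => w Hw Bw; apply: cvg_EFin; [exact: nearW|exact: Hw].
have gE : {ae m, forall w n, B w -> (`|(EFin \o D_ n) w| <= (EFin \o g) w)%E}.
  by apply: filterS Dg => w Hw n Bw; rewrite /= lee_fin; exact: Hw.
have [iD _ cv] := dominated_convergence mB (fun n => measurable_int _ (D0 n).1) mED cE gi gE.
split => //; apply: cvg_unique cv _ => //.
rewrite (_ : [sequence _]_n = cst 0%E); first exact: cvg_cst.
by apply/funext => n; rewrite /= (D0 n).2.
Qed.

Lemma mean_zero_ae_eq B (D1 D2 : S -> R) : measurable B -> measurable_fun B D2 ->
  {ae m, forall w, B w -> D1 w = D2 w} ->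
  mean_zero B D1 -> mean_zero B D2.
Proof.
move=> mB mD2 D12 D10.
apply: (@mean_zero_lim B (fun=> D1) D2 (Num.norm \o D1)) => //.
- by apply: filterS D12 => w Hw Bw; rewrite Hw//; exact: cvg_cst.
- by apply: integrable_norm; exact: D10.1.
- exact: aeW.
Qed.

Lemma mean_zeroZ B (c : R) (D : S -> R) : measurable B ->
  mean_zero B D -> mean_zero B (fun w => c * D w).
Proof.
move=> mB [i1 e1]; split; first exact: (integrableZl mB c i1).
transitivity (\int[m]_(w in B) (c%:E * (EFin \o D) w))%E => //.
by rewrite integralZl//= e1 mule0.
Qed.

(** A bounded weight phi is approximated by combinations of the indicators of the
    sets {k/(n+1) <= phi + C < (k+1)/(n+1)}, which are test events; the limit is
    dominated by (C + 1)|D|. *)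
Lemma mean_zero_weight (FF : set (set S)) (phi D : S -> R) (B : set S) (C : R) :
  (forall A, FF A -> measurable A) ->
  (forall A A', FF A -> FF A' -> FF (A `&` A')) ->
  (forall Y : set R, measurable Y -> FF (phi @^-1` Y)) ->
  (forall w, `|phi w| <= C) -> FF B ->
  (forall A, FF A -> A `<=` B -> mean_zero A D) ->
  mean_zero B (fun w => phi w * D w).
Proof.
move=> FFm FFI FFphi phiC FB D0.
have mB := FFm _ FB.
have n0 n : (0 : R) < n.+1%:R by rewrite ltr0n.
have mphi : measurable_fun setT phi by move=> _ Y mY; rewrite setTI; apply: FFm; exact: FFphi.
have phiC0 w : 0 <= phi w + C by have := phiC w; rewrite ler_norml; lra.
have DB := D0 _ FB (fun=> id).
pose k_ n w := Num.truncn ((phi w + C) * n.+1%:R).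
pose phi_ n w : R := (k_ n w)%:R / n.+1%:R - C.
have phi_near n w : `|phi_ n w - phi w| <= n.+1%:R^-1.
  have ge0 : 0 <= (phi w + C) * n.+1%:R by rewrite mulr_ge0// ltW.
  have /andP[k1 k2] := truncn_itv ge0; rewrite -/(k_ n w) in k1 k2.
  have {}k1 : (k_ n w)%:R / n.+1%:R <= phi w + C by rewrite ler_pdivrMr.
  have {}k2 : phi w + C < (k_ n w)%:R / n.+1%:R + n.+1%:R^-1.
    rewrite (_ : _ + _^-1 = (k_ n w).+1%:R / n.+1%:R) ?ltr_pdivlMr//.
    by rewrite -(natr1 (k_ n w)) mulrDl mul1r.
  rewrite ler_norml /phi_; move: k1 k2; set a := (k_ n w)%:R / _; set b := _^-1 => k1 k2.
  by apply/andP; split; lra.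
have invn n : (n.+1%:R^-1 : R) <= 1 by rewrite invf_le1// ler1n.
apply: (@mean_zero_lim B (fun n w => phi_ n w * D w) _ (fun w => (C + 1) * `|D w|)) => //.
- move=> n; pose K := (Num.truncn ((C + C) * n.+1%:R)).+1.
  pose c (k : nat) : R := k%:R / n.+1%:R - C.
  pose Y (k : nat) : set R := `[k%:R / n.+1%:R - C, k.+1%:R / n.+1%:R - C[%classic.
  have YE w k : (phi @^-1` Y k) w <-> k_ n w = k.
    have ge0 : 0 <= (phi w + C) * n.+1%:R by rewrite mulr_ge0// ltW.
    rewrite /Y/= in_itv/= lerBlDr ltrBrDr ler_pdivrMr// ltr_pdivlMr// -truncn_eq//.
    by split=> /eqP.
  apply: (@mean_zero_eq B (fun w => \sum_(k < K) \1_(phi @^-1` Y k) w * (c k * D w))) => //.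
    move=> w _.
    have kK : (k_ n w < K)%N.
      rewrite ltnS /k_; apply: le_truncn.
      by rewrite ler_pM2r// lerD2r; have := phiC w; rewrite ler_norml => /andP[].
    rewrite (bigD1 (Ordinal kK))//= big1 ?addr0 => [|i ik].
      by rewrite indicE mem_set ?mul1r//; exact/YE.
    rewrite indicE memNset ?mul0r// => /YE E.
    by move/eqP: ik; apply; apply/val_inj; rewrite /= E.
  apply: mean_zero_sum => // k.
  have FY : FF (phi @^-1` Y k) by apply: FFphi; exact: measurable_itv.
  apply: mean_zero_indic => //; first exact: FFm.
  apply: mean_zeroZ; first by apply: FFm; exact: FFI.
  by apply: D0; [exact: FFI|move=> w []].
- apply: measurable_funM; first exact: measurable_funTS.
  by apply/measurable_EFinP; exact: measurable_int DB.1.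
- apply: aeW => w _; apply: cvgM; last exact: cvg_cst.
  apply/cvgrPdist_le => e e0; near=> n.
  rewrite distrC (le_trans (phi_near n w))// ltW//.
  by near: n; exact: near_infty_natSinv_lt (PosNum e0).
- exact: (integrableZl mB (C + 1) (integrable_norm DB.1)).
- apply: aeW => w n _; rewrite normrM ler_wpM2r//.
  rewrite -(subrK (phi w) (phi_ n w)) (le_trans (ler_normD _ _))// addrC.
  by rewrite lerD// (le_trans (phi_near n w)).
Unshelve. all: by end_near. Qed.

End mean_zero.

(** * Optional stopping *)

Section stopping.
Context {R : realType} {T : R} {X : ptopologicalType}.
Local Notation Om := (cadlag_path T X).
Local Notation F I := (<<s @position_gen R T X I >>).
Local Notation Ft t := (<<s @position_gen R T X `[0, t] >>).
Variable Q : {sigma_finite_measure set Om -> \bar R}.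

Lemma position_genI (I : set R) (A B : set Om) : F I A -> F I B -> F I (A `&` B).
Proof. exact: (@measurableI _ (g_sigma_algebraType (position_gen I))). Qed.

Lemma position_genD (I : set R) (A B : set Om) : F I A -> F I B -> F I (A `\` B).
Proof. exact: (@measurableD _ (g_sigma_algebraType (position_gen I))). Qed.

Lemma position_genC (I : set R) (A : set Om) : F I A -> F I (~` A).
Proof. exact: (@measurableC _ (g_sigma_algebraType (position_gen I))). Qed.

Lemma position_gen_le (s t : R) : s <= t -> Ft s `<=` Ft t.
Proof. by move=> st; apply: position_gen_sub; apply: subset_itvl; rewrite bnd_simp. Qed.

Lemma position_gen_le_measurable (t : R) (A : set Om) : t <= T -> Ft t A -> measurable A.
Proof. by move=> tT; apply: position_gen_measurable; apply: subset_itvl; rewrite bnd_simp. Qed.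

(** Cut [s,t] into k+1 equal steps and let g be the first grid point after sigma. On the event
    that sigma lies in a given step, known at its right endpoint, M_t - M_g has
    zero integral. As k grows, g decreases to sigma and M_g tends to M_sigma.
    The events G_r, known at time r, serve to bound M at the grid points: they
    are only asked to hold just after sigma, which suffices in the limit. *)
Lemma martingale_stop (M : R -> Om -> R) (sigma : Om -> R) (G : R -> set Om)
    (s t c : R) (B : set Om) :
  0 <= s -> s <= t -> t <= T ->
  (forall r, s <= r <= t -> measurable_fun setT (M r)) ->
  (forall r, s <= r <= t -> forall A, Ft r A -> (Q A < +oo)%E ->
     mean_zero Q A (fun w => M t w - M r w)) ->
  Q.-integrable B (EFin \o M t) ->
  (forall r, s <= r <= t -> Ft r [set w | sigma w < r]) ->
  (forall r, s <= r <= t -> Ft r (G r)) ->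
  (forall r w, s <= r <= t -> G r w -> `|M r w| <= c) ->
  {ae Q, forall w, s <= sigma w < t ->
     M r w @[r --> (sigma w)^'+] --> M (sigma w) w /\ \forall r \near (sigma w)^'+, G r w} ->
  measurable_fun setT (fun w => M (Num.min (sigma w) t) w) ->
  Ft s B -> (Q B < +oo)%E -> (forall w, B w -> s <= sigma w) ->
  mean_zero Q B (fun w => M t w - M (Num.min (sigma w) t) w).
Proof.
move=> s0 st tT mM marM Mti sigF GF GM rcM mMs FB QB Bs.
have sT := le_trans st tT.
have mB : measurable B by apply: position_gen_le_measurable FB.
move: (st); rewrite le_eqVlt => /predU1P[est|slt].
  apply: mean_zero_eq (mean_zero0 Q B) => // w /Bs sw.
  by rewrite min_r ?subrr// -est.
have dlt0 : 0 < t - s by rewrite subr_gt0.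
have k0 k : (0 : R) < k.+1%:R by rewrite ltr0n.
pose dt k : R := (t - s) / k.+1%:R.
have dt0 k : 0 < dt k by rewrite divr_gt0.
pose g k (i : nat) : R := s + i%:R * dt k.
have g_le k i : (i <= k.+1)%N -> s <= g k i <= t.
  move=> ik; rewrite /g lerDl mulr_ge0 ?(ltW (dt0 k))//= -lerBrDl.
  rewrite /dt mulrA ler_pdivrMr// mulrC ler_pM2l//.
  by rewrite ler_nat.
have g_mono k i j : (i <= j)%N -> g k i <= g k j.
  by move=> ij; rewrite lerD2l ler_pM2r// ler_nat.
have mGr r : s <= r <= t -> measurable (G r).
  by move=> srt; apply: (@position_gen_le_measurable r) (GF _ srt); case/andP: srt => _ /le_trans; apply.
(* sigma lies in the i-th step, and M is bounded at its right endpoint. *)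
pose C k i : set Om := ([set w | sigma w < g k i.+1] `\` [set w | sigma w < g k i]) `&` G (g k i.+1).
have FC k (i : 'I_k.+1) : Ft (g k i.+1) (C k i).
  apply: position_genI; last by apply: GF; exact: g_le.
  apply: position_genD; first by apply: sigF; exact: g_le.
  apply: (@position_gen_le (g k i)); first exact: g_mono.
  by apply: sigF; apply: g_le; rewrite ltnW.
have mC k (i : 'I_k.+1) : measurable (C k i).
  by apply: position_gen_le_measurable (FC k i); have /andP[_ /le_trans] := g_le k _ (ltn_ord i); apply.
pose D k w := \sum_(i < k.+1) \1_(C k i) w * (M t w - M (g k i.+1) w).
pose idx k w := Num.truncn ((sigma w - s) / dt k).
have idxP k w : s <= sigma w -> g k (idx k w) <= sigma w < g k (idx k w).+1.
  move=> sw; have ge0 : 0 <= (sigma w - s) / dt k by rewrite divr_ge0 ?subr_ge0// ltW.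
  have := truncn_itv ge0; rewrite -/(idx k w) ler_pdivlMr// ltr_pdivrMr// => /andP[h1 h2].
  by rewrite /g -lerBrDl h1 -ltrBlDl.
have C_idx k (i : nat) w : s <= sigma w -> C k i w -> i = idx k w.
  move=> sw [[/= w1 /negP]]; rewrite -leNgt => w2 _.
  have /andP[i1 i2] := idxP k w sw.
  apply/eqP; rewrite eqn_leq -ltnS -[(idx k w <= i)%N]ltnS; apply/andP; split.
    rewrite ltnNge; apply/negP => /(g_mono k) h.
    by have := lt_le_trans i2 (le_trans h w2); rewrite ltxx.
  rewrite ltnNge; apply/negP => /(g_mono k) h.
  by have := lt_le_trans w1 (le_trans h i1); rewrite ltxx.
(* If sigma is at least t there is nothing to stop, and no step contains it. *)
have D_ge k w : t <= sigma w -> D k w = 0.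
  move=> tw; rewrite /D big1// => i _; rewrite indicE memNset ?mul0r//.
  move=> [[/= w1 _] _]; have /andP[_ h] := g_le k _ (ltn_ord i).
  by have := lt_le_trans w1 (le_trans h tw); rewrite ltxx.
have D_lt k w : s <= sigma w -> sigma w < t ->
    D k w = \1_(G (g k (idx k w).+1)) w * (M t w - M (g k (idx k w).+1) w).
  move=> sw wt; have /andP[i1 i2] := idxP k w sw.
  have ik : (idx k w < k.+1)%N.
    rewrite ltnNge; apply/negP => /(g_mono k).
    rewrite {1}/g /dt mulrC divfK ?gt_eqF// addrC subrK => h.
    by have := lt_le_trans wt (le_trans h i1); rewrite ltxx.
  rewrite /D (bigD1 (Ordinal ik))//= big1 ?addr0 => [|i ii].
    congr (_ * _); apply: eq_indic; split=> [[]//|Gw]; split => //; split => //=.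
    by apply/negP; rewrite -leNgt.
  rewrite indicE memNset ?mul0r// => /C_idx -/(_ sw) E.
  by move/eqP: ii; apply; apply/val_inj.
have dt_cvg : dt k @[k --> \oo] --> 0.
  rewrite -[X in _ --> X](mulr0 (t - s)); apply: cvgM; first exact: cvg_cst.
  exact: cvg_harmonic.
have g_near k w : s <= sigma w -> sigma w < g k (idx k w).+1 <= sigma w + dt k.
  move=> sw; have /andP[i1 ->] := idxP k w sw.
  by rewrite /= /g -natr1 mulrDl mul1r addrA lerD2r.
apply: (@mean_zero_lim _ _ _ Q B D (fun w => M t w - M (Num.min (sigma w) t) w) (fun w => `|M t w| + `|c|)) => //.
- move=> k; apply: mean_zero_sum => // i; apply: mean_zero_indic => //.
  apply: marM; first exact: g_le.
    apply: position_genI => //; apply: position_gen_le FB.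
    by have /andP[] := g_le k _ (ltn_ord i).
  apply: le_lt_trans QB; apply: le_measure; rewrite ?inE//; first exact: measurableI.
- apply: measurable_funTS; apply: measurable_funB => //.
  by apply: mM; rewrite st lexx.
- apply: filterS rcM => w rcw Bw; have sw := Bs _ Bw.
  have [tw|wt] := leP t (sigma w).
    by rewrite subrr (_ : D^~ w = cst 0); [exact: cvg_cst|apply/funext => k; exact: D_ge].
  have [] := rcw; first by rewrite sw.
  move=> Mc Gnear.
  have gc : g k (idx k w).+1 @[k --> \oo] --> (sigma w)^'+.
    move=> A [e /= e0 eA].
    have /cvgrPdist_lt /(_ _ e0) := dt_cvg; apply: filterS => k; rewrite sub0r normrN => dke.
    have /andP[h1 h2] := g_near k w sw.
    apply: eA => //=; rewrite ltr0_norm ?subr_lt0// opprB ltrBlDl.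
    by apply: le_lt_trans h2 _; rewrite ltrD2l (le_lt_trans _ dke)// ler_norm.
  have Mgc := cvg_comp _ _ gc Mc.
  have Ggc := gc _ Gnear.
  have : (M t w - M (g k (idx k w).+1) w) @[k --> \oo] --> M t w - M (sigma w) w.
    by apply: cvgB => //; exact: cvg_cst.
  apply: cvg_trans; apply: near_eq_cvg; near=> k.
  rewrite D_lt// indicE mem_set ?mul1r//.
  by near: k.
- apply: (@integrableD _ _ _ _ _ mB (EFin \o (Num.norm \o M t)) (EFin \o cst `|c|)).
    exact: integrable_norm.
  apply: measurable_bounded_integrable => //.
  exists `|c|; split; first exact: num_real.
  by move=> x cx w _ /=; rewrite normr_id; exact: ltW.
- apply: aeW => w k Bw; have sw := Bs _ Bw.
  have [tw|wt] := leP t (sigma w); first by rewrite D_ge// normr0 addr_ge0.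
  rewrite D_lt// indicE; have [/set_mem Gw|_] := boolP (w \in _); last first.
    by rewrite mul0r normr0 addr_ge0.
  rewrite mul1r (le_trans (ler_normB _ _))// lerD2l (le_trans _ (ler_norm c))//.
  apply: GM Gw; have /andP[h1 _] := g_near k w sw.
  rewrite (le_trans sw (ltW h1))/=.
  have ik : (idx k w < k.+1)%N.
    rewrite ltnNge; apply/negP => /(g_mono k).
    rewrite {1}/g /dt mulrC divfK ?gt_eqF// addrC subrK => h.
    have /andP[i1 _] := idxP k w sw.
    by have := lt_le_trans wt (le_trans h i1); rewrite ltxx.
  by have /andP[] := g_le k _ ik.
Unshelve. all: by end_near. Qed.

End stopping.

(** * Processes cut to the time interval *)

Section observables.
Context {R : realType} {T : R} {X : ptopologicalType}.
Hypothesis T_gt0 : 0 < T.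
Local Notation Om := (cadlag_path T X).
Local Notation TR := (measurableTypeR R).
Local Notation mu := (@lebesgue_measure R).
Variable Q : {sigma_finite_measure set Om -> \bar R}.

(** Processes are only meaningful on [0,T]; extended by 0 they are jointly
    measurable on the whole line, and can be averaged and shifted in time. *)
Definition time_cut (K : R -> Om -> R) (t : R) (w : Om) : R :=
  if 0 <= t <= T then K t w else 0.

Lemma time_cutE (K : R -> Om -> R) t w : 0 <= t <= T -> time_cut K t w = K t w.
Proof. by rewrite /time_cut => ->. Qed.

Lemma measurable_time_cut (K : R -> Om -> R) : measurable_process `[0, T] K ->
  measurable_fun setT (fun p : TR * Om => time_cut K p.1 p.2).
Proof.
move=> mK.
have mD : measurable (`[0, T] `*` setT : set (TR * Om)) by exact: measurableX.
rewrite (_ : (fun p => _) = (fun p : TR * Om => K p.1 p.2) \_ (`[0, T] `*` setT)).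
  apply/(measurable_restrict _ mD measurableT); rewrite setTI; exact: mK.
apply/funext => p; rewrite patchE /time_cut.
by congr (if _ then _ else _); apply/idP/idP => [h|]; [rewrite inE/=; split|rewrite inE/= in_itv => -[]]; rewrite ?in_itv.
Qed.

Lemma time_cut_integral (K : R -> Om -> R) a b w : 0 <= a -> b <= T ->
  \int[mu]_(s in `[a, b]) time_cut K s w = \int[mu]_(s in `[a, b]) K s w.
Proof.
move=> a0 bT; apply: eq_Rintegral => s; rewrite inE/= in_itv/= => /andP[sa sb].
by rewrite time_cutE// (le_trans a0 sa) (le_trans sb bT).
Qed.

(** The times outside [0,T] carry no information on a path: X_t = X_(clamp t). *)
Definition clamp (t : R) : R := Num.max 0 (Num.min t T).

Lemma clampP t : 0 <= clamp t <= T.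
Proof. by rewrite /clamp le_max lexx/= ge_max ge_min lexx orbT ltW. Qed.

Lemma path_clamp t (w : Om) : path_fun w t = path_fun w (clamp t).
Proof.
rewrite /clamp; have [_ _ w0 wT] := cadlag_pathP w.
have [tT|Tt] := leP t T.
  by have [t0|t0] := leP t 0; [rewrite w0|].
by have [|_] := leP T 0; [rewrite leNgt T_gt0|rewrite wT// ltW].
Qed.

Lemma position_measurable_comp (I : set R) (u : X -> R) t : I t ->
  measurable_fun setT (u : borel X -> R) ->
  position_measurable I (fun w : Om => u (position t w)).
Proof.
move=> It mu_ _ A mA; rewrite setTI; apply: sub_sigma_algebra.
exists t => //; exists (u @^-1` A) => //; last by rewrite setTI.
by rewrite -[X in measurable X]setTI; exact: mu_.
Qed.

Lemma measurable_comp_position (u : X -> R) t : measurable_fun setT (u : borel X -> R) ->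
  measurable_fun setT (fun w : Om => u (position t w)).
Proof.
move=> mu_.
rewrite (_ : (fun w : Om => _) = (fun w : Om => u (position (clamp t) w))).
  apply: (@position_measurable_measurable _ _ _ `[0, T]) => //.
  by apply: position_measurable_comp => //; rewrite /= in_itv/= clampP.
by apply/funext => w; rewrite /position path_clamp.
Qed.

Lemma measurable_observable (u : X -> R) : measurable_fun setT (u : borel X -> R) ->
  continuous u -> measurable_fun setT (fun p : TR * Om => u (position p.1 p.2)).
Proof.
move=> mu_ cu.
apply: (measurable_right_continuous (f := fun t (w : Om) => u (position t w))).
  by move=> t; exact: measurable_comp_position.
by move=> w t; apply: continuous_cvg; [exact: cu|exact: path_right_cvg].
Qed.

Lemma stopping_time_measurable (tau : Om -> R) t : 0 <= t <= T -> stopping_time tau ->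
  measurable_fun setT (fun w => Num.min (tau w) t).
Proof.
move=> /andP[t0 tT] [tau0 Ftau].
apply: (measurability (@RGenOInfty.G R)); first exact: RGenOInfty.measurableE.
move=> _ [_ [x ->] <-]; rewrite setTI.
have [tx|xt] := leP t x.
  rewrite (_ : _ @^-1` _ = set0); first exact: measurable0.
  by apply/seteqP; split=> // w /=; rewrite in_itv/= andbT lt_min (ltNge x t) tx andbF.
have [x0|x0] := ltP x 0.
  rewrite (_ : _ @^-1` _ = setT); first exact: measurableT.
  by apply/seteqP; split=> // w _ /=; rewrite in_itv/= andbT lt_min xt andbT (lt_le_trans x0).
rewrite (_ : _ @^-1` _ = ~` [set w | tau w <= x]).
  apply: measurableC; apply: (@position_gen_le_measurable _ _ _ x).
    exact: le_trans (ltW xt) tT.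
  by apply: Ftau; rewrite x0 (le_trans (ltW xt)).
by apply/seteqP; split=> w /=; rewrite in_itv/= andbT lt_min xt andbT ltNge => /negP.
Qed.

End observables.

(** * The clock of an adapted process *)

Section clock.
Context {R : realType} {T : R} {X : ptopologicalType}.
Hypothesis T_gt0 : 0 < T.
Local Notation Om := (cadlag_path T X).
Local Notation TR := (measurableTypeR R).
Local Notation mu := (@lebesgue_measure R).
Local Notation Ft t := (<<s @position_gen R T X `[0, t] >>).
Variable Q : {sigma_finite_measure set Om -> \bar R}.

Lemma measurable_process_section (K : R -> Om -> R) (w : Om) :
  measurable_process `[0, T] K -> measurable_fun `[0, T] (fun s : TR => K s w).
Proof.
move=> /measurable_time_cut mK.
have := measurableT_comp mK (measurable_pair2 w).
move=> /(measurable_funS measurableT (@subsetT _ `[0, T])).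
by apply: eq_measurable_fun => s; rewrite inE/= in_itv/= => h; rewrite time_cutE.
Qed.

Variable kappa : R -> Om -> R.
Hypothesis kappa_ge0 : forall t w, 0 <= kappa t w.
Hypothesis kappa_adapted : adapted_process kappa.

Definition clock (r : R) (w : Om) : \bar R :=
  (\int[mu]_(s in `[0%R, r]) (kappa s w)%:E)%E.

Let kappa_section w r : r <= T -> measurable_fun `[0, r] (fun s : TR => (kappa s w)%:E).
Proof.
move=> rT; apply/measurable_EFinP.
apply: measurable_funS (measurable_process_section w kappa_adapted.1) => //.
by apply: subset_itvl; rewrite bnd_simp.
Qed.

(** An instance of [adapted_integral_measurable]: kappa at time s is a function
    of the path up to s. *)
Lemma clock_adapted (r : R) : 0 <= r <= T ->
  measurable_fun setT (clock r : g_sigma_algebraType (@position_gen R T X `[0, r]) -> \bar R).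
Proof.
move=> /andP[r0 rT].
have mK : measurable_fun setT (fun p : TR * Om => (time_cut kappa p.1 p.2)%:E).
  by apply/measurable_EFinP; exact: measurable_time_cut kappa_adapted.1.
have := adapted_integral_measurable (K := fun s w => (time_cut kappa s w)%:E) mK _ _ r0.
move=> H; have {H} := H _ _.
have h1 : (forall s (w : Om), 0 <= (time_cut kappa s w)%:E)%E.
  by move=> s w; rewrite lee_fin /time_cut; case: ifP.
have h2 s (w w' : Om) : 0 <= s <= r ->
    (forall q, 0 <= q <= s -> path_fun w q = path_fun w' q) ->
    (time_cut kappa s w)%:E = (time_cut kappa s w')%:E.
  move=> /andP[s0 sr] ww'; have sT : 0 <= s <= T by rewrite s0 (le_trans sr).
  rewrite !time_cutE//; congr EFin.
  apply: (position_measurable_eq _ (kappa_adapted.2 _ sT)) => q; rewrite /= in_itv/=.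
  exact: ww'.
move=> /(_ h1 h2); apply: eq_measurable_fun => w _ /=.
apply: eq_integral => s; rewrite inE/= in_itv/= => /andP[s0 sr].
by rewrite time_cutE// s0 (le_trans sr).
Qed.

Lemma clock_measurable (r : R) (Y : set (\bar R)) : 0 <= r <= T -> measurable Y ->
  Ft r (clock r @^-1` Y).
Proof. by move=> /clock_adapted mv mY; rewrite -[X in smallest _ _ X]setTI; exact: mv. Qed.

Lemma le_clock (r r' : R) w : r <= r' -> r' <= T -> (clock r w <= clock r' w)%E.
Proof.
move=> rr' r'T; apply: ge0_subset_integral => //.
- exact: kappa_section.
- by move=> s _; rewrite lee_fin.
- by apply: subset_itvl; rewrite bnd_simp.
Qed.

Lemma clock_integrable (K : R -> Om -> R) (r : R) w : measurable_process `[0, T] K ->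
  (forall t w, 0 <= t <= T -> `|K t w| <= kappa t w) ->
  r <= T -> (clock r w < +oo)%E ->
  mu.-integrable `[0, r] (EFin \o (K ^~ w)).
Proof.
move=> mK Kk rT vr.
have sub : `[0, r] `<=` (`[0, T] : set R) by apply: subset_itvl; rewrite bnd_simp.
have ki : mu.-integrable `[0, r] (EFin \o (kappa ^~ w)).
  apply/integrableP; split; first exact: kappa_section.
  rewrite (le_lt_trans _ vr)// /clock le_eqVlt; apply/orP; left; apply/eqP.
  by apply: eq_integral => s _ /=; rewrite ger0_norm.
apply: le_integrable ki => //.
- apply/measurable_EFinP; apply: measurable_funS sub (measurable_process_section w mK) => //.
- move=> s /sub; rewrite /= in_itv/= => /Kk h.
  by rewrite lee_fin (le_trans (h w))// ler_norm.
Qed.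

Lemma clock_bound (K : R -> Om -> R) (r : R) (N : R) w : measurable_process `[0, T] K ->
  (forall t w, 0 <= t <= T -> `|K t w| <= kappa t w) ->
  r <= T -> (clock r w <= N%:E)%E -> `|\int[mu]_(s in `[0, r]) K s w| <= N.
Proof.
move=> mK Kk rT vr.
have vfin : (clock r w < +oo)%E by apply: le_lt_trans vr _; rewrite ltry.
have Ki := clock_integrable mK Kk rT vfin.
rewrite -lee_fin; apply: le_trans vr.
rewrite EFin_normr_Rintegral//; apply: le_trans (le_abse_integral _ _ _) _ => //.
  exact: measurable_int Ki.
apply: ge0_le_integral => //.
- by apply: measurableT_comp => //; exact: measurable_int Ki.
- exact: kappa_section.
- move=> s; rewrite /= in_itv/= => /andP[s0 sr]; rewrite lee_fin.
  by apply: Kk; rewrite s0 (le_trans sr).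
Qed.

Lemma clock_fine (r : R) w : r <= T -> (clock r w < +oo)%E ->
  clock r w = (\int[mu]_(s in `[0, r]) kappa s w)%:E.
Proof.
move=> rT vr; rewrite /Rintegral fineK// ge0_fin_numE//.
by apply: integral_ge0 => s _; rewrite lee_fin.
Qed.

End clock.

(** * Stopping a local martingale *)

Section local_martingale_stop.
Context {R : realType} {T : R} {X : ptopologicalType}.
Local Notation Om := (cadlag_path T X).
Local Notation Ft t := (<<s @position_gen R T X `[0, t] >>).
Variable Q : {sigma_finite_measure set Om -> \bar R}.

(** Apply [martingale_stop] to each stopped martingale, at the time sigma; then
    let the localizing times reach T. The bound by c on G makes the limit
    dominated. *)
Lemma local_martingale_stop (M : R -> Om -> R) (sigma : Om -> R) (G : R -> set Om)
    (s t c : R) (B : set Om) :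
  local_martingale Q M ->
  0 <= s -> s <= t -> t <= T ->
  (forall rho : Om -> R, measurable_fun setT rho -> (forall w, rho w <= T) ->
    measurable_fun setT (fun w => M (rho w) w)) ->
  measurable_fun setT sigma ->
  (forall r, s <= r <= t -> Ft r [set w | sigma w < r]) ->
  (forall r, s <= r <= t -> Ft r (G r)) ->
  (forall q r w, 0 <= q -> q <= r -> r <= t -> G r w -> `|M q w| <= c) ->
  {ae Q, forall w, s <= sigma w < t ->
     M r w @[r --> (sigma w)^'+] --> M (sigma w) w /\ \forall r \near (sigma w)^'+, G r w} ->
  {ae Q, forall w, s <= sigma w -> G (Num.min (sigma w) t) w} ->
  Ft s B -> (Q B < +oo)%E -> (forall w, B w -> s <= sigma w) ->
  mean_zero Q B (fun w => M (Num.min (sigma w) t) w - M s w).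
Proof.
move=> [tau [stau tau_mono tau_T mtau]] s0 st tT mM msig sigF GF GM rcM GS FB QB Bs.
have sT := le_trans st tT.
have t0 := le_trans s0 st.
have mB : measurable B by apply: position_gen_le_measurable FB.
have mmin : measurable_fun setT (fun w => Num.min (sigma w) t) by exact: measurable_minr.
have mminr n r : 0 <= r <= T -> measurable_fun setT (fun w => Num.min (tau n w) r).
  by move=> rT; apply: stopping_time_measurable.
have mmin2 n : measurable_fun setT (fun w => Num.min (tau n w) (Num.min (sigma w) t)).
  have h : (fun w => Num.min (tau n w) (Num.min (sigma w) t)) =
           (fun w => Num.min (Num.min (tau n w) t) (sigma w)).
    by apply/funext => w; rewrite minA minAC.
  by rewrite h; apply: measurable_minr => //; apply: mminr; rewrite t0.
have mar n r r' : 0 <= r -> r <= r' -> r' <= T -> forall A, Ft r A -> (Q A < +oo)%E ->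
    mean_zero Q A (fun w => stopped (tau n) M r' w - stopped (tau n) M r w).
  move=> r0 rr' r'T A FA QA; have [_ ce] := mtau n.
  have [i1 i2 e] := (ce _ _ r0 rr' r'T).2 A FA QA.
  have mA : measurable A by apply: position_gen_le_measurable FA; exact: le_trans r'T.
  exact: (@mean_zero_sub _ _ _ Q A (stopped (tau n) M r') (stopped (tau n) M r) mA i1 i2 (esym e)).
have key n : mean_zero Q B (fun w => stopped (tau n) M (Num.min (sigma w) t) w - stopped (tau n) M s w).
  have h1 := mar n s t s0 st tT B FB QB.
  have h2 : mean_zero Q B (fun w => stopped (tau n) M t w
      - stopped (tau n) M (Num.min (sigma w) t) w).
    apply: (@martingale_stop _ _ _ Q (stopped (tau n) M) sigma G s t c) => //.
    - move=> r /andP[sr rt]; apply: mM; first by apply: mminr; rewrite (le_trans s0) ?(le_trans rt).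
      by move=> w; rewrite ge_min (le_trans rt tT) orbT.
    - by move=> r /andP[sr rt] A FA QA; apply: mar => //; exact: le_trans sr.
    - have [it _] := mtau n; have [_ iM] := it t (introT andP (conj t0 tT)).
      exact: (integrableS measurableT mB _ iM).
    - move=> r w /andP[sr rt] Gr; apply: (GM _ r) => //.
      + by rewrite le_min (stau n).1 (le_trans s0).
      + by rewrite ge_min lexx orbT.
    - apply: filterS rcM => w rcw swt; have [Mc Gn] := rcw swt; split => //.
      rewrite /stopped; have [tw|wt] := leP (tau n w) (sigma w).
        apply: cvg_near_cst; near=> r; rewrite min_l// (le_trans tw)//.
      apply: cvg_trans Mc; apply: near_eq_cvg; near=> r; rewrite min_r//.
      by near: r; exact: nbhs_right_le.
    - by apply: mM; [exact: mmin2|move=> w; rewrite !ge_min tT !orbT].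
  have := mean_zeroB mB h1 h2; apply: mean_zero_eq => // w _; ring.
apply: (@mean_zero_lim _ _ _ Q B (fun n w => stopped (tau n) M (Num.min (sigma w) t) w - stopped (tau n) M s w)
  (fun w => M (Num.min (sigma w) t) w - M s w) (cst (`|c| + `|c|))) => //.
- apply: measurable_funTS; apply: measurable_funB.
    by apply: mM => // w; rewrite ge_min tT orbT.
  by apply: (mM (cst s)) => // w.
- apply: filterS tau_T => w [n0 Tn0] Bw.
  apply: cvg_near_cst; exists n0 => // n /= n0n.
  have Tn : T <= tau n w by apply: le_trans Tn0 _; exact: tau_mono.
  have h1 : Num.min (sigma w) t <= tau n w by rewrite ge_min (le_trans tT Tn) orbT.
  by rewrite /stopped (min_r h1) (min_r (le_trans sT Tn)).
- apply: measurable_bounded_integrable => //.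
  exists (`|c| + `|c|); split; first exact: num_real.
  by move=> x cx w _ /=; rewrite ger0_norm ?addr_ge0// ltW.
- apply: filterS GS => w Gw n Bw; have sw := Bs _ Bw; have {}Gw := Gw sw.
  have m0 : 0 <= Num.min (sigma w) t by rewrite le_min (le_trans s0 sw) (le_trans s0 st).
  have mt : Num.min (sigma w) t <= t by rewrite ge_min lexx orbT.
  have bnd q : 0 <= q -> q <= Num.min (sigma w) t -> `|M q w| <= `|c|.
    by move=> q0 qm; rewrite (le_trans (GM _ _ _ q0 qm mt Gw))// ler_norm.
  rewrite (le_trans (ler_normB _ _))// /stopped lerD// bnd//.
  - by rewrite le_min (stau n).1.
  - by rewrite ge_min lexx orbT.
  - by rewrite le_min (stau n).1.
  - by rewrite ge_min; apply/orP; right; rewrite le_min sw.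
Unshelve. all: by end_near. Qed.

End local_martingale_stop.

Section generator_stop.
Context {R : realType} {T : R} {X : ptopologicalType}.
Hypothesis T_gt0 : 0 < T.
Local Notation Om := (cadlag_path T X).
Local Notation TR := (measurableTypeR R).
Local Notation mu := (@lebesgue_measure R).
Local Notation Ft t := (<<s @position_gen R T X `[0, t] >>).
Variable Q : {sigma_finite_measure set Om -> \bar R}.

Lemma measurable_process_integral (K : R -> Om -> R) (a b : Om -> R) :
  measurable_process `[0, T] K ->
  measurable_fun setT a -> measurable_fun setT b ->
  (forall w, 0 <= a w) -> (forall w, b w <= T) ->
  measurable_fun setT (fun w => \int[mu]_(s in `[a w, b w]) K s w).
Proof.
move=> mK ma mb a0 bT.
have mp : measurable_fun setT (fun w : Om => ((a w, b w), w) : (TR * TR) * Om).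
  by do 2 apply/measurable_fun_pair => //.
have := measurableT_comp (measurable_itv_integral (measurable_time_cut mK)) mp.
move=> /(measurableT_comp (fine_measurable measurableT)).
by apply: eq_measurable_fun => w _; rewrite -time_cut_integral.
Qed.

Lemma measurable_observable_at (u : X -> R) (rho : Om -> R) :
  measurable_fun setT (u : borel X -> R) -> continuous u ->
  measurable_fun setT rho -> measurable_fun setT (fun w => u (position (rho w) w)).
Proof.
move=> mu_ cu mrho.
have mp : measurable_fun setT (fun w : Om => (rho w : TR, w)) by apply/measurable_fun_pair.
exact: (measurableT_comp (measurable_observable T_gt0 mu_ cu) mp).
Qed.

Variable kappa : R -> Om -> R.
Hypothesis kappa_ge0 : forall t w, 0 <= kappa t w.
Hypothesis kappa_adapted : adapted_process kappa.

Lemma clock_right_cvg w a : 0 <= a < T -> (clock kappa T w < +oo)%E ->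
  \int[mu]_(s in `[0, r]) kappa s w @[r --> a^'+] --> \int[mu]_(s in `[0, a]) kappa s w.
Proof.
move=> aT cT; apply: (primitive_right_cvg aT).
apply: (clock_integrable kappa_ge0 kappa_adapted kappa_adapted.1) => // t w' _.
by rewrite ger0_norm.
Qed.

(** On the event that the clock is at most N + 1, known at each time, the local
    martingale of u is bounded by 2C + N + 1, as kappa dominates |Ku|. If the
    clock is at most N at sigma, it stays below N + 1 for a while after sigma,
    which is the condition required by [local_martingale_stop]. *)
Lemma generator_stop (u : X -> R) (K : R -> Om -> R) (C : R) (sigma : Om -> R)
    (N : R) (s t : R) (B : set Om) :
  measurable_fun setT (u : borel X -> R) -> continuous u -> (forall x, `|u x| <= C) ->
  generator_version Q u K ->
  (forall t w, 0 <= t <= T -> `|K t w| <= kappa t w) ->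
  measurable_fun setT sigma -> (forall w, sigma w <= T) ->
  (forall r, 0 <= r <= T -> Ft r [set w | sigma w < r]) ->
  {ae Q, forall w, (clock kappa T w < +oo)%E} ->
  {ae Q, forall w, (clock kappa (sigma w) w <= N%:E)%E} ->
  0 <= s -> s <= t -> t <= T ->
  Ft s B -> (Q B < +oo)%E -> (forall w, B w -> s <= sigma w) ->
  mean_zero Q B (fun w => u (position (Num.min (sigma w) t) w) - u (position s w)
     - \int[mu]_(r in `[s, Num.min (sigma w) t]) K r w).
Proof.
move=> mu_ cu bu [[mK aK] _ lmM] KK msig sigT sigF cT cN s0 st tT FB QB Bs.
have t0 := le_trans s0 st.
have sT := le_trans st tT.
have mB : measurable B by apply: position_gen_le_measurable FB.
have mmin : measurable_fun setT (fun w => Num.min (sigma w) t) by exact: measurable_minr.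
pose M r w := u (position r w) - u (position 0 w) - \int[mu]_(q in `[0, r]) K q w.
have itvT r : s <= r <= t -> 0 <= r <= T.
  by move=> /andP[sr rt]; rewrite (le_trans s0 sr) (le_trans rt tT).
have lint w : (clock kappa T w < +oo)%E -> mu.-integrable `[0, T] (EFin \o (K ^~ w)).
  by apply: (clock_integrable kappa_ge0 kappa_adapted mK KK).
have H : mean_zero Q B (fun w => M (Num.min (sigma w) t) w - M s w).
  apply: (@local_martingale_stop _ _ _ Q M sigma (fun r => [set w | (clock kappa r w <= (N + 1)%:E)%E])
    s t (C + C + (N + 1))).
  - exact: lmM.
  - exact: s0.
  - exact: st.
  - exact: tT.
  - move=> rho mrho rhoT; apply: measurable_funB.
      by apply: measurable_funB; exact: measurable_observable_at.
    by apply: measurable_process_integral.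
  - exact: msig.
  - by move=> r /itvT; exact: sigF.
  - move=> r /itvT rT.
    exact: (clock_measurable kappa_ge0 kappa_adapted rT (emeasurable_itv `]-oo, (N + 1)%:E])).
  - move=> q r w q0 qr rt Gr.
    have Gq : (clock kappa q w <= (N + 1)%:E)%E.
      by apply: le_trans Gr; apply: le_clock => //; exact: le_trans tT.
    have qT : q <= T by rewrite (le_trans qr)// (le_trans rt).
    rewrite /M (le_trans (ler_normB _ _))// lerD//.
      by rewrite (le_trans (ler_normB _ _))// lerD.
    exact: (clock_bound kappa_ge0 kappa_adapted mK KK qT Gq).
  - apply: filterS2 cT cN => w cTw cNw /andP[sw wt].
    have wT : 0 <= sigma w < T by rewrite (le_trans s0 sw) (lt_le_trans wt).
    split.
      apply: cvgB; last exact: (primitive_right_cvg wT (lint w cTw)).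
      apply: cvgB; last exact: cvg_cst.
      by apply: continuous_cvg; [exact: cu|exact: path_right_cvg].
    have := clock_right_cvg wT cTw.
    have cfin r : r <= T -> (clock kappa r w < +oo)%E.
      by move=> rT; apply: le_lt_trans cTw; exact: le_clock.
    have cE r : r <= T -> clock kappa r w = (\int[mu]_(s in `[0, r]) kappa s w)%:E.
      by move=> rT; apply: clock_fine => //; exact: cfin.
    have : \int[mu]_(s in `[0, sigma w]) kappa s w < N + 1.
      by rewrite -lte_fin -cE// (le_lt_trans cNw)// lte_fin ltrDl.
    move=> lN /cvgr_lt /(_ _ lN) near_lt; near=> r.
    rewrite /= cE; last by near: r; apply: nbhs_right_le; case/andP: wT.
    by rewrite lee_fin ltW//; near: r.
  - apply: filterS cN => w cNw sw /=.
    apply: (@le_trans _ _ N%:E); last by rewrite lee_fin lerDl.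
    by apply: le_trans cNw; apply: le_clock => //; rewrite ge_min lexx.
  - exact: FB.
  - exact: QB.
  - exact: Bs.
apply: mean_zero_ae_eq H => //.
  apply: measurable_funTS; apply: measurable_funB.
    by apply: measurable_funB; apply: measurable_observable_at.
  by apply: measurable_process_integral => // w; rewrite ge_min tT orbT.
apply: filterS cT => w cTw Bw.
rewrite -(@primitiveB _ T s _ (K ^~ w)) //; last 3 first.
- by rewrite le_min (Bs _ Bw).
- by rewrite ge_min tT orbT.
- exact: lint.
by rewrite /M; ring.
Unshelve. all: by end_near. Qed.

End generator_stop.

(** * Exit times of a clock *)

Section exit_time.
Context {R : realType} {T : R} {X : ptopologicalType}.
Hypothesis T_gt0 : 0 < T.
Local Notation Om := (cadlag_path T X).
Local Notation mu := (@lebesgue_measure R).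
Local Notation Ft t := (<<s @position_gen R T X `[0, t] >>).
Variable Q : {sigma_finite_measure set Om -> \bar R}.
Variable kappa : R -> Om -> R.
Hypothesis kappa_ge0 : forall t w, 0 <= kappa t w.
Hypothesis kappa_adapted : adapted_process kappa.

(** Defined by a supremum over [0,T], hence equal to T if the clock stays below
    N + 1. *)
Definition exit_time (N : nat) (w : Om) : R :=
  sup [set r : R | 0 <= r <= T /\ (clock kappa r w < N.+1%:R%:E)%E].

Let E N w := [set r : R | 0 <= r <= T /\ (clock kappa r w < N.+1%:R%:E)%E].

Let clock0 w : clock kappa 0 w = 0%E.
Proof. by rewrite /clock set_itv1 integral_set1. Qed.

Let E0 N w : E N w 0.
Proof. by rewrite /E /= lexx ltW// clock0 lte_fin ltr0n. Qed.

Let Esup N w : has_sup (E N w).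
Proof. by split; [exists 0; exact: E0|exists T => r [/andP[]]]. Qed.

Lemma exit_time_itv N w : 0 <= exit_time N w <= T.
Proof.
apply/andP; split; first exact: (ub_le_sup (Esup N w).2 (E0 N w)).
by apply: ge_sup; [exists 0; exact: E0|move=> r [/andP[]]].
Qed.

Lemma clock_lt_exit N w r : 0 <= r -> r < exit_time N w -> (clock kappa r w < N.+1%:R%:E)%E.
Proof.
move=> r0 rs.
have [q [/andP[q0 qT] cq] rq] := sup_gt (Esup N w).1 rs.
by apply: le_lt_trans cq; apply: le_clock => //; exact: ltW.
Qed.

Lemma clock_ge_exit N w r : exit_time N w < r -> r <= T -> (N.+1%:R%:E <= clock kappa r w)%E.
Proof.
move=> sr rT; rewrite leNgt; apply/negP => cr.
have : r <= exit_time N w.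
  apply: (ub_le_sup (Esup N w).2); split => //.
  by rewrite rT (le_trans _ (ltW sr))//; have /andP[] := exit_time_itv N w.
by rewrite leNgt sr.
Qed.

Lemma exit_time_lt N w r : r <= T -> exit_time N w < r <->
  exists n, 0 <= r - n.+1%:R^-1 /\ (N.+1%:R%:E <= clock kappa (r - n.+1%:R^-1) w)%E.
Proof.
move=> rT; split=> [sr|[n [n0 cn]]].
  have [n nsr] : exists n, n.+1%:R^-1 < r - exit_time N w.
    have p : 0 < r - exit_time N w by rewrite subr_gt0.
    by have [n _ /(_ n (leqnn n))] := near_infty_natSinv_lt (PosNum p); exists n.
  have sn : exit_time N w < r - n.+1%:R^-1 by rewrite ltrBrDr -ltrBrDl.
  exists n; split.
    by apply: le_trans (ltW sn); have /andP[] := exit_time_itv N w.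
  by apply: clock_ge_exit => //; rewrite lerBlDr (le_trans rT)// lerDl.
apply: (@le_lt_trans _ _ (r - n.+1%:R^-1)); last by rewrite ltrBlDr ltrDl.
rewrite leNgt; apply/negP => /(clock_lt_exit n0).
by rewrite ltNge cn.
Qed.

(** The time is only optional for the raw filtration: it is smaller
    than r when the clock has reached N + 1 at some time r - 1/(n+1). *)
Lemma exit_time_optional N r : 0 <= r <= T -> Ft r [set w | exit_time N w < r].
Proof.
move=> /andP[r0 rT].
pose S n : set Om := [set w | 0 <= r - n.+1%:R^-1 /\
    (N.+1%:R%:E <= clock kappa (r - n.+1%:R^-1) w)%E].
have FS n : Ft r (S n).
  have [n0|n0] := leP 0 (r - n.+1%:R^-1); last first.
    have -> : S n = set0.
      by apply/seteqP; split=> // w []; rewrite leNgt n0.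
    exact: (@measurable0 _ (g_sigma_algebraType (@position_gen R T X `[0, r]))).
  have -> : S n = clock kappa (r - n.+1%:R^-1) @^-1` `[N.+1%:R%:E, +oo%E].
    by apply/seteqP; split=> w; rewrite /S /= in_itv/= leey andbT; [case|split].
  have nr : r - n.+1%:R^-1 <= r by rewrite lerBlDr lerDl.
  apply: (position_gen_le nr).
  by apply: clock_measurable => //; [rewrite n0 (le_trans nr)|exact: emeasurable_itv].
have -> : [set w | exit_time N w < r] = \bigcup_n S n.
  apply/seteqP; split=> w /=; first by move=> /(exit_time_lt _ _ rT)[n hn]; exists n.
  by move=> [n _ hn]; apply/(exit_time_lt _ _ rT); exists n.
exact: (@bigcupT_measurable _ (g_sigma_algebraType (@position_gen R T X `[0, r])) S FS).
Qed.

Lemma measurable_exit_time N : measurable_fun setT (exit_time N).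
Proof.
apply: (measurability (@RGenInftyO.G R)); first exact: RGenInftyO.measurableE.
move=> _ [_ [x ->] <-]; rewrite setTI.
have [xT|Tx] := leP x T; last first.
  rewrite (_ : _ @^-1` _ = setT); first exact: measurableT.
  apply/seteqP; split=> // w _ /=; rewrite in_itv/= (le_lt_trans _ Tx)//.
  by have /andP[] := exit_time_itv N w.
have [x0|x0] := leP 0 x; last first.
  rewrite (_ : _ @^-1` _ = set0); first exact: measurable0.
  apply/seteqP; split=> // w /=; rewrite in_itv/= => /lt_trans /(_ x0).
  by rewrite ltNge; have /andP[->] := exit_time_itv N w.
rewrite (_ : _ @^-1` _ = [set w | exit_time N w < x]); last first.
  by apply/seteqP; split=> w /=; rewrite in_itv.
by apply: (@position_gen_le_measurable _ _ _ x) => //; apply: exit_time_optional; rewrite x0.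
Qed.

Lemma exit_timeE N w : (clock kappa T w < N.+1%:R%:E)%E -> exit_time N w = T.
Proof.
move=> cT; apply/eqP; rewrite eq_le; have /andP[_ ->] /= := exit_time_itv N w.
by apply: (ub_le_sup (Esup N w).2); split => //; rewrite lexx ltW.
Qed.

Lemma le_exit_time N N' w : (N <= N')%N -> exit_time N w <= exit_time N' w.
Proof.
move=> NN'; apply: ge_sup; first by exists 0; exact: E0.
move=> r [rT cr]; apply: (ub_le_sup (Esup N' w).2); split => //.
by apply: lt_le_trans cr _; rewrite lee_fin ler_nat.
Qed.

(** The clock is below N + 1 before the exit time, and it is left-continuous
    because it is finite at T. *)
Lemma clock_exit_le N w : (clock kappa T w < +oo)%E ->
  (clock kappa (exit_time N w) w <= N.+1%:R%:E)%E.
Proof.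
move=> cT; have /andP[] := exit_time_itv N w.
rewrite le_eqVlt => /predU1P[<- _|s0 sT]; first by rewrite clock0 lee_fin.
have cfin r : r <= T -> (clock kappa r w < +oo)%E.
  by move=> rT; apply: le_lt_trans cT; exact: le_clock.
have cE r : r <= T -> clock kappa r w = (\int[mu]_(s in `[0, r]) kappa s w)%:E.
  by move=> rT; apply: clock_fine => //; exact: cfin.
rewrite cE// lee_fin.
have ki : mu.-integrable `[0, T] (EFin \o (kappa ^~ w)).
  apply: (clock_integrable kappa_ge0 kappa_adapted kappa_adapted.1) => // t w' _.
  by rewrite ger0_norm.
have s0T : 0 < exit_time N w <= T by rewrite s0.
rewrite leNgt; apply/negP => lt.
have /cvgr_gt /(_ _ lt) near_gt := primitive_left_cvg s0T ki.
have : \forall r \near (exit_time N w)^'-, False.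
  near=> r.
  have rs : r < exit_time N w by near: r; exact: nbhs_left_lt.
  have r0 : 0 <= r by near: r; exact: nbhs_left_ge.
  have := clock_lt_exit r0 rs; rewrite cE ?(le_trans (ltW rs))// lte_fin.
  by rewrite ltNge ltW//; near: r.
by move=> /filter_ex[].
Unshelve. all: by end_near. Qed.

Lemma exit_time_ae_T : {ae Q, forall w, (clock kappa T w < +oo)%E} ->
  {ae Q, forall w, exists n0, forall n, (n0 <= n)%N -> exit_time n w = T}.
Proof.
apply: filterS => w cT.
have c0 : (0 <= clock kappa T w)%E by apply: integral_ge0 => s _; rewrite lee_fin.
pose x := fine (clock kappa T w).
have cx : clock kappa T w = x%:E by rewrite fineK// ge0_fin_numE.
exists (Num.truncn x) => n xn; apply: exit_timeE; rewrite cx lte_fin.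
apply: (@lt_le_trans _ _ (Num.truncn x).+1%:R); last by rewrite ler_nat.
have x0 : 0 <= x by exact: fine_ge0.
by case/andP: (truncn_itv x0).
Qed.

End exit_time.

Section generator_martingale.
Context {R : realType} {T : R} {X : ptopologicalType}.
Hypothesis T_gt0 : 0 < T.
Local Notation Om := (cadlag_path T X).
Local Notation TR := (measurableTypeR R).
Local Notation mu := (@lebesgue_measure R).
Local Notation Ft t := (<<s @position_gen R T X `[0, t] >>).
Variable Q : {sigma_finite_measure set Om -> \bar R}.

(** The form in which the local martingale property of u is used. As B lies in
    the set where s <= sigma, it can be proved first at the exit times of a
    clock, where the local martingale is bounded, and then at sigma = T. *)
Definition stopped_generator (sigma : Om -> R) (u : X -> R) (K : R -> Om -> R) : Prop :=
  forall s t B, 0 <= s -> s <= t -> t <= T ->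
    Ft s B -> (Q B < +oo)%E -> (forall w, B w -> s <= sigma w) ->
    mean_zero Q B (fun w => u (position (Num.min (sigma w) t) w) - u (position s w)
      - \int[mu]_(r in `[s, Num.min (sigma w) t]) K r w).

Lemma adapted_norm (K : R -> Om -> R) : adapted_process K ->
  adapted_process (fun t w => `|K t w|).
Proof.
move=> [mK aK]; split; first exact: measurableT_comp mK.
by move=> t tT; apply: measurableT_comp (aK t tT).
Qed.

(** When |K| is integrable over B x [0,T], the exit times of its own integral
    can be sent to T by dominated convergence, with bound 2C + int |K|. *)
Lemma stopped_generator_full (u : X -> R) (K : R -> Om -> R) (C : R) :
  measurable_fun setT (u : borel X -> R) -> continuous u -> (forall x, `|u x| <= C) ->
  generator_version Q u K ->
  (forall B, measurable B -> (Q B < +oo)%E ->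
    (\int[Q]_(w in B) \int[mu]_(t in `[0%R, T]) `|K t w|%:E < +oo)%E) ->
  stopped_generator (cst T) u K.
Proof.
move=> mu_ cu bu genK Kint s t B s0 st tT FB QB _.
have [adK cT _] := genK.
have mK := adK.1.
have mB : measurable B by apply: position_gen_le_measurable FB; exact: le_trans tT.
pose kappa t w := `|K t w|.
have k0 t' w : 0 <= kappa t' w by exact: normr_ge0.
have adk : adapted_process kappa by exact: adapted_norm.
pose sg n w := exit_time kappa n w.
pose S n := [set w | s <= sg n w].
have s0T : 0 <= s <= T by rewrite s0 (le_trans st).
have FS n : Ft s (S n).
  rewrite (_ : S n = ~` [set w | sg n w < s]).
    by apply: position_genC; exact: exit_time_optional.
  by apply/seteqP; split=> w; rewrite /S /= leNgt => /negP.
have msg n : measurable_fun setT (sg n) by exact: measurable_exit_time.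
have sgT n w : sg n w <= T by have /andP[] := exit_time_itv T_gt0 kappa n w.
have mS n : measurable (S n) by apply: position_gen_le_measurable (FS n); case/andP: s0T.
pose D n w := \1_(S n) w * (u (position (Num.min (sg n w) t) w) - u (position s w)
      - \int[mu]_(r in `[s, Num.min (sg n w) t]) K r w).
have lint w : (clock kappa T w < +oo)%E -> mu.-integrable `[0, T] (EFin \o (K ^~ w)).
  by apply: (clock_integrable k0 adk mK).
apply: (@mean_zero_lim _ _ _ Q B D (fun w => u (position (Num.min T t) w) - u (position s w)
      - \int[mu]_(r in `[s, Num.min T t]) K r w) (fun w => C + C + fine (clock kappa T w))) => //.
- move=> n; apply: mean_zero_indic => //.
  apply: (generator_stop T_gt0 k0 adk mu_ cu bu genK (N := n.+1%:R)) => //.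
  + by move=> r rT; exact: exit_time_optional.
  + by apply: filterS cT => w; exact: clock_exit_le.
  + exact: position_genI.
  + by apply: le_lt_trans QB; apply: le_measure; rewrite ?inE//; exact: measurableI.
  + by move=> w [].
- apply: measurable_funTS; apply: measurable_funB.
    apply: measurable_funB; last exact: measurable_observable_at.
    by apply: measurable_observable_at => //.
  apply: measurable_process_integral => //.
  by move=> w; rewrite ge_min lexx.
- apply: filterS (exit_time_ae_T T_gt0 k0 cT) => w [n0 sgn] Bw.
  apply: cvg_near_cst; exists n0 => // n /= n0n.
  by rewrite /D /sg (sgn _ n0n) indicE mem_set ?mul1r// /S/= /sg (sgn _ n0n); case/andP: s0T.
- apply: (@integrableD _ _ _ _ _ mB (EFin \o cst (C + C)) (EFin \o (fun w => fine (clock kappa T w)))).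
    apply: measurable_bounded_integrable => //.
    exists `|C + C|; split; first exact: num_real.
    by move=> x cx w _ /=; exact: ltW.
  apply/integrableP; split.
    apply/measurable_EFinP; apply: measurable_funTS.
    apply: (measurableT_comp (fine_measurable measurableT)) => //.
    by move=> _ Y mY; rewrite setTI; apply: (@position_gen_le_measurable _ _ _ T) => //;
      apply: clock_measurable => //; rewrite lexx ltW.
  apply: le_lt_trans (Kint B mB QB); apply: ge0_le_integral => //.
  + apply: measurableT_comp => //; apply/measurable_EFinP; apply: measurable_funTS.
    apply: (measurableT_comp (fine_measurable measurableT)) => //.
    by move=> _ Y mY; rewrite setTI; apply: (@position_gen_le_measurable _ _ _ T) => //;
      apply: clock_measurable => //; rewrite lexx ltW.
  + apply: measurable_funTS.
    by move=> _ Y mY; rewrite setTI; apply: (@position_gen_le_measurable _ _ _ T) => //;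
      apply: (clock_measurable k0) => //; rewrite lexx ltW.
  + move=> w _; have c0 : (0 <= clock kappa T w)%E by apply: integral_ge0 => q _; rewrite lee_fin.
    rewrite /= ger0_norm ?fine_ge0//.
    rewrite -[X in (_ <= X)%E]/(clock kappa T w).
    by case: (clock kappa T w) c0 => [r| |] //=; rewrite leey.
- apply: filterS cT => w cTw n Bw.
  have C0 : 0 <= C by apply: le_trans (bu point).
  have c0 : (0 <= clock kappa T w)%E by apply: integral_ge0 => q _; rewrite lee_fin.
  have i01 : `|\1_(S n) w : R| <= 1 by rewrite indicE; case: (_ \in _); rewrite ?normr1 ?normr0.
  rewrite /D normrM (le_trans (ler_wpM2r (normr_ge0 _) i01))// mul1r.
  rewrite (le_trans (ler_normB _ _))// lerD//.
    by rewrite (le_trans (ler_normB _ _))// lerD.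
  rewrite -lee_fin fineK ?ge0_fin_numE//.
  have sub : `[s, Num.min (sg n w) t] `<=` (`[0, T] : set R).
    move=> q; rewrite /= !in_itv/= le_min => /and3P[q1 q2 _].
    by rewrite (le_trans s0 q1) (le_trans q2).
  have mitv : measurable (`[s, Num.min (sg n w) t] : set TR) by exact: measurable_itv.
  have mT : measurable (`[0, T] : set TR) by exact: measurable_itv.
  have lint' := integrableS mT mitv sub (lint w cTw).
  rewrite EFin_normr_Rintegral//; apply: le_trans (le_abse_integral _ mitv _) _.
    exact: measurable_int lint'.
  apply: ge0_subset_integral => //.
  by apply: measurableT_comp => //; exact: measurable_int (lint w cTw).
Qed.

End generator_martingale.

(** * The energy identity *)

Section tonelli_on.
Context {R : realType} d1 d2 (S1 : measurableType d1) (S2 : measurableType d2).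
Variable m1 : {sigma_finite_measure set S1 -> \bar R}.
Variable m2 : {sigma_finite_measure set S2 -> \bar R}.

Lemma measurable_rectangle_mul (A : set S1) (B : set S2) (f : S1 * S2 -> \bar R) :
  measurable A -> measurable B -> measurable_fun setT f ->
  measurable_fun setT (fun p => f p * (\1_(A `*` B) p)%:E)%E.
Proof.
move=> mA mB mf; apply: emeasurable_funM => //; apply/measurable_EFinP.
by apply: measurable_indic; exact: measurableX.
Qed.

Lemma rectangle_integral_l (A : set S1) (B : set S2) (f : S1 * S2 -> \bar R) :
  (\int[m2]_(y in B) \int[m1]_(x in A) f (x, y) =
   \int[m2]_y \int[m1]_x (f (x, y) * (\1_(A `*` B) (x, y))%:E))%E.
Proof.
rewrite integral_mkcond; apply: eq_integral => y _; rewrite patchE.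
have [yB|yB] := boolP (y \in B).
  rewrite integral_mkcond; apply: eq_integral => x _; rewrite epatch_indic /=.
  congr (_ * _%:E)%E; apply: eq_indic; split=> [Ax|[]//]; split => //; exact/set_mem.
rewrite integral0_eq// => x _; rewrite indicE memNset ?mule0// => -[_ /= By].
by move/negP: yB; apply; rewrite inE.
Qed.

Lemma rectangle_integral_r (A : set S1) (B : set S2) (f : S1 * S2 -> \bar R) :
  (\int[m1]_(x in A) \int[m2]_(y in B) f (x, y) =
   \int[m1]_x \int[m2]_y (f (x, y) * (\1_(A `*` B) (x, y))%:E))%E.
Proof.
rewrite integral_mkcond; apply: eq_integral => x _; rewrite patchE.
have [xA|xA] := boolP (x \in A).
  rewrite integral_mkcond; apply: eq_integral => y _; rewrite epatch_indic /=.
  congr (_ * _%:E)%E; apply: eq_indic; split=> [By|[]//]; split => //; exact/set_mem.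
rewrite integral0_eq// => y _; rewrite indicE memNset ?mule0// => -[/= Ax _].
by move/negP: xA; apply; rewrite inE.
Qed.

Lemma tonelli_on (A : set S1) (B : set S2) (f : S1 * S2 -> \bar R) :
  measurable A -> measurable B -> measurable_fun setT f -> (forall p, 0 <= f p)%E ->
  (\int[m2]_(y in B) \int[m1]_(x in A) f (x, y) =
   \int[m1]_(x in A) \int[m2]_(y in B) f (x, y))%E.
Proof.
move=> mA mB mf f0.
rewrite rectangle_integral_l rectangle_integral_r.
rewrite -(fubini_tonelli (fun p => f p * (\1_(A `*` B) p)%:E)%E)//.
  exact: measurable_rectangle_mul.
by move=> p; rewrite mule_ge0// lee_fin.
Qed.

Lemma measurable_partial_integral (A : set S1) (f : S1 * S2 -> \bar R) :
  measurable A -> measurable_fun setT f -> (forall p, 0 <= f p)%E ->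
  measurable_fun setT (fun y => \int[m1]_(x in A) f (x, y))%E.
Proof.
move=> mA mf f0.
have mfA := measurable_rectangle_mul mA (@measurableT _ S2) mf.
have f0A p : (0 <= f p * (\1_(A `*` [set: S2]) p)%:E)%E by rewrite mule_ge0// lee_fin.
have := measurable_fun_fubini_tonelli_G (m1 := m1) _ mfA f0A.
apply: eq_measurable_fun => y _; rewrite /fubini_G [RHS]integral_mkcond.
apply: eq_integral => x _; rewrite epatch_indic /=.
by congr (_ * _%:E)%E; apply: eq_indic; split=> [[]//|Ax].
Qed.

End tonelli_on.

Section energy.
Context {R : realType} {T : R} {X : ptopologicalType}.
Hypothesis T_gt0 : 0 < T.
Local Notation Om := (cadlag_path T X).
Local Notation TR := (measurableTypeR R).
Local Notation mu := (@lebesgue_measure R).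
Local Notation Ft t := (<<s @position_gen R T X `[0, t] >>).
Variable Q : {sigma_finite_measure set Om -> \bar R}.

Lemma stopped_generator_cut (sigma : Om -> R) (u : X -> R) (K : R -> Om -> R) :
  stopped_generator Q sigma u K -> stopped_generator Q sigma u (time_cut K).
Proof.
move=> H s t B s0 st tT FB QB Bs.
have mB : measurable B by apply: position_gen_le_measurable FB; exact: le_trans tT.
have := H s t B s0 st tT FB QB Bs; apply: mean_zero_eq => // w _.
by rewrite time_cut_integral// ge_min tT orbT.
Qed.

Definition carre (f g : X -> R) (Kfg Kf Kg : R -> Om -> R) (r : R) (w : Om) : R :=
  Kfg r w - f (position r w) * Kg r w - g (position r w) * Kf r w.

(** What remains of the product rule when f and g are evaluated at time r
    instead of the initial time s. *)
Definition carre_error (f g : X -> R) (Kf Kg : R -> Om -> R) (s r : R) (w : Om) : R :=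
  (f (position r w) - f (position s w)) * Kg r w +
  (g (position r w) - g (position s w)) * Kf r w.

Variables (sigma : Om -> R).
Hypothesis sigma_mes : measurable_fun setT sigma.

(** Expand the product of the increments as the increment of fg, minus f(X_s)
    times the one of g, minus g(X_s) times the one of f. Each increment is the
    integral of its generator up to mean zero, and the weights f(X_s), g(X_s)
    are bounded functions of the past of s. *)
Lemma energy_identity (f g : X -> R) (Kfg Kf Kg : R -> Om -> R) (C : R) :
  measurable_fun setT (f : borel X -> R) -> continuous f -> (forall x, `|f x| <= C) ->
  measurable_fun setT (g : borel X -> R) -> continuous g -> (forall x, `|g x| <= C) ->
  measurable_fun setT (fun p : TR * Om => Kf p.1 p.2) ->
  measurable_fun setT (fun p : TR * Om => Kg p.1 p.2) ->
  measurable_fun setT (fun p : TR * Om => Kfg p.1 p.2) ->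
  {ae Q, forall w, mu.-integrable `[0, T] (EFin \o (Kf ^~ w))} ->
  {ae Q, forall w, mu.-integrable `[0, T] (EFin \o (Kg ^~ w))} ->
  {ae Q, forall w, mu.-integrable `[0, T] (EFin \o (Kfg ^~ w))} ->
  stopped_generator Q sigma f Kf -> stopped_generator Q sigma g Kg ->
  stopped_generator Q sigma (f \* g) Kfg ->
  forall s t B, 0 <= s -> s <= t -> t <= T ->
    Ft s B -> (Q B < +oo)%E -> (forall w, B w -> s <= sigma w) ->
    mean_zero Q B (fun w =>
      (f (position (Num.min (sigma w) t) w) - f (position s w)) *
      (g (position (Num.min (sigma w) t) w) - g (position s w))
      - \int[mu]_(r in `[s, Num.min (sigma w) t])
          (carre f g Kfg Kf Kg r w + carre_error f g Kf Kg s r w)).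
Proof.
move=> mf cf bf mg cg bg mKf mKg mKfg iKf iKg iKfg Hf Hg Hfg s t B s0 st tT FB QB Bs.
have sT := le_trans st tT.
have mB : measurable B by apply: position_gen_le_measurable FB.
have weight (phi : X -> R) D : measurable_fun setT (phi : borel X -> R) ->
    (forall x, `|phi x| <= C) ->
    (forall A, Ft s A -> A `<=` B -> mean_zero Q A D) ->
    mean_zero Q B (fun w => phi (position s w) * D w).
  move=> mphi bphi D0.
  apply: (@mean_zero_weight _ _ _ Q (Ft s) _ D B C) => //.
  - by move=> A FA; apply: position_gen_le_measurable FA.
  - by move=> A A'; exact: position_genI.
  - move=> Y mY; have mp : position_measurable `[0, s] (fun w : Om => phi (position s w)).
      by apply: position_measurable_comp => //; rewrite /= in_itv/= s0 lexx.
    by rewrite -[X in smallest _ _ X]setTI; exact: mp.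
have sub A : Ft s A -> A `<=` B -> (Q A < +oo)%E /\ forall w, A w -> s <= sigma w.
  move=> FA AB; split; last by move=> w /AB; exact: Bs.
  apply: le_lt_trans QB; apply: le_measure; rewrite ?inE//.
  by apply: position_gen_le_measurable FA.
pose D (u : X -> R) (K : R -> Om -> R) w :=
  u (position (Num.min (sigma w) t) w) - u (position s w)
  - \int[mu]_(r in `[s, Num.min (sigma w) t]) K r w.
have h1 : mean_zero Q B (D (f \* g) Kfg) by exact: Hfg.
have h2 : mean_zero Q B (fun w => f (position s w) * D g Kg w).
  by apply: weight => // A FA AB; have [QA As] := sub A FA AB; exact: Hg.
have h3 : mean_zero Q B (fun w => g (position s w) * D f Kf w).
  by apply: weight => // A FA AB; have [QA As] := sub A FA AB; exact: Hf.
have h := mean_zeroB mB (mean_zeroB mB h1 h2) h3.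
have mmin : measurable_fun setT (fun w => Num.min (sigma w) t) by exact: measurable_minr.
have mobs (u : X -> R) : measurable_fun setT (u : borel X -> R) -> continuous u ->
    measurable_fun setT (fun p : TR * Om => u (position p.1 p.2)) by exact: measurable_observable.
have mobss (u : X -> R) : measurable_fun setT (u : borel X -> R) ->
    measurable_fun setT (fun p : TR * Om => u (position s p.2)).
  by move=> mu_; exact: (measurableT_comp (measurable_comp_position T_gt0 s mu_)).
have mtot : measurable_fun setT (fun p : TR * Om =>
    carre f g Kfg Kf Kg p.1 p.2 + carre_error f g Kf Kg s p.1 p.2).
  have [mfo mgo] := (mobs f mf cf, mobs g mg cg).
  have [mfs mgs] := (mobss f mf, mobss g mg).
  apply: measurable_funD.
    apply: measurable_funB; last exact: measurable_funM.
    by apply: measurable_funB => //; exact: measurable_funM.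
  by apply: measurable_funD; apply: measurable_funM => //; exact: measurable_funB.
apply: mean_zero_ae_eq h => //.
  apply: measurable_funTS; apply: measurable_funB.
    by apply: measurable_funM; apply: measurable_funB; apply: measurable_observable_at.
  have mp : measurable_fun setT (fun w : Om => ((s, Num.min (sigma w) t), w) : (TR * TR) * Om).
    by do 2 apply/measurable_fun_pair => //.
  have := measurableT_comp (measurable_itv_integral mtot) mp.
  exact: (measurableT_comp (fine_measurable measurableT)).
apply: filterS3 iKf iKg iKfg => w iKfw iKgw iKfgw Bw.
have subI : `[s, Num.min (sigma w) t] `<=` (`[0, T] : set R).
  move=> q; rewrite /= !in_itv/= le_min => /and3P[q1 _ q2].
  by rewrite (le_trans s0 q1) (le_trans q2).
have mI : measurable (`[s, Num.min (sigma w) t] : set TR) by exact: measurable_itv.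
have mT : measurable (`[0, T] : set TR) by exact: measurable_itv.
have i1 := integrableS mT mI subI iKfw.
have i2 := integrableS mT mI subI iKgw.
have i3 := integrableS mT mI subI iKfgw.
have -> : \int[mu]_(r in `[s, Num.min (sigma w) t])
          (carre f g Kfg Kf Kg r w + carre_error f g Kf Kg s r w) =
   \int[mu]_(r in `[s, Num.min (sigma w) t]) Kfg r w
   - f (position s w) * (\int[mu]_(r in `[s, Num.min (sigma w) t]) Kg r w)
   - g (position s w) * (\int[mu]_(r in `[s, Num.min (sigma w) t]) Kf r w).
  rewrite -RintegralZl// -RintegralZl// -RintegralB//; last exact: (integrableZl mI _ i2).
  rewrite -RintegralB//; last 2 first.
  - exact: (integrableB mI i3 (integrableZl mI (f (position s w)) i2)).
  - exact: (integrableZl mI _ i1).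
  by apply: eq_Rintegral => r _; rewrite /carre /carre_error; ring.
by rewrite /D /=; ring.
Qed.

End energy.

(** * Oscillation on a short time interval *)

Section integral_helpers.
Context d (S : measurableType d) (R : realType).
Variable m : {measure set S -> \bar R}.

Lemma norm_Rintegral_le (D : set S) (f : S -> R) : measurable D -> measurable_fun D f ->
  (`|\int[m]_(x in D) f x|%:E <= \int[m]_(x in D) `|f x|%:E)%E.
Proof.
move=> mD mf; have mEf : measurable_fun D (EFin \o f) by exact/measurable_EFinP.
apply: le_trans (le_abse_integral m mD mEf).
rewrite /Rintegral; case: (\int[m]_(x in D) (EFin \o f) x)%E => [r| |] //=.
all: by rewrite normr0 ?leey.
Qed.

Lemma bounded_integrable (B : set S) (f : S -> R) (c : R) : measurable B -> (m B < +oo)%E ->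
  measurable_fun B f -> (forall x, B x -> `|f x| <= c) -> m.-integrable B (EFin \o f).
Proof.
move=> mB Bfin mf fc; apply: measurable_bounded_integrable => //.
exists c; split; first exact: num_real.
by move=> x cx w Bw; rewrite /= (le_trans (fc _ Bw))// ltW.
Qed.

Lemma mean_zero_split (B : set S) (f g : S -> R) : measurable B ->
  m.-integrable B (EFin \o f) -> mean_zero m B (fun w => f w - g w) ->
  m.-integrable B (EFin \o g) /\
  (\int[m]_(w in B) (f w)%:E = \int[m]_(w in B) (g w)%:E)%E.
Proof.
move=> mB fi [di d0].
have gE : (EFin \o g) = ((EFin \o f) \- (EFin \o (fun w => (f w - g w)%R)))%E.
  by apply/funext => w /=; rewrite -EFinB; congr EFin; ring.
split; first by rewrite gE; exact: integrableB.
rewrite -[RHS]/(\int[m]_(w in B) (EFin \o g) w)%E gE.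
by rewrite (integralB mB fi di)/= d0 sube0.
Qed.

End integral_helpers.

Section oscillation.
Context {R : realType} {T : R} {X : ptopologicalType}.
Hypothesis T_gt0 : 0 < T.
Local Notation Om := (cadlag_path T X).
Local Notation TR := (measurableTypeR R).
Local Notation mu := (@lebesgue_measure R).
Local Notation Ft t := (<<s @position_gen R T X `[0, t] >>).
Variable Q : {sigma_finite_measure set Om -> \bar R}.

Lemma measurable_increment (u : X -> R) (s : R) : measurable_fun setT (u : borel X -> R) ->
  continuous u ->
  measurable_fun setT (fun p : TR * Om => u (position p.1 p.2) - u (position s p.2)).
Proof.
move=> mu_ cu; apply: measurable_funB; first exact: measurable_observable.
exact: (measurableT_comp (measurable_comp_position T_gt0 s mu_)).
Qed.

Lemma measurable_carre (f g : X -> R) (Kfg Kf Kg : R -> Om -> R) :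
  measurable_fun setT (f : borel X -> R) -> continuous f ->
  measurable_fun setT (g : borel X -> R) -> continuous g ->
  measurable_fun setT (fun p : TR * Om => Kf p.1 p.2) ->
  measurable_fun setT (fun p : TR * Om => Kg p.1 p.2) ->
  measurable_fun setT (fun p : TR * Om => Kfg p.1 p.2) ->
  measurable_fun setT (fun p : TR * Om => carre f g Kfg Kf Kg p.1 p.2).
Proof.
move=> mf cf mg cg mKf mKg mKfg.
have mfo := measurable_observable T_gt0 mf cf.
have mgo := measurable_observable T_gt0 mg cg.
apply: measurable_funB; last exact: measurable_funM.
by apply: measurable_funB => //; exact: measurable_funM.
Qed.

Lemma measurable_carre_error (f g : X -> R) (Kf Kg : R -> Om -> R) (s : R) :
  measurable_fun setT (f : borel X -> R) -> continuous f ->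
  measurable_fun setT (g : borel X -> R) -> continuous g ->
  measurable_fun setT (fun p : TR * Om => Kf p.1 p.2) ->
  measurable_fun setT (fun p : TR * Om => Kg p.1 p.2) ->
  measurable_fun setT (fun p : TR * Om => carre_error f g Kf Kg s p.1 p.2).
Proof.
move=> mf cf mg cg mKf mKg.
by apply: measurable_funD; apply: measurable_funM => //; exact: measurable_increment.
Qed.

Variables (u : X -> R) (K K2 : R -> Om -> R) (C : R).
Hypothesis mes_u : measurable_fun setT (u : borel X -> R).
Hypothesis cont_u : continuous u.
Hypothesis bnd_u : forall x, `|u x| <= C.
Hypothesis mK : measurable_fun setT (fun p : TR * Om => K p.1 p.2).
Hypothesis mK2 : measurable_fun setT (fun p : TR * Om => K2 p.1 p.2).
Hypothesis iK : {ae Q, forall w, mu.-integrable `[0, T] (EFin \o (K ^~ w))}.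
Hypothesis iK2 : {ae Q, forall w, mu.-integrable `[0, T] (EFin \o (K2 ^~ w))}.
Hypothesis genK : stopped_generator Q (cst T) u K.
Hypothesis genK2 : stopped_generator Q (cst T) (u \* u) K2.

(** Let beta be the left-hand side and I the integral on the right. By the
    energy identity for (u,u), E 1_B (u_t - u_s)^2 is at most I + beta for all t
    in [s,s'], since the error 2 (u_r - u_s) K_r is at most (u_r - u_s)^2 + K_r^2.
    Integrating over t, beta <= h (I + beta) <= h I + beta / 2, and beta is
    finite because u is bounded. *)
Lemma oscillation_le (s s' h : R) (B : set Om) :
  0 <= s -> s <= s' -> s' <= T -> 0 < h -> s' - s <= h -> h <= 2^-1 ->
  Ft s B -> (Q B < +oo)%E ->
  (\int[Q]_(w in B) \int[mu]_(r in `[s, s']) ((u (position r w) - u (position s w)) ^+ 2)%:E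
   <= (2 * h)%:E * \int[Q]_(w in B) \int[mu]_(r in `[s, s'])
        (`|carre u u K2 K K r w| + K r w ^+ 2)%:E)%E.
Proof.
move=> s0 ss' s'T h_gt0 s'h h2 FB QB.
have sT := le_trans ss' s'T.
have mB : measurable B by apply: position_gen_le_measurable FB.
have mI : measurable (`[s, s'] : set TR) by exact: measurable_itv.
have C0 : 0 <= C by apply: le_trans (bnd_u point).
pose D2 (p : TR * Om) : R := (u (position p.1 p.2) - u (position s p.2)) ^+ 2.
pose H (p : TR * Om) : R := `|carre u u K2 K K p.1 p.2| + K p.1 p.2 ^+ 2.
have mD2 : measurable_fun setT D2 by apply: measurable_funX; exact: measurable_increment.
have mH : measurable_fun setT H.
  apply: measurable_funD; last exact: measurable_funX.
  by apply: measurableT_comp => //; exact: measurable_carre.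
have mED2 : measurable_fun setT (EFin \o D2) by exact/measurable_EFinP.
have mEH : measurable_fun setT (EFin \o H) by exact/measurable_EFinP.
have D20 p : 0 <= D2 p by exact: sqr_ge0.
have H0 p : 0 <= H p by rewrite addr_ge0// sqr_ge0.
have D2C p : D2 p <= (C + C) ^+ 2.
  rewrite /D2 -real_normK ?num_real// ler_pXn2r// ?nnegrE ?addr_ge0//.
  by rewrite (le_trans (ler_normB _ _))// lerD.
pose beta := (\int[Q]_(w in B) \int[mu]_(r in `[s, s']) (D2 (r, w))%:E)%E.
pose I := (\int[Q]_(w in B) \int[mu]_(r in `[s, s']) (H (r, w))%:E)%E.
rewrite -/beta -/I.
have betaE : beta = (\int[mu]_(r in `[s, s']) \int[Q]_(w in B) (D2 (r, w))%:E)%E.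
  by rewrite /beta (tonelli_on _ _ mI mB mED2)// => p; rewrite lee_fin.
have msec (f : TR * Om -> R) w : measurable_fun setT f -> measurable_fun `[s, s'] (fun r : TR => (f (r, w))%:E).
  move=> mf; apply/measurable_EFinP; apply: measurable_funTS.
  exact: (measurableT_comp mf (measurable_pair2 w)).
have msecB (f : TR * Om -> R) r : measurable_fun setT f -> measurable_fun B (fun w : Om => (f (r, w))%:E).
  move=> mf; apply/measurable_EFinP; apply: measurable_funTS.
  exact: (measurableT_comp mf (measurable_pair1 (r : TR))).
have mpart (f : TR * Om -> R) : measurable_fun setT f -> (forall p, 0 <= f p) ->
    measurable_fun B (fun w => \int[mu]_(r in `[s, s']) (f (r, w))%:E)%E.
  move=> mf f0; apply: measurable_funTS.
  have mEf : measurable_fun setT (EFin \o f) by exact/measurable_EFinP.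
  exact: (measurable_partial_integral mu mI mEf (fun p => f0 p)).
have mpartr : measurable_fun `[s, s'] (fun r : TR => \int[Q]_(w in B) (D2 (r, w))%:E)%E.
  apply: measurable_funTS.
  have mDs : measurable_fun setT (fun p : Om * TR => (D2 (p.2, p.1))%:E).
    apply/measurable_EFinP; apply: (measurableT_comp mD2).
    by apply/measurable_fun_pair.
  exact: (measurable_partial_integral Q mB mDs (fun p => D20 _)).
have muI : mu `[s, s'] = (s' - s)%:E.
  rewrite lebesgue_measure_itv/= lte_fin; case: ltP => // s's.
  by rewrite (@le_anti _ _ s s') ?ss' ?s's// subrr.
have ss0 : 0 <= s' - s by rewrite subr_ge0.
have cIbeta : (\int[Q]_(w in B) \int[mu]_(r in `[s, s']) (H (r, w) + D2 (r, w))%:E = I + beta)%E.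
  rewrite /I /beta -ge0_integralD//; last 4 first.
  - by move=> w _; apply: integral_ge0 => r _; rewrite lee_fin.
  - exact: mpart.
  - by move=> w _; apply: integral_ge0 => r _; rewrite lee_fin.
  - exact: mpart.
  apply: eq_integral => w _.
  under eq_integral do rewrite EFinD.
  rewrite ge0_integralD//.
  - by move=> r _; rewrite lee_fin.
  - exact: msec.
  - by move=> r _; rewrite lee_fin.
  - exact: msec.
have step t : s <= t -> t <= s' -> (\int[Q]_(w in B) (D2 (t, w))%:E <= I + beta)%E.
  move=> st ts'.
  have tT := le_trans ts' s'T.
  have := energy_identity T_gt0 (measurable_cst T) mes_u cont_u bnd_u mes_u cont_u bnd_u mK mK mK2
     iK iK iK2 genK genK genK2 s0 st tT FB QB (fun w _ => sT).
  rewrite /= min_r// => mz.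
  have D2i : Q.-integrable B (EFin \o (fun w => D2 (t, w))).
    apply: (@bounded_integrable _ _ _ _ _ _ ((C + C) ^+ 2)) => //.
      by apply/measurable_EFinP; exact: msecB.
    by move=> w _; rewrite ger0_norm.
  have [Ji eJ] := mean_zero_split mB D2i mz.
  rewrite eJ -cIbeta.
  apply: (le_trans (lee_abs _)); apply: (le_trans (le_abse_integral _ mB (measurable_int _ Ji))).
  apply: ge0_le_integral => //.
  - by apply: measurableT_comp => //; exact: measurable_int Ji.
  - by apply: (mpart (fun p => H p + D2 p)); [exact: measurable_funD|move=> p; rewrite addr_ge0].
  - move=> w _ /=.
    have mItR : measurable (`[s, t] : set TR) by exact: measurable_itv.
    have mth : measurable_fun `[s, t] (fun r : TR => carre u u K2 K K r w + carre_error u u K K s r w).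
      apply: measurable_funTS.
      apply: (measurableT_comp (f := fun p : TR * Om => carre u u K2 K K p.1 p.2 + carre_error u u K K s p.1 p.2) _ (measurable_pair2 w)).
      by apply: measurable_funD; [exact: measurable_carre|exact: measurable_carre_error].
    apply: (le_trans (norm_Rintegral_le _ mItR mth)).
    apply: (@le_trans _ _ (\int[mu]_(r in `[s, t]) (H (r, w) + D2 (r, w))%:E)%E).
      apply: ge0_le_integral => //.
      + by apply/measurable_EFinP; apply: measurableT_comp.
      + apply: measurable_funS (msec (fun p => H p + D2 p) w (measurable_funD mH mD2)) => //.
        by apply: subset_itvl; rewrite bnd_simp.
      + move=> r _; rewrite lee_fin (le_trans (ler_normD _ _))// /H /D2/= -addrA lerD2l.
        rewrite /carre_error -mulr2n -mulr_natl normrM ger0_norm// normrM.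
        set a := u _ - u _; set b := K r w.
        have := sqr_ge0 (`|a| - `|b|); rewrite sqrrB !real_normK ?num_real// => hh.
        by lra.
    apply: ge0_subset_integral => //.
    + exact: (msec (fun p => H p + D2 p) w (measurable_funD mH mD2)).
    + by move=> r _; rewrite lee_fin addr_ge0.
    + by apply: subset_itvl; rewrite bnd_simp.
(* Integration of the previous bound over t in [s, s']. *)
have beta_le : (beta <= (I + beta) * (s' - s)%:E)%E.
  rewrite betaE -muI -integral_cst//; apply: ge0_le_integral => //.
  - by move=> r _; apply: integral_ge0 => w _; rewrite lee_fin.
  - by move=> r; rewrite /= in_itv/= => /andP[sr rs']; rewrite -betaE; exact: step.
have beta_fin : beta \is a fin_num.
  rewrite ge0_fin_numE; last first.
    by apply: integral_ge0 => w _; apply: integral_ge0 => r _; rewrite lee_fin.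
  rewrite betaE; apply: (@le_lt_trans _ _ (\int[mu]_(r in `[s, s']) (((C + C) ^+ 2)%:E * Q B))%E).
    apply: ge0_le_integral => //.
    - by move=> r _; apply: integral_ge0 => w _; rewrite lee_fin.
    - move=> r _; rewrite -integral_cst//; apply: ge0_le_integral => //.
      + by move=> w _; rewrite lee_fin.
      + exact: msecB.
      + by move=> w _; rewrite lee_fin.
  rewrite integral_cst// -[X in (_ * X < _)%E]/(mu `[s, s']) muI lte_mul_pinfty//.
  + by rewrite mule_ge0// lee_fin sqr_ge0.
  + by rewrite fin_numM// ge0_fin_numE.
  + by rewrite ltry.
have I0 : (0 <= I)%E.
  by apply: integral_ge0 => w _; apply: integral_ge0 => r _; rewrite lee_fin.
have b0 : 0 <= fine beta.
  by apply: fine_ge0; apply: integral_ge0 => w _; apply: integral_ge0 => r _; rewrite lee_fin.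
move: beta_le b0; rewrite -(fineK beta_fin); move: (fine beta) => b.
have [Ifin|] := boolP (I \is a fin_num); last first.
  rewrite ge0_fin_numE// -leNgt leye_eq => /eqP -> _ _.
  by rewrite gt0_muley ?leey// lte_fin mulr_gt0.
have := fine_ge0 I0; rewrite -(fineK Ifin); move: (fine I) => i i0.
rewrite -EFinD -!EFinM !lee_fin => bi b0.
have h1 : (i + b) * (s' - s) <= (i + b) * h by rewrite ler_wpM2l ?addr_ge0.
have h3 : b * h <= b * 2^-1 by rewrite ler_wpM2l.
have h4 : (i + b) * h = h * i + b * h by ring.
by rewrite -mulrA mulr_natl mulr2n; lra.
Qed.

End oscillation.

(** * Size of the error terms *)

Section double_integral.
Context {R : realType} d (S : measurableType d).
Local Notation TR := (measurableTypeR R).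
Local Notation mu := (@lebesgue_measure R).
Variable Q : {sigma_finite_measure set S -> \bar R}.

Definition double_integral (B : set S) (a b : R) (f : R -> S -> R) : \bar R :=
  (\int[Q]_(w in B) \int[mu]_(r in `[a, b]) (f r w)%:E)%E.

Let jointly_measurable (f : R -> S -> R) := measurable_fun setT (fun p : TR * S => f p.1 p.2).

Lemma measurable_inner (f : R -> S -> R) (w : S) (a b : R) : jointly_measurable f ->
  measurable_fun `[a, b] (fun r : TR => (f r w)%:E).
Proof.
move=> mf; apply/measurable_EFinP; apply: measurable_funTS.
exact: (measurableT_comp mf (measurable_pair2 w)).
Qed.

Lemma measurable_inner_integral (f : R -> S -> R) (B : set S) (a b : R) :
  jointly_measurable f -> (forall r w, 0 <= f r w) -> measurable B ->
  measurable_fun B (fun w => \int[mu]_(r in `[a, b]) (f r w)%:E)%E.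
Proof.
move=> mf f0 mB; apply: measurable_funTS.
have mI : measurable (`[a, b] : set TR) by exact: measurable_itv.
have mEf : measurable_fun setT (fun p : TR * S => (f p.1 p.2)%:E) by exact/measurable_EFinP.
exact: (measurable_partial_integral mu mI mEf (fun p => f0 p.1 p.2)).
Qed.

Lemma double_integral_ge0 B a b f : (forall r w, 0 <= f r w) -> (0 <= double_integral B a b f)%E.
Proof. by move=> f0; apply: integral_ge0 => w _; apply: integral_ge0 => r _; rewrite lee_fin. Qed.

Lemma le_double_integral B a b f g : measurable B -> jointly_measurable f -> jointly_measurable g ->
  (forall r w, 0 <= f r w) -> (forall r w, f r w <= g r w) ->
  (double_integral B a b f <= double_integral B a b g)%E.
Proof.
move=> mB mf mg f0 fg; have g0 r w : 0 <= g r w by exact: le_trans (fg r w).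
apply: ge0_le_integral => //.
- by move=> w _; apply: integral_ge0 => r _; rewrite lee_fin.
- exact: measurable_inner_integral.
- exact: measurable_inner_integral.
- move=> w _; apply: ge0_le_integral => //.
  + by move=> r _; rewrite lee_fin.
  + exact: measurable_inner.
  + exact: measurable_inner.
  + by move=> r _; rewrite lee_fin.
Qed.

Lemma double_integralD B a b f g : measurable B -> jointly_measurable f -> jointly_measurable g ->
  (forall r w, 0 <= f r w) -> (forall r w, 0 <= g r w) ->
  (double_integral B a b (fun r w => f r w + g r w)%R
   = double_integral B a b f + double_integral B a b g)%E.
Proof.
move=> mB mf mg f0 g0; rewrite /double_integral -ge0_integralD//; last 4 first.
- by move=> w _; apply: integral_ge0 => r _; rewrite lee_fin.
- exact: measurable_inner_integral.
- by move=> w _; apply: integral_ge0 => r _; rewrite lee_fin.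
- exact: measurable_inner_integral.
apply: eq_integral => w _; under eq_integral do rewrite EFinD.
rewrite ge0_integralD//.
- by move=> r _; rewrite lee_fin.
- exact: measurable_inner.
- by move=> r _; rewrite lee_fin.
- exact: measurable_inner.
Qed.

Lemma double_integralZ B a b (c : R) f : measurable B -> jointly_measurable f ->
  (forall r w, 0 <= f r w) -> 0 <= c ->
  (double_integral B a b (fun r w => c * f r w)%R = c%:E * double_integral B a b f)%E.
Proof.
move=> mB mf f0 c0; rewrite /double_integral -ge0_integralZl//; last 2 first.
- exact: measurable_inner_integral.
- by move=> w _; apply: integral_ge0 => r _; rewrite lee_fin.
apply: eq_integral => w _; under eq_integral do rewrite EFinM.
rewrite ge0_integralZl//.
- exact: measurable_inner.
- by move=> r _; rewrite lee_fin.
Qed.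

Lemma subset_double_integral B B' a b a' b' f : measurable B -> measurable B' ->
  jointly_measurable f -> (forall r w, 0 <= f r w) -> B `<=` B' -> a' <= a -> b <= b' ->
  (double_integral B a b f <= double_integral B' a' b' f)%E.
Proof.
move=> mB mB' mf f0 BB' aa' bb'.
apply: (@le_trans _ _ (double_integral B a' b' f)).
  apply: ge0_le_integral => //.
  - by move=> w _; apply: integral_ge0 => r _; rewrite lee_fin.
  - exact: measurable_inner_integral.
  - exact: measurable_inner_integral.
  - move=> w _; apply: ge0_subset_integral => //.
    + exact: measurable_inner.
    + by move=> r _; rewrite lee_fin.
    + by move=> r; rewrite /= !in_itv/= => /andP[ra rb]; rewrite (le_trans aa')// (le_trans rb).
apply: ge0_subset_integral => //; first exact: measurable_inner_integral.
by move=> w _; apply: integral_ge0 => r _; rewrite lee_fin.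
Qed.

End double_integral.

Section error_bounds.
Context {R : realType} {T : R} {X : ptopologicalType}.
Hypothesis T_gt0 : 0 < T.
Local Notation Om := (cadlag_path T X).
Local Notation TR := (measurableTypeR R).
Local Notation mu := (@lebesgue_measure R).
Local Notation Ft t := (<<s @position_gen R T X `[0, t] >>).
Variable Q : {sigma_finite_measure set Om -> \bar R}.

(** K is a candidate for the process Lu; only what does not depend on the
    martingale property is collected here. *)
Record observable_of (C : R) (u : X -> R) (K : R -> Om -> R) : Prop := ObservableOf {
  obs_measurable : measurable_fun setT (u : borel X -> R) ;
  obs_continuous : continuous u ;
  obs_bounded : forall x, `|u x| <= C ;
  obs_process : measurable_fun setT (fun p : TR * Om => K p.1 p.2) ;
  obs_integrable : {ae Q, forall w, mu.-integrable `[0, T] (EFin \o (K ^~ w))} }.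

(** K stands for Lu and K2 for L(u u). The martingale properties are those
    without stopping. *)
Record energetic (C : R) (u : X -> R) (K K2 : R -> Om -> R) : Prop := Energetic {
  en_obs : observable_of C u K ;
  en_obs2 : observable_of (C * C) (u \* u) K2 ;
  en_gen : stopped_generator Q (cst T) u K ;
  en_gen2 : stopped_generator Q (cst T) (u \* u) K2 }.

Definition energy_density (u : X -> R) (K K2 : R -> Om -> R) (r : R) (w : Om) : R :=
  `|carre u u K2 K K r w| + K r w ^+ 2.

Lemma energy_density_ge0 u K K2 r w : 0 <= energy_density u K K2 r w.
Proof. by rewrite addr_ge0// sqr_ge0. Qed.

Lemma measurable_energy_density C u K K2 : energetic C u K K2 ->
  measurable_fun setT (fun p : TR * Om => energy_density u K K2 p.1 p.2).
Proof.
move=> [[mu_ cu bu mK iK] [_ _ _ mK2 _] _ _]; apply: measurable_funD; last exact: measurable_funX.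
by apply: measurableT_comp => //; exact: measurable_carre.
Qed.

(** For x = |u_r - u_s| and y = |kappa_r|, x y <= (sqrt h / 2) y^2 + x^2 / (2 sqrt h),
    and [oscillation_le] gives a factor h for the integral of x^2. *)
Lemma increment_rate_le C u K K2 (kappa : R -> Om -> R) (s s' h : R) (B : set Om) :
  energetic C u K K2 -> measurable_fun setT (fun p : TR * Om => kappa p.1 p.2) ->
  0 <= s -> s <= s' -> s' <= T -> 0 < h -> s' - s <= h -> h <= 2^-1 ->
  Ft s B -> (Q B < +oo)%E ->
  (double_integral Q B s s' (fun r w => `|u (position r w) - u (position s w)| * `|kappa r w|)%R
   <= (2 * Num.sqrt h)%:E *
      double_integral Q B s s' (fun r w => energy_density u K K2 r w + kappa r w ^+ 2)%R)%E.
Proof.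
move=> en mk s0 ss' s'T h0 s'h h2 FB QB.
have [[mu_ cu bu mK iK] [_ _ _ mK2 iK2] gK gK2] := en.
have mB : measurable B by apply: position_gen_le_measurable FB; exact: le_trans s'T.
have osc := oscillation_le T_gt0 mu_ cu bu mK mK2 iK iK2 gK gK2 s0 ss' s'T h0 s'h h2 FB QB.
have mi := measurable_increment T_gt0 s mu_ cu.
have mi2 : measurable_fun setT (fun p : TR * Om => (u (position p.1 p.2) - u (position s p.2)) ^+ 2).
  exact: measurable_funX.
have mk2 : measurable_fun setT (fun p : TR * Om => kappa p.1 p.2 ^+ 2) by exact: measurable_funX.
have mH := measurable_energy_density en.
have H0 := energy_density_ge0 u K K2.
have sh0 : 0 < Num.sqrt h by rewrite sqrtr_gt0.
have shh : Num.sqrt h * Num.sqrt h = h by rewrite -expr2 sqr_sqrtr// ltW.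
pose D2 (r : R) (w : Om) : R := (u (position r w) - u (position s w)) ^+ 2.
pose a := 2^-1 * Num.sqrt h; pose b := 2^-1 / Num.sqrt h.
have a0 : 0 <= a by rewrite mulr_ge0// ltW.
have b0 : 0 <= b by rewrite mulr_ge0// invr_ge0 ltW.
have D0 r w : 0 <= D2 r w by exact: sqr_ge0.
have k0 r w : 0 <= kappa r w ^+ 2 by exact: sqr_ge0.
set I := double_integral Q B s s' (fun r w => energy_density u K K2 r w + kappa r w ^+ 2)%R.
apply: (@le_trans _ _ (double_integral Q B s s' (fun r w => a * kappa r w ^+ 2 + b * D2 r w)%R)).
  apply: le_double_integral => //.
  - by apply: measurable_funM; apply: measurableT_comp.
  - by apply: measurable_funD; apply: measurable_funM.
  - move=> r w; rewrite /D2; set x := u _ - u _; set y := kappa r w.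
    have := sqr_ge0 (Num.sqrt h * `|y| - `|x|).
    rewrite sqrrB exprMn !real_normK ?num_real// expr2 shh => hh.
    rewrite -(ler_pM2l sh0) mulrDr /a /b.
    have -> : Num.sqrt h * (2^-1 * Num.sqrt h * y ^+ 2) = 2^-1 * (h * y ^+ 2).
      by transitivity (2^-1 * ((Num.sqrt h * Num.sqrt h) * y ^+ 2)); [ring|rewrite shh].
    have -> : Num.sqrt h * (2^-1 / Num.sqrt h * x ^+ 2) = 2^-1 * x ^+ 2.
      by field; rewrite gt_eqF.
    by lra.
rewrite double_integralD//; last 4 first.
- by apply: measurable_funM.
- by apply: measurable_funM.
- by move=> r w; rewrite mulr_ge0.
- by move=> r w; rewrite mulr_ge0.
rewrite !double_integralZ//.
have i1 : (double_integral Q B s s' (fun r w => kappa r w ^+ 2)%R <= I)%E.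
  apply: le_double_integral => //; first exact: measurable_funD.
  by move=> r w; rewrite lerDr.
have i2 : (double_integral Q B s s' D2 <= (2 * h)%:E * I)%E.
  apply: (le_trans osc); apply: lee_wpmul2l; first by rewrite lee_fin mulr_ge0// ltW.
  apply: le_double_integral => //; first exact: measurable_funD.
  by move=> r w; rewrite lerDl.
apply: (@le_trans _ _ (a%:E * I + b%:E * ((2 * h)%:E * I))%E).
  by apply: leeD; apply: lee_wpmul2l => //; rewrite lee_fin.
rewrite muleA -EFinM -ge0_muleDl ?lee_fin//; last by rewrite mulr_ge0// mulr_ge0// ltW.
apply: lee_wpmul2r.
  by apply: double_integral_ge0 => r w; rewrite addr_ge0.
rewrite -EFinD lee_fin /a /b.
have -> : 2^-1 / Num.sqrt h * (2 * h) = Num.sqrt h.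
  rewrite (_ : _ * (2 * h) = (Num.sqrt h * Num.sqrt h) / Num.sqrt h); last by rewrite shh; field; rewrite gt_eqF.
  by rewrite mulfK// gt_eqF.
by lra.
Qed.

End error_bounds.

Section carre_pairs.
Context {R : realType} {T : R} {X : ptopologicalType}.
Hypothesis T_gt0 : 0 < T.
Local Notation Om := (cadlag_path T X).
Local Notation TR := (measurableTypeR R).
Local Notation mu := (@lebesgue_measure R).
Local Notation Ft t := (<<s @position_gen R T X `[0, t] >>).
Variable Q : {sigma_finite_measure set Om -> \bar R}.

Lemma carre_error_le C f Kf Kff g Kg Kgg (G : R -> Om -> R) (s s' h : R) (B : set Om) :
  energetic Q C f Kf Kff -> energetic Q C g Kg Kgg ->
  measurable_fun setT (fun p : TR * Om => G p.1 p.2) ->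
  (forall r w, energy_density f Kf Kff r w + Kg r w ^+ 2 <= G r w) ->
  (forall r w, energy_density g Kg Kgg r w + Kf r w ^+ 2 <= G r w) ->
  0 <= s -> s <= s' -> s' <= T -> 0 < h -> s' - s <= h -> h <= 2^-1 ->
  Ft s B -> (Q B < +oo)%E ->
  (double_integral Q B s s' (fun r w => `|carre_error f g Kf Kg s r w|)%R
   <= (4 * Num.sqrt h)%:E * double_integral Q B s s' G)%E.
Proof.
move=> enf eng mG fG gG s0 ss' s'T h0 s'h h2 FB QB.
have [[mf cf bf mKf iKf] [_ _ _ mKff _] _ _] := enf.
have [[mg cg bg mKg iKg] [_ _ _ mKgg _] _ _] := eng.
have mB : measurable B by apply: position_gen_le_measurable FB; exact: le_trans s'T.
have mif := measurable_increment T_gt0 s mf cf.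
have mig := measurable_increment T_gt0 s mg cg.
have mHf := measurable_energy_density T_gt0 enf.
have mHg := measurable_energy_density T_gt0 eng.
have m1 : measurable_fun setT (fun p : TR * Om =>
    `|f (position p.1 p.2) - f (position s p.2)| * `|Kg p.1 p.2|).
  by apply: measurable_funM; exact: measurableT_comp.
have m2 : measurable_fun setT (fun p : TR * Om =>
    `|g (position p.1 p.2) - g (position s p.2)| * `|Kf p.1 p.2|).
  by apply: measurable_funM; exact: measurableT_comp.
have sh0 : 0 <= 2 * Num.sqrt h by rewrite mulr_ge0// sqrtr_ge0.
apply: (@le_trans _ _ (double_integral Q B s s' (fun r w =>
   `|f (position r w) - f (position s w)| * `|Kg r w| +
   `|g (position r w) - g (position s w)| * `|Kf r w|)%R)).
  apply: le_double_integral => //.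
  - by apply: measurableT_comp => //; exact: measurable_carre_error.
  - exact: measurable_funD.
  - by move=> r w; rewrite (le_trans (ler_normD _ _))// !normrM.
rewrite double_integralD//.
have -> : ((4 * Num.sqrt h)%:E = (2 * Num.sqrt h)%:E + (2 * Num.sqrt h)%:E)%E.
  by rewrite -EFinD; congr EFin; ring.
rewrite ge0_muleDl ?lee_fin//; apply: leeD.
  apply: le_trans (increment_rate_le T_gt0 enf mKg s0 ss' s'T h0 s'h h2 FB QB) _.
  apply: lee_wpmul2l; first by rewrite lee_fin.
  apply: le_double_integral => //; first by apply: measurable_funD => //; exact: measurable_funX.
  by move=> r w; rewrite addr_ge0 ?sqr_ge0// energy_density_ge0.
apply: le_trans (increment_rate_le T_gt0 eng mKf s0 ss' s'T h0 s'h h2 FB QB) _.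
apply: lee_wpmul2l; first by rewrite lee_fin.
apply: le_double_integral => //; first by apply: measurable_funD => //; exact: measurable_funX.
by move=> r w; rewrite addr_ge0 ?sqr_ge0// energy_density_ge0.
Qed.

Lemma carre_error_path_integrable C f Kf g Kg (s : R) (w : Om) :
  observable_of Q C f Kf -> observable_of Q C g Kg ->
  mu.-integrable `[0, T] (EFin \o (Kf ^~ w)) ->
  mu.-integrable `[0, T] (EFin \o (Kg ^~ w)) ->
  mu.-integrable `[0, T] (EFin \o (fun r => carre_error f g Kf Kg s r w)).
Proof.
move=> [mf cf bf mKf _] [mg cg bg mKg _] iKf iKg.
have mD : measurable (`[0, T] : set TR) by exact: measurable_itv.
have mult (k : X -> R) (K : R -> Om -> R) : measurable_fun setT (k : borel X -> R) ->
   continuous k -> (forall x, `|k x| <= C) -> mu.-integrable `[0, T] (EFin \o (K ^~ w)) ->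
   mu.-integrable `[0, T] ((EFin \o (fun r => k (position r w) - k (position s w))%R) \* (EFin \o (K ^~ w)))%E.
  move=> mk ck bk iK; apply: integrableMr => //.
    apply: measurable_funTS.
    exact: (measurableT_comp (measurable_increment T_gt0 s mk ck) (measurable_pair2 w)).
  exists (C + C); split; first exact: num_real.
  move=> x Cx r _; rewrite /= (le_trans _ (ltW Cx))// (le_trans (ler_normB _ _))//.
  exact: lerD.
exact: (integrableD mD (mult f Kg mf cf bf iKg) (mult g Kf mg cg bg iKf)).
Qed.

Lemma carre_path_integrable C f Kf g Kg Kfg (w : Om) :
  observable_of Q C f Kf -> observable_of Q C g Kg ->
  mu.-integrable `[0, T] (EFin \o (Kf ^~ w)) ->
  mu.-integrable `[0, T] (EFin \o (Kg ^~ w)) ->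
  mu.-integrable `[0, T] (EFin \o (Kfg ^~ w)) ->
  mu.-integrable `[0, T] (EFin \o (fun r => carre f g Kfg Kf Kg r w)).
Proof.
move=> of_ og iKf iKg iKfg.
have mD : measurable (`[0, T] : set TR) by exact: measurable_itv.
have ie := carre_error_path_integrable 0 of_ og iKf iKg.
have i1 := integrableB mD (integrableB mD iKfg (integrableZl mD (f (position 0 w)) iKg))
   (integrableZl mD (g (position 0 w)) iKf).
have := integrableB mD i1 ie; apply: eq_integrable => // r _ /=.
congr EFin; rewrite /carre /carre_error; ring.
Qed.

End carre_pairs.

(** * Polarization by an inequality *)

Section polarization.
Context {R : realType} {T : R} {X : ptopologicalType}.
Hypothesis T_gt0 : 0 < T.
Local Notation Om := (cadlag_path T X).
Local Notation TR := (measurableTypeR R).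
Local Notation mu := (@lebesgue_measure R).
Local Notation Ft t := (<<s @position_gen R T X `[0, t] >>).
Variable Q : {sigma_finite_measure set Om -> \bar R}.

Lemma measurable_path_integral (f : R -> Om -> R) (a b : Om -> R) :
  measurable_fun setT (fun p : TR * Om => f p.1 p.2) ->
  measurable_fun setT a -> measurable_fun setT b ->
  measurable_fun setT (fun w => \int[mu]_(r in `[a w, b w]) f r w).
Proof.
move=> mf ma mb.
have mp : measurable_fun setT (fun w : Om => ((a w, b w), w) : (TR * TR) * Om).
  by do 2 apply/measurable_fun_pair => //.
have := measurableT_comp (measurable_itv_integral mf) mp.
exact: (measurableT_comp (fine_measurable measurableT)).
Qed.

Variables (C : R) (u v : X -> R) (Ku Kuu Kv Kvv Kuv G : R -> Om -> R).
Hypothesis en_u : energetic Q C u Ku Kuu.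
Hypothesis en_v : energetic Q C v Kv Kvv.
Hypothesis obs_uv : observable_of Q (C * C) (u \* v) Kuv.
Hypothesis mG : measurable_fun setT (fun p : TR * Om => G p.1 p.2).
Hypothesis G_ge : forall r w, 2 * (energy_density u Ku Kuu r w + energy_density v Kv Kvv r w) <= G r w.

(** For eps = 1 or -1 this is -1/2 times what Gamma(u - eps v, u - eps v) would be
    if the class were a linear space. *)
Definition polar_gap (eps r : R) (w : Om) : R :=
  eps * carre u v Kuv Ku Kv r w - 2^-1 * (carre u u Kuu Ku Ku r w + carre v v Kvv Kv Kv r w).

Definition polar_error (eps s r : R) (w : Om) : R :=
  eps * carre_error u v Ku Kv s r w
  - 2^-1 * (carre_error u u Ku Ku s r w + carre_error v v Kv Kv s r w).

(** The four lemmas of this group put the constant 2 of G_ge in the form used for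
    the pairs (u,u), (v,v), (u,v) and (v,u). *)
Lemma density_le_u r w : energy_density u Ku Kuu r w + Ku r w ^+ 2 <= G r w.
Proof.
apply: le_trans (G_ge r w); have := energy_density_ge0 v Kv Kvv r w.
have : Ku r w ^+ 2 <= energy_density u Ku Kuu r w by rewrite lerDr.
lra.
Qed.

Lemma density_le_v r w : energy_density v Kv Kvv r w + Kv r w ^+ 2 <= G r w.
Proof.
apply: le_trans (G_ge r w); have := energy_density_ge0 u Ku Kuu r w.
have : Kv r w ^+ 2 <= energy_density v Kv Kvv r w by rewrite lerDr.
lra.
Qed.

Lemma density_le_uv r w : energy_density u Ku Kuu r w + Kv r w ^+ 2 <= G r w.
Proof.
apply: le_trans (G_ge r w); have := energy_density_ge0 u Ku Kuu r w.
have : Kv r w ^+ 2 <= energy_density v Kv Kvv r w by rewrite lerDr.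
have := sqr_ge0 (Kv r w); lra.
Qed.

Lemma density_le_vu r w : energy_density v Kv Kvv r w + Ku r w ^+ 2 <= G r w.
Proof.
apply: le_trans (G_ge r w); have := energy_density_ge0 v Kv Kvv r w.
have : Ku r w ^+ 2 <= energy_density u Ku Kuu r w by rewrite lerDr.
have := sqr_ge0 (Ku r w); lra.
Qed.

Lemma G_ge0 r w : 0 <= G r w.
Proof. by apply: le_trans (density_le_u r w); rewrite addr_ge0 ?sqr_ge0// energy_density_ge0. Qed.

Let mu_ := obs_measurable (en_obs en_u).
Let cu := obs_continuous (en_obs en_u).
Let bu := obs_bounded (en_obs en_u).
Let mKu := obs_process (en_obs en_u).
Let iKu := obs_integrable (en_obs en_u).
Let mv := obs_measurable (en_obs en_v).
Let cv := obs_continuous (en_obs en_v).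
Let bv := obs_bounded (en_obs en_v).
Let mKv := obs_process (en_obs en_v).
Let iKv := obs_integrable (en_obs en_v).
Let mKuu := obs_process (en_obs2 en_u).
Let iKuu := obs_integrable (en_obs2 en_u).
Let mKvv := obs_process (en_obs2 en_v).
Let iKvv := obs_integrable (en_obs2 en_v).
Let mKuv := obs_process obs_uv.
Let iKuv := obs_integrable obs_uv.

Lemma measurable_polar_gap eps : measurable_fun setT (fun p : TR * Om => polar_gap eps p.1 p.2).
Proof.
apply: measurable_funB; apply: measurable_funM => //.
  exact: measurable_carre.
by apply: measurable_funD; exact: measurable_carre.
Qed.

Lemma measurable_polar_error eps s : measurable_fun setT (fun p : TR * Om => polar_error eps s p.1 p.2).
Proof.
apply: measurable_funB; apply: measurable_funM => //.
  exact: measurable_carre_error.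
by apply: measurable_funD; exact: measurable_carre_error.
Qed.

(** With du and dv the increments up to the minimum of sigma and s', the
    combination eps du dv - (du^2 + dv^2) / 2 is nonpositive; by the three energy
    identities it equals in mean the integral of polar_gap plus the one of
    polar_error. Three error terms of size 4 sqrt h give the constant 12. *)
Lemma polarized_energy_le (sigma : Om -> R) (eps s s' h : R) (B : set Om) :
  measurable_fun setT sigma -> (forall w, sigma w <= T) ->
  stopped_generator Q sigma u Ku -> stopped_generator Q sigma v Kv ->
  stopped_generator Q sigma (u \* u) Kuu -> stopped_generator Q sigma (v \* v) Kvv ->
  stopped_generator Q sigma (u \* v) Kuv ->
  `|eps| <= 1 ->
  0 <= s -> s <= s' -> s' <= T -> 0 < h -> s' - s <= h -> h <= 2^-1 ->
  Ft s B -> (Q B < +oo)%E -> (forall w, B w -> s <= sigma w) ->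
  (double_integral Q B s s' G < +oo)%E ->
  let Y w := \int[mu]_(r in `[s, Num.min (sigma w) s']) polar_gap eps r w in
  Q.-integrable B (EFin \o Y) /\
  (\int[Q]_(w in B) (Y w)%:E <= (12 * Num.sqrt h)%:E * double_integral Q B s s' G)%E.
Proof.
move=> ms sT gu gv guu gvv guv eps1 s0 ss' s'T h0 s'h h2 FB QB Bs Gfin Y.
have mB : measurable B by apply: position_gen_le_measurable FB; exact: le_trans s'T.
have C0 : 0 <= C by apply: le_trans (bu point).
have mm : measurable_fun setT (fun w => Num.min (sigma w) s') by exact: measurable_minr.
pose t' w := Num.min (sigma w) s'.
pose du w := u (position (t' w) w) - u (position s w).
pose dv w := v (position (t' w) w) - v (position s w).
pose J f g Kfg Kf Kg w := \int[mu]_(r in `[s, t' w]) (carre f g Kfg Kf Kg r w + carre_error f g Kf Kg s r w).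
have zuv : mean_zero Q B (fun w => du w * dv w - J u v Kuv Ku Kv w).
  exact: (energy_identity T_gt0 ms mu_ cu bu mv cv bv).
have zuu : mean_zero Q B (fun w => du w * du w - J u u Kuu Ku Ku w).
  exact: (energy_identity T_gt0 ms mu_ cu bu mu_ cu bu).
have zvv : mean_zero Q B (fun w => dv w * dv w - J v v Kvv Kv Kv w).
  exact: (energy_identity T_gt0 ms mv cv bv mv cv bv).
pose Z w := eps * (du w * dv w) - 2^-1 * (du w * du w + dv w * dv w).
pose E w := \int[mu]_(r in `[s, t' w]) polar_error eps s r w.
have mY : measurable_fun setT Y by apply: measurable_path_integral => //; exact: measurable_polar_gap.
have mE : measurable_fun setT E by apply: measurable_path_integral => //; exact: measurable_polar_error.
have mdu : measurable_fun setT du by apply: measurable_funB; exact: measurable_observable_at.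
have mdv : measurable_fun setT dv by apply: measurable_funB; exact: measurable_observable_at.
have mZ : measurable_fun setT Z.
  apply: measurable_funB; apply: measurable_funM => //; first exact: measurable_funM.
  by apply: measurable_funD; exact: measurable_funM.
(* This is 2 |a b| <= a^2 + b^2; it replaces the nonnegativity of Gamma(u - eps v, u - eps v). *)
have Z_le0 w : Z w <= 0.
  rewrite /Z; set a := du w; set b := dv w.
  have h3 : eps * (a * b) <= `|a| * `|b|.
    rewrite (le_trans (ler_norm _))// normrM normrM -[leRHS]mul1r ler_wpM2r//.
  have := sqr_ge0 (`|a| - `|b|); rewrite sqrrB !real_normK ?num_real// -!expr2.
  by lra.
have bdu w : `|du w| <= C + C by rewrite (le_trans (ler_normB _ _))// lerD.
have bdv w : `|dv w| <= C + C by rewrite (le_trans (ler_normB _ _))// lerD.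
have bZ w : `|Z w| <= 2 * ((C + C) * (C + C)).
  have bb a b : `|a| <= C + C -> `|b| <= C + C -> `|a * b| <= (C + C) * (C + C).
    by move=> ha hb; rewrite normrM ler_pM.
  have h1 := bb _ _ (bdu w) (bdv w); have h3 := bb _ _ (bdu w) (bdu w).
  have h4 := bb _ _ (bdv w) (bdv w).
  have e1 : `|eps * (du w * dv w)| <= `|du w * dv w|.
    by rewrite normrM -[leRHS]mul1r ler_wpM2r.
  have e2 : `|2^-1 * (du w * du w + dv w * dv w)| <= 2^-1 * (`|du w * du w| + `|dv w * dv w|).
    by rewrite normrM ger0_norm// ler_pM2l// ler_normD.
  have := ler_normB (eps * (du w * dv w)) (2^-1 * (du w * du w + dv w * dv w)).
  by rewrite -/(Z w); lra.
have iZ : Q.-integrable B (EFin \o Z).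
  apply: bounded_integrable (fun w _ => bZ w) => //; exact: measurable_funTS.
have z : mean_zero Q B (fun w => (Z w - E w) - Y w).
  have zz := mean_zeroB mB (mean_zeroZ eps mB zuv)
     (mean_zeroZ 2^-1 mB (mean_zeroD mB zuu zvv)).
  apply: mean_zero_ae_eq zz => //.
    by apply: measurable_funTS; apply: measurable_funB => //; exact: measurable_funB.
  have ae3 : {ae Q, forall w, [/\ mu.-integrable `[0, T] (EFin \o (Kuu ^~ w)),
      mu.-integrable `[0, T] (EFin \o (Kvv ^~ w)) & mu.-integrable `[0, T] (EFin \o (Kuv ^~ w))]}.
    by apply: filterS3 iKuu iKvv iKuv => w.
  apply: filterS3 iKu iKv ae3 => w iu iv [iuu ivv iuv] Bw.
  have subI : `[s, t' w] `<=` (`[0, T] : set R).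
    move=> q; rewrite /= !in_itv/= le_min => /and3P[q1 _ q2].
    by rewrite (le_trans s0 q1) (le_trans q2).
  have mI : measurable (`[s, t' w] : set TR) by exact: measurable_itv.
  have mT : measurable (`[0, T] : set TR) by exact: measurable_itv.
  have iG f Kf g Kg Kfg : observable_of Q C f Kf -> observable_of Q C g Kg ->
      mu.-integrable `[0, T] (EFin \o (Kf ^~ w)) ->
      mu.-integrable `[0, T] (EFin \o (Kg ^~ w)) ->
      mu.-integrable `[0, T] (EFin \o (Kfg ^~ w)) ->
      mu.-integrable `[s, t' w] (EFin \o (fun r => carre f g Kfg Kf Kg r w)).
    move=> of_ og ikf ikg ikfg.
    exact: (integrableS mT mI subI (carre_path_integrable T_gt0 of_ og ikf ikg ikfg)).
  have iE f Kf g Kg : observable_of Q C f Kf -> observable_of Q C g Kg ->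
      mu.-integrable `[0, T] (EFin \o (Kf ^~ w)) ->
      mu.-integrable `[0, T] (EFin \o (Kg ^~ w)) ->
      mu.-integrable `[s, t' w] (EFin \o (fun r => carre_error f g Kf Kg s r w)).
    move=> of_ og ikf ikg.
    exact: (integrableS mT mI subI (carre_error_path_integrable T_gt0 s of_ og ikf ikg)).
  have ou := en_obs en_u; have ov := en_obs en_v.
  have gap_uv := iG _ _ _ _ _ ou ov iu iv iuv.
  have gap_uu := iG _ _ _ _ _ ou ou iu iu iuu.
  have gap_vv := iG _ _ _ _ _ ov ov iv iv ivv.
  have err_uv := iE _ _ _ _ ou ov iu iv.
  have err_uu := iE _ _ _ _ ou ou iu iu.
  have err_vv := iE _ _ _ _ ov ov iv iv.
  have YE : Y w = eps * (\int[mu]_(r in `[s, t' w]) carre u v Kuv Ku Kv r w)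
     - 2^-1 * ((\int[mu]_(r in `[s, t' w]) carre u u Kuu Ku Ku r w)
         + (\int[mu]_(r in `[s, t' w]) carre v v Kvv Kv Kv r w)).
    rewrite -RintegralZl// -RintegralD//.
    rewrite -RintegralZl//; last exact: (integrableD mI gap_uu gap_vv).
    rewrite -RintegralB//; first exact: (integrableZl mI eps gap_uv).
    exact: (integrableZl mI 2^-1 (integrableD mI gap_uu gap_vv)).
  have EE : E w = eps * (\int[mu]_(r in `[s, t' w]) carre_error u v Ku Kv s r w)
     - 2^-1 * ((\int[mu]_(r in `[s, t' w]) carre_error u u Ku Ku s r w)
         + (\int[mu]_(r in `[s, t' w]) carre_error v v Kv Kv s r w)).
    rewrite -RintegralZl// -RintegralD//.
    rewrite -RintegralZl//; last exact: (integrableD mI err_uu err_vv).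
    rewrite -RintegralB//; first exact: (integrableZl mI eps err_uv).
    exact: (integrableZl mI 2^-1 (integrableD mI err_uu err_vv)).
  rewrite YE EE /J (RintegralD mI gap_uv err_uv) (RintegralD mI gap_uu err_uu) (RintegralD mI gap_vv err_vv) /Z.
  by ring.
have e_le : (\int[Q]_(w in B) `|E w|%:E <= (12 * Num.sqrt h)%:E * double_integral Q B s s' G)%E.
  have l1 := carre_error_le T_gt0 en_u en_v mG density_le_uv density_le_vu s0 ss' s'T h0 s'h h2 FB QB.
  have l2 := carre_error_le T_gt0 en_u en_u mG density_le_u density_le_u s0 ss' s'T h0 s'h h2 FB QB.
  have l3 := carre_error_le T_gt0 en_v en_v mG density_le_v density_le_v s0 ss' s'T h0 s'h h2 FB QB.
  have sh0 : 0 <= 4 * Num.sqrt h by rewrite mulr_ge0// sqrtr_ge0.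
  have -> : ((12 * Num.sqrt h)%:E = (4 * Num.sqrt h)%:E + (4 * Num.sqrt h)%:E + (4 * Num.sqrt h)%:E)%E.
    by rewrite -!EFinD; congr EFin; ring.
  have sh1 : (0 <= (4 * Num.sqrt h)%:E + (4 * Num.sqrt h)%:E)%E by rewrite -EFinD lee_fin addr_ge0.
  rewrite ge0_muleDl ?lee_fin// ge0_muleDl ?lee_fin//.
  apply: (le_trans _ (leeD (leeD l1 l2) l3)).
  have m1 : measurable_fun setT (fun p : TR * Om => `|carre_error u v Ku Kv s p.1 p.2|).
    by apply: measurableT_comp => //; exact: measurable_carre_error.
  have m2 : measurable_fun setT (fun p : TR * Om => `|carre_error u u Ku Ku s p.1 p.2|).
    by apply: measurableT_comp => //; exact: measurable_carre_error.
  have m3 : measurable_fun setT (fun p : TR * Om => `|carre_error v v Kv Kv s p.1 p.2|).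
    by apply: measurableT_comp => //; exact: measurable_carre_error.
  have m12 : measurable_fun setT (fun p : TR * Om =>
      `|carre_error u v Ku Kv s p.1 p.2| + `|carre_error u u Ku Ku s p.1 p.2|).
    exact: measurable_funD.
  have n12 r w : 0 <= `|carre_error u v Ku Kv s r w| + `|carre_error u u Ku Ku s r w|.
    by rewrite addr_ge0.
  rewrite -double_integralD// -double_integralD//.
  have mtot : measurable_fun setT (fun p : TR * Om => `|carre_error u v Ku Kv s p.1 p.2|
     + `|carre_error u u Ku Ku s p.1 p.2| + `|carre_error v v Kv Kv s p.1 p.2|).
    by apply: measurable_funD => //; exact: measurable_funD.
  apply: ge0_le_integral => //.
  - by apply/measurable_EFinP; apply: measurableT_comp => //; exact: measurable_funTS.
  - by apply: measurable_inner_integral => // r w; rewrite !addr_ge0.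
  - move=> w _.
    have mIt : measurable (`[s, t' w] : set TR) by exact: measurable_itv.
    apply: (le_trans (norm_Rintegral_le _ mIt _)).
      by apply/measurable_EFinP; apply: (measurable_inner w); exact: measurable_polar_error.
    apply: (@le_trans _ _ (\int[mu]_(r in `[s, t' w]) (`|carre_error u v Ku Kv s r w|
     + `|carre_error u u Ku Ku s r w| + `|carre_error v v Kv Kv s r w|)%:E)%E).
      apply: ge0_le_integral => //.
      + apply/measurable_EFinP; apply: measurableT_comp => //.
        by apply/measurable_EFinP; apply: (measurable_inner w); exact: measurable_polar_error.
      + exact: (@measurable_inner _ _ _ (fun r w => `|carre_error u v Ku Kv s r w|
          + `|carre_error u u Ku Ku s r w| + `|carre_error v v Kv Kv s r w|) w _ _ mtot).
      + move=> r _; rewrite lee_fin /polar_error.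
        set x := carre_error u v _ _ _ _ _; set y := carre_error u u _ _ _ _ _.
        set z' := carre_error v v _ _ _ _ _.
        have e1 : `|eps * x| <= `|x| by rewrite normrM -[leRHS]mul1r ler_wpM2r.
        have e2 : `|2^-1 * (y + z')| <= 2^-1 * (`|y| + `|z'|).
          by rewrite normrM ger0_norm// ler_pM2l// ler_normD.
        have := ler_normB (eps * x) (2^-1 * (y + z')).
        by have := normr_ge0 y; have := normr_ge0 z'; lra.
    apply: ge0_subset_integral => //.
    + exact: (@measurable_inner _ _ _ (fun r w => `|carre_error u v Ku Kv s r w|
          + `|carre_error u u Ku Ku s r w| + `|carre_error v v Kv Kv s r w|) w _ _ mtot).
    + by apply: subset_itvl; rewrite bnd_simp ge_min lexx orbT.
have iE : Q.-integrable B (EFin \o E).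
  apply/integrableP; split; first by apply/measurable_EFinP; exact: measurable_funTS.
  apply: (le_lt_trans e_le); apply: lte_mul_pinfty => //.
have iZE : Q.-integrable B (EFin \o (fun w => Z w - E w)) by exact: (integrableB mB iZ iE).
have [iY eY] := mean_zero_split mB iZE z.
split => //; rewrite -eY; apply: le_trans e_le.
apply: le_integral => //; first exact: (integrable_norm iE).
move=> w _; rewrite lee_fin /=.
by have := Z_le0 w; have := ler_norm (- E w); rewrite normrN; lra.
Qed.

End polarization.

(** * Integrability of the mixed carre du champ *)

Section strip_average.
Context {R : realType} d (S : measurableType d).
Local Notation TR := (measurableTypeR R).
Local Notation mu := (@lebesgue_measure R).
Variable Q : {sigma_finite_measure set S -> \bar R}.

Lemma measurable_strip_mean (h : R) (f : R -> S -> R) :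
  measurable_fun setT (fun p : TR * S => f p.1 p.2) -> (forall r w, 0 <= f r w) ->
  measurable_fun setT (fun s : TR => \int[Q]_w \int[mu]_(r in `[s, (s + h)%R]) (f r w)%:E)%E.
Proof.
move=> mf f0.
have mF := measurable_strip_integral h mf.
have F0 (p : TR * S) : (0 <= \int[mu]_(s in `[p.1, (p.1 + h)%R]) (f s p.2)%:E)%E.
  by apply: integral_ge0 => r _; rewrite lee_fin.
exact: (measurable_fun_fubini_tonelli_F (m2 := Q) _ mF F0).
Qed.

Lemma integral_strip_mean (h : R) (f : R -> S -> R) : 0 <= h ->
  measurable_fun setT (fun p : TR * S => f p.1 p.2) -> (forall r w, 0 <= f r w) ->
  (\int[mu]_s \int[Q]_w \int[mu]_(r in `[s, (s + h)%R]) (f r w)%:E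
   = h%:E * \int[Q]_w \int[mu]_r (f r w)%:E)%E.
Proof.
move=> h0 mf f0.
have mF := measurable_strip_integral h mf.
have F0 (p : TR * S) : (0 <= \int[mu]_(s in `[p.1, (p.1 + h)%R]) (f s p.2)%:E)%E.
  by apply: integral_ge0 => r _; rewrite lee_fin.
have mEf : measurable_fun setT (fun p : TR * S => (f p.1 p.2)%:E) by exact/measurable_EFinP.
rewrite (fubini_tonelli (m1 := mu) (m2 := Q) _ mF F0)/=.
have f0E (p : TR * S) : (0 <= (f p.1 p.2)%:E)%E by rewrite lee_fin.
have mI := measurable_fun_fubini_tonelli_G (m1 := mu) _ mEf f0E.
have I0 w : (0 <= \int[mu]_r (f r w)%:E)%E by apply: integral_ge0 => r _; rewrite lee_fin.
rewrite -ge0_integralZl//.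
apply: eq_integral => w _.
apply: (ge0_integral_strip (f := fun r => (f r w)%:E)) => //.
exact: (measurableT_comp mEf (measurable_pair2 w)).
by move=> x; rewrite lee_fin.
Qed.

End strip_average.

Section carre_integrable.
Context {R : realType} {T : R} {X : ptopologicalType}.
Hypothesis T_gt0 : 0 < T.
Local Notation Om := (cadlag_path T X).
Local Notation TR := (measurableTypeR R).
Local Notation mu := (@lebesgue_measure R).
Local Notation Ft t := (<<s @position_gen R T X `[0, t] >>).
Variable Q : {sigma_finite_measure set Om -> \bar R}.

Variables (C : R) (u v : X -> R) (Ku Kuu Kv Kvv Kuv G : R -> Om -> R).
Hypothesis en_u : energetic Q C u Ku Kuu.
Hypothesis en_v : energetic Q C v Kv Kvv.
Hypothesis obs_uv : observable_of Q (C * C) (u \* v) Kuv.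
Hypothesis mG : measurable_fun setT (fun p : TR * Om => G p.1 p.2).
Hypothesis G_ge : forall r w, 2 * (energy_density u Ku Kuu r w + energy_density v Kv Kvv r w) <= G r w.
Hypothesis G_fin : (double_integral Q setT 0 T G < +oo)%E.
Hypothesis carre_adapted : forall s, 0 <= s <= T -> position_measurable `[0, s] (carre u v Kuv Ku Kv s).

Variables (sg : nat -> Om -> R) (b : nat -> R) (A : nat -> set Om).
Hypothesis sg_itv : forall n w, 0 <= sg n w <= T.
Hypothesis sg_mes : forall n, measurable_fun setT (sg n).
Hypothesis sg_adapted : forall n s, 0 <= s <= T -> Ft s [set w | s <= sg n w].
Hypothesis sg_bound : forall n, {ae Q, forall w,
  (\int[mu]_(r in `[0%R, sg n w]) (`|Kuv r w| + `|Ku r w| + `|Kv r w|)%:E <= (b n)%:E)%E}.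
Hypothesis sg_T : {ae Q, forall w, exists n0, forall n, (n0 <= n)%N -> sg n w = T}.
Hypothesis sg_mono : forall n n' w, (n <= n')%N -> sg n w <= sg n' w.
Hypothesis gen_u : forall n, stopped_generator Q (sg n) u Ku.
Hypothesis gen_v : forall n, stopped_generator Q (sg n) v Kv.
Hypothesis gen_uu : forall n, stopped_generator Q (sg n) (u \* u) Kuu.
Hypothesis gen_vv : forall n, stopped_generator Q (sg n) (v \* v) Kvv.
Hypothesis gen_uv : forall n, stopped_generator Q (sg n) (u \* v) Kuv.
Hypothesis A_F : forall n, Ft 0 (A n).
Hypothesis A_fin : forall n, (Q (A n) < +oo)%E.
Hypothesis A_mono : forall n n', (n <= n')%N -> A n `<=` A n'.
Hypothesis A_cover : \bigcup_n A n = setT.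

Local Notation gap := (polar_gap u v Ku Kuu Kv Kvv Kuv).
Local Notation Gam := (carre u v Kuv Ku Kv).

Let G0 r w : 0 <= G r w := G_ge0 G_ge r w.
Let C0 : 0 <= C := le_trans (normr_ge0 _) (obs_bounded (en_obs en_u) point).
Let mKu := obs_process (en_obs en_u).
Let mKv := obs_process (en_obs en_v).
Let mKuv := obs_process obs_uv.

Let mA n : measurable (A n).
Proof. by apply: position_gen_le_measurable (A_F n); exact: ltW. Qed.

Let mgap eps : measurable_fun setT (fun p : TR * Om => gap eps p.1 p.2).
Proof. exact: (measurable_polar_gap T_gt0 en_u en_v obs_uv). Qed.

Let mGam : measurable_fun setT (fun p : TR * Om => Gam p.1 p.2).
Proof.
have [mu_ cu _ _ _] := en_obs en_u; have [mv cv _ _ _] := en_obs en_v.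
exact: measurable_carre.
Qed.

(** The part of [0,T] x Omega before the stopping time, over an event of finite measure:
    there polar_gap is integrable. *)
Let region n : set (TR * Om) := [set p | [/\ 0 <= p.1, p.1 <= sg n p.2 & A n p.2]].

Let measurable_region n : measurable (region n).
Proof.
have -> : region n = [set p | 0 <= p.1] `&` [set p | p.1 <= sg n p.2] `&` (setT `*` A n).
  by apply/seteqP; split=> [p [? ? ?]|p [[? ?] [_ ?]]].
apply: measurableI; last exact: measurableX.
by apply: measurableI; rewrite -[X in measurable X]setTI; apply: measurable_fun_le => //;
  exact: measurableT_comp.
Qed.

Let g n eps (p : TR * Om) : R := \1_(region n) p * gap eps p.1 p.2.

Let mg n eps : measurable_fun setT (g n eps).
Proof. by apply: measurable_funM => //; exact: measurable_indic. Qed.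

Let gap_le eps r w : `|eps| <= 1 ->
  `|gap eps r w| <= (1 + C) * (`|Kuv r w| + `|Ku r w| + `|Kv r w|) + G r w.
Proof.
move=> eps1; have bu := obs_bounded (en_obs en_u) (position r w).
have bv := obs_bounded (en_obs en_v) (position r w).
have gu := G_ge r w.
have h1 : `|eps * Gam r w| <= `|Gam r w| by rewrite normrM -[leRHS]mul1r ler_wpM2r.
have h2 : `|Gam r w| <= `|Kuv r w| + C * `|Kv r w| + C * `|Ku r w|.
  rewrite /carre (le_trans (ler_normB _ _))// lerD//.
    by rewrite (le_trans (ler_normB _ _))// lerD// normrM ler_wpM2r.
  by rewrite normrM ler_wpM2r.
set a := carre u u Kuu Ku Ku r w; set c := carre v v Kvv Kv Kv r w.
have h3 : `|a| + `|c| <= G r w.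
  apply: le_trans gu; rewrite /energy_density -/a -/c.
  have := sqr_ge0 (Ku r w); have := sqr_ge0 (Kv r w).
  by have := normr_ge0 a; have := normr_ge0 c; lra.
have h4 : `|2^-1 * (a + c)| <= 2^-1 * (`|a| + `|c|).
  by rewrite normrM ger0_norm// ler_pM2l// ler_normD.
have h5 := ler_normB (eps * Gam r w) (2^-1 * (a + c)).
have h6 := G0 r w.
have n1 := normr_ge0 (Kuv r w); have n2 := normr_ge0 (Ku r w); have n3 := normr_ge0 (Kv r w).
have h7 : (1 + C) * (`|Kuv r w| + `|Ku r w| + `|Kv r w|) =
   `|Kuv r w| + C * `|Kuv r w| + (`|Ku r w| + `|Kv r w|) + C * `|Ku r w| + C * `|Kv r w| by ring.
have h8 : 0 <= C * `|Kuv r w| by rewrite mulr_ge0.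
by rewrite h7 /polar_gap -/a -/c; lra.
Qed.

Let region_integrable n eps : `|eps| <= 1 -> (mu \x Q)%E.-integrable setT (EFin \o g n eps).
Proof.
move=> eps1; apply/integrable21ltyP; first exact/measurable_EFinP.
pose kap r w := `|Kuv r w| + `|Ku r w| + `|Kv r w|.
have mkap : measurable_fun setT (fun p : TR * Om => kap p.1 p.2).
  by apply: measurable_funD; [apply: measurable_funD|]; exact: measurableT_comp.
have kap0 r w : 0 <= kap r w by rewrite !addr_ge0.
have mT : measurable (`[0, T] : set TR) by exact: measurable_itv.
have k0 : 0 <= (1 + C) * `|b n| by rewrite mulr_ge0// addr_ge0.
have mind : measurable_fun setT (fun w => (\1_(A n) w : R)%:E).
  by apply/measurable_EFinP; exact: measurable_indic.
have mk : measurable_fun setT (fun w => (((1 + C) * `|b n|)%:E * (\1_(A n) w)%:E)%E).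
  exact: emeasurable_funM.
have mIG : measurable_fun setT (fun w => \int[mu]_(r in `[0%R, T]) (G r w)%:E)%E.
  exact: measurable_inner_integral.
have G0w w : (0 <= \int[mu]_(r in `[0%R, T]) (G r w)%:E)%E.
  by apply: integral_ge0 => r _; rewrite lee_fin.
have k0w w : (0 <= ((1 + C) * `|b n|)%:E * (\1_(A n) w)%:E)%E by rewrite mule_ge0// lee_fin.
apply: (@le_lt_trans _ _ (\int[Q]_w ((((1 + C) * `|b n|)%:E * (\1_(A n) w)%:E)
   + \int[mu]_(r in `[0%R, T]) (G r w)%:E))%E); last first.
  have i0 w : (0 <= (\1_(A n) w : R)%:E)%E by rewrite lee_fin.
  rewrite ge0_integralD// ge0_integralZl//.
  rewrite integral_indic// setIT; apply: lte_add_pinfty; last exact: G_fin.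
  by apply: lte_mul_pinfty => //; exact: A_fin.
have mag : measurable_fun setT (fun p => `|(EFin \o g n eps) p|%E).
  by apply: measurableT_comp => //; exact/measurable_EFinP.
apply: ae_ge0_le_integral => //.
- by move=> w _; exact: integral_ge0.
- exact: (measurable_fun_fubini_tonelli_G (m1 := mu) _ mag (fun p => abse_ge0 _)).
- by move=> w _; rewrite adde_ge0.
- exact: emeasurable_funD.
apply: filterS (sg_bound n) => w bw _.
have [Aw|nAw] := pselect (A n w); last first.
  apply: (@le_trans _ _ 0%E); last by apply: adde_ge0; [exact: k0w|exact: G0w].
  rewrite le_eqVlt; apply/orP; left; apply/eqP; apply: integral0_eq => r _.
  by rewrite /g /= indicE memNset ?mul0r ?normr0// => -[].
rewrite indicE mem_set// mule1.
apply: (@le_trans _ _ (\int[mu]_(r in `[0%R, sg n w]) ((1 + C) * kap r w + G r w)%:E)%E).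
  rewrite [leRHS]integral_mkcond; apply: ge0_le_integral => //.
  - exact: (measurableT_comp mag (measurable_pair2 w)).
  - have mkG : measurable_fun setT (fun p : TR * Om => (1 + C) * kap p.1 p.2 + G p.1 p.2).
      by apply: measurable_funD => //; exact: measurable_funM.
    apply/(measurable_restrict _ _ _ ) => //; apply: measurable_funTS.
    by apply/measurable_EFinP; exact: (measurableT_comp mkG (measurable_pair2 w)).
  - move=> r _; rewrite patchE /=.
    have [/set_mem|rn] := boolP (r \in _).
      rewrite /= in_itv/= => /andP[r0 rs]; rewrite lee_fin /g/= indicE mem_set// mul1r.
      exact: gap_le.
    rewrite /g /= indicE memNset ?mul0r ?normr0// => -[/= r0 rs _].
    by move/negP: rn; apply; rewrite inE/= in_itv/= r0.
have msec (f : R -> Om -> R) (a c : R) : measurable_fun setT (fun p : TR * Om => f p.1 p.2) ->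
    measurable_fun `[a, c] (fun r : TR => (f r w)%:E).
  exact: measurable_inner.
under eq_integral do rewrite EFinD.
rewrite ge0_integralD//; last 4 first.
- by move=> r _; rewrite lee_fin mulr_ge0// addr_ge0.
- by apply: (msec (fun r w => (1 + C) * kap r w)); exact: measurable_funM.
- by move=> r _; rewrite lee_fin.
- exact: msec.
apply: leeD.
  under eq_integral do rewrite EFinM.
  rewrite ge0_integralZl//; last 3 first.
  - exact: msec.
  - by move=> r _; rewrite lee_fin.
  - by rewrite lee_fin addr_ge0.
  rewrite EFinM; apply: lee_wpmul2l; first by rewrite lee_fin addr_ge0.
  by apply: (le_trans bw); rewrite lee_fin ler_norm.
apply: ge0_subset_integral => //.
- exact: msec.
- by move=> r _; rewrite lee_fin.
- by apply: subset_itvl; rewrite bnd_simp; case/andP: (sg_itv n w).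
Qed.

Let average_region n eps h s w : A n w -> 0 <= s ->
  forward_average h (fun r => g n eps (r, w)) s =
  h^-1 * \int[mu]_(r in `[s, Num.min (sg n w) (Num.min (s + h) T)]) gap eps r w.
Proof.
move=> Aw s0; rewrite /forward_average; congr (_ * _).
have sgT : sg n w <= T by case/andP: (sg_itv n w).
have -> : `[s, Num.min (sg n w) (Num.min (s + h) T)]%classic =
    `[s, s + h] `&` [set r : TR | r <= sg n w].
  apply/seteqP; split=> r /=; rewrite !in_itv/= !le_min.
    by move=> /and3P[-> -> /andP[-> _]].
  by move=> [/andP[-> ->] rs]; rewrite rs (le_trans rs).
rewrite Rintegral_mkcondr; apply: eq_Rintegral => r; rewrite inE/= in_itv/= => /andP[sr _].
rewrite /g /= patchE; have [/set_mem rs|rs] := boolP (r \in _).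
  by rewrite indicE mem_set ?mul1r//; split => //; exact: le_trans sr.
rewrite indicE memNset ?mul0r// => -[_ /= rs' _].
by move/negP: rs; apply; rewrite inE.
Qed.

(** The test event at time s: the choice of the sign of eps Gamma_s(u,v) is known
    at time s. *)
Let B_ n eps s : set Om := [set w | 0 <= eps * Gam s w] `&` [set w | s <= sg n w] `&` A n.

Let B_F n eps s : 0 <= s <= T -> Ft s (B_ n eps s).
Proof.
move=> s0T; apply: position_genI; last first.
  by apply: position_gen_le (A_F n); case/andP: s0T.
apply: position_genI; last exact: sg_adapted.
have mp : position_measurable `[0, s] (fun w => eps * Gam s w).
  by apply: measurable_funM => //; exact: carre_adapted.
have -> : [set w | 0 <= eps * Gam s w] = setT `&` (fun w => eps * Gam s w) @^-1` `[0, +oo[.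
  by rewrite setTI; apply/seteqP; split=> w /=; rewrite in_itv/= andbT.
by apply: mp => //; exact: measurable_itv.
Qed.

Let B_fin n eps s : 0 <= s <= T -> (Q (B_ n eps s) < +oo)%E.
Proof.
move=> s0T; apply: le_lt_trans (A_fin n); apply: le_measure; rewrite ?inE//.
by apply: position_gen_le_measurable (B_F n eps s0T); case/andP: s0T.
by move=> w [].
Qed.

Let G' := @time_cut R T X G.

Let mG' : measurable_fun setT (fun p : TR * Om => G' p.1 p.2).
Proof. by apply: measurable_time_cut; apply: measurable_funTS. Qed.

Let G'0 r w : 0 <= G' r w.
Proof. by rewrite /G' /time_cut; case: ifP. Qed.

Let G'E a c w : 0 <= a -> c <= T ->
  (\int[mu]_(r in `[a, c]) (G r w)%:E = \int[mu]_(r in `[a, c]) (G' r w)%:E)%E.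
Proof.
move=> a0 cT; apply: eq_integral => r; rewrite inE/= in_itv/= => /andP[ar rc].
by rewrite /G' time_cutE// (le_trans a0 ar) (le_trans rc).
Qed.

Let G'T w : (\int[mu]_r (G' r w)%:E = \int[mu]_(r in `[0%R, T]) (G r w)%:E)%E.
Proof.
rewrite [RHS]integral_mkcond; apply: eq_integral => r _; rewrite patchE /G' /time_cut.
by rewrite mem_setE in_itv/=; case: ifP.
Qed.

Let avg n eps h s w := forward_average h (fun r => g n eps (r, w)) s.

(** On the test event, eps Gamma_s is at most g_s + G_s, and g_s is replaced by its
    forward average, whose integral is controlled by [polarized_energy_le]. *)
Let slice_le n eps h s : `|eps| <= 1 -> 0 < h -> h <= 2^-1 -> 0 <= s <= T ->
  (\int[Q]_(w in B_ n eps s) (eps * Gam s w)%:E <=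
   (12 * Num.sqrt h / h)%:E * (\int[Q]_w \int[mu]_(r in `[s, (s + h)%R]) (G' r w)%:E)
   + (\int[Q]_w (`|avg n eps h s w - g n eps (s, w)|%:E + (G' s w)%:E)))%E.
Proof.
move=> eps1 h0 h2 s0T; have /andP[s0 sT] := s0T.
pose s' := Num.min (s + h) T.
have ss' : s <= s' by rewrite le_min sT lerDl ltW.
have s'T : s' <= T by rewrite ge_min lexx orbT.
have s'h : s' - s <= h by rewrite lerBlDl ge_min lexx.
have FB := B_F n eps s0T.
have mB : measurable (B_ n eps s) by apply: position_gen_le_measurable FB.
have sgT w : sg n w <= T by case/andP: (sg_itv n w).
have DI_le : (double_integral Q (B_ n eps s) s s' G <=
    \int[Q]_w \int[mu]_(r in `[s, (s + h)%R]) (G' r w)%:E)%E.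
  apply: (@le_trans _ _ (double_integral Q (B_ n eps s) s s' G')).
    by rewrite /double_integral le_eqVlt; apply/orP; left; apply/eqP; apply: eq_integral => w _; exact: G'E.
  by apply: subset_double_integral => //; rewrite ge_min lexx.
have DI_fin : (double_integral Q (B_ n eps s) s s' G < +oo)%E.
  by apply: le_lt_trans G_fin; apply: subset_double_integral.
have [iY Yle] := polarized_energy_le T_gt0 en_u en_v obs_uv mG G_ge (sg_mes n) sgT
  (@gen_u n) (@gen_v n) (@gen_uu n) (@gen_vv n) (@gen_uv n) eps1 s0 ss' s'T h0 s'h h2
  FB (B_fin n eps s0T) (fun w Bw => Bw.1.2) DI_fin.
have avgE w : B_ n eps s w -> avg n eps h s w =
    h^-1 * \int[mu]_(r in `[s, Num.min (sg n w) s']) gap eps r w.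
  by move=> [_ Aw]; rewrite /avg average_region.
have iavg : Q.-integrable (B_ n eps s) (EFin \o avg n eps h s).
  apply: eq_integrable (integrableZl mB h^-1 iY) => // w /set_mem Bw.
  by rewrite /= avgE.
have avg_le : (\int[Q]_(w in B_ n eps s) (avg n eps h s w)%:E <=
    (12 * Num.sqrt h / h)%:E * (\int[Q]_w \int[mu]_(r in `[s, (s + h)%R]) (G' r w)%:E))%E.
  have -> : (\int[Q]_(w in B_ n eps s) (avg n eps h s w)%:E =
     (h^-1)%:E * \int[Q]_(w in B_ n eps s)
        (\int[mu]_(r in `[s, Num.min (sg n w) s']) gap eps r w)%:E)%E.
    rewrite -integralZl//; apply: eq_integral => w /set_mem Bw.
    by rewrite avgE// EFinM.
  rewrite (_ : 12 * Num.sqrt h / h = h^-1 * (12 * Num.sqrt h)); last by rewrite mulrC.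
  rewrite EFinM -muleA; apply: lee_wpmul2l; first by rewrite lee_fin invr_ge0 ltW.
  apply: (le_trans Yle); apply: lee_wpmul2l => //.
pose N w := (`|avg n eps h s w - g n eps (s, w)| + G' s w).
have mavg : measurable_fun setT (avg n eps h s).
  exact: (measurableT_comp (measurable_forward_average h (mg n eps)) (measurable_pair1 (s : TR))).
have mN : measurable_fun setT (EFin \o N).
  apply/measurable_EFinP; apply: measurable_funD.
    apply: measurableT_comp => //; apply: measurable_funB => //.
    exact: (measurableT_comp (mg n eps) (measurable_pair1 (s : TR))).
  exact: (measurableT_comp mG' (measurable_pair1 (s : TR))).
have N0 w : 0 <= N w by rewrite addr_ge0.
have N_le : (\int[Q]_(w in B_ n eps s) (N w)%:E <=
   \int[Q]_w (`|avg n eps h s w - g n eps (s, w)|%:E + (G' s w)%:E))%E.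
  apply: (@le_trans _ _ (\int[Q]_w (N w)%:E)%E); last first.
    by rewrite le_eqVlt; apply/orP; left; apply/eqP; apply: eq_integral => w _; rewrite EFinD.
  by apply: ge0_subset_integral => // w _; rewrite lee_fin.
apply: (le_trans _ (leeD avg_le N_le)).
have mBGam : measurable_fun (B_ n eps s) (fun w => (eps * Gam s w)%:E).
  apply: measurable_funTS; apply/measurable_EFinP; apply: measurable_funM => //.
  exact: (measurableT_comp mGam (measurable_pair1 (s : TR))).
have ptw w : B_ n eps s w -> eps * Gam s w <= avg n eps h s w + N w.
  move=> [[_ /= ssg] Aw].
  have gE : g n eps (s, w) = gap eps s w by rewrite /g/= indicE mem_set ?mul1r.
  have := ler_norm (g n eps (s, w) - avg n eps h s w); rewrite distrC.
  have G'G : G' s w = G s w by rewrite /G' time_cutE.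
  have gu := G_ge s w.
  rewrite /N G'G gE /polar_gap.
  set a := carre u u Kuu Ku Ku s w; set c := carre v v Kvv Kv Kv s w.
  move: gu; rewrite /energy_density -/a -/c.
  have := sqr_ge0 (Ku s w); have := sqr_ge0 (Kv s w).
  have := normr_ge0 a; have := normr_ge0 c; have := ler_norm a; have := ler_norm c.
  by lra.
have [Nfin|Ninf] := ltP (\int[Q]_(w in B_ n eps s) (N w)%:E)%E +oo%E; last first.
  have -> : (\int[Q]_(w in B_ n eps s) (N w)%:E = +oo)%E.
    by apply/eqP; rewrite -leye_eq.
  by rewrite addey ?leey// -ltNye; have := integrable_fin_num mB iavg; rewrite fin_numElt => /andP[].
have iN : Q.-integrable (B_ n eps s) (EFin \o N).
  apply/integrableP; split; first exact: measurable_funTS.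
  by under eq_integral do rewrite /= ger0_norm//.
have eD := integralD_EFin mB iavg iN.
rewrite /= in eD; rewrite -eD.
have isum : Q.-integrable (B_ n eps s) (fun w => (avg n eps h s w)%:E + (N w)%:E)%E.
  exact: (integrableD mB iavg iN).
apply: (@le_trans _ _ (\int[Q]_(w in B_ n eps s) `|(avg n eps h s w)%:E + (N w)%:E|)%E).
  apply: ge0_le_integral => //.
  - by move=> w [[Bw _] _]; rewrite lee_fin.
  - by apply: measurableT_comp => //; exact: measurable_int isum.
  - by move=> w Bw; rewrite -EFinD abse_EFin lee_fin (le_trans (ptw w Bw))// ler_norm.
rewrite le_eqVlt; apply/orP; left; apply/eqP; apply: eq_integral => w /set_mem Bw.
rewrite gee0_abs// -EFinD lee_fin (le_trans _ (ptw w Bw))//.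
by case: Bw => -[].
Qed.

Let P n eps (s : R) (w : Om) : R := \1_(region n) (s, w) * Num.max (eps * Gam s w) 0.

Let P0 n eps s w : 0 <= P n eps s w.
Proof. by rewrite mulr_ge0// le_max lexx orbT. Qed.

Let mP n eps : measurable_fun setT (fun p : TR * Om => P n eps p.1 p.2).
Proof.
have -> : (fun p : TR * Om => P n eps p.1 p.2) = (fun p => \1_(region n) p * Num.max (eps * Gam p.1 p.2) 0).
  by apply/funext => -[].
apply: measurable_funM; first exact: measurable_indic.
by apply: measurable_maxr => //; exact: measurable_funM.
Qed.

Let P_slice n eps s : 0 <= s <= T ->
  (\int[Q]_w (P n eps s w)%:E = \int[Q]_(w in B_ n eps s) (eps * Gam s w)%:E)%E.
Proof.
move=> /andP[s0 sT]; rewrite [RHS]integral_mkcond; apply: eq_integral => w _.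
rewrite patchE /P; have [/set_mem|nB] := boolP (w \in _).
  by move=> [[/= e0 ssg] Aw]; rewrite indicE mem_set// mul1r max_l.
have [rw|nrw] := pselect (region n (s, w)); last by rewrite indicE memNset ?mul0r.
rewrite max_r ?mulr0//; have [//|/ltW e0] := leP (eps * Gam s w) 0.
by move/negP: nB; case; apply/mem_set; case: rw.
Qed.

(** Integration of [slice_le] over s; the strips of width h contribute a factor
    h. *)
Let P_bound n eps h : `|eps| <= 1 -> 0 < h -> h <= 2^-1 ->
  (\int[Q]_w \int[mu]_s (P n eps s w)%:E <= (12 * Num.sqrt h)%:E * double_integral Q setT 0 T G
    + (\int[Q]_w \int[mu]_s `|avg n eps h s w - g n eps (s, w)|%:E) + double_integral Q setT 0 T G)%E.
Proof.
move=> eps1 h0 h2; set N := double_integral _ _ _ _ _.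
have mEP : measurable_fun setT (fun p : TR * Om => (P n eps p.1 p.2)%:E) by exact/measurable_EFinP.
have P0E (p : TR * Om) : (0 <= (P n eps p.1 p.2)%:E)%E by rewrite lee_fin.
rewrite -(fubini_tonelli (m1 := mu) (m2 := Q) _ mEP P0E)/=.
have GE : N = (\int[Q]_w \int[mu]_r (G' r w)%:E)%E.
  by apply: eq_integral => w _; rewrite G'T.
clearbody N.
have mI := measurable_strip_mean Q h mG' G'0.
have mavg : measurable_fun setT (fun p : TR * Om => `|avg n eps h p.1 p.2 - g n eps p|).
  apply: measurableT_comp => //; apply: measurable_funB => //.
  exact: (measurable_forward_average h (mg n eps)).
have mEavg : measurable_fun setT (fun p : TR * Om => `|avg n eps h p.1 p.2 - g n eps (p.1, p.2)|%:E).
  by apply/measurable_EFinP; apply: eq_measurable_fun mavg => -[].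
have avg0 (p : TR * Om) : (0 <= `|avg n eps h p.1 p.2 - g n eps (p.1, p.2)|%:E)%E by rewrite lee_fin.
have mEG : measurable_fun setT (fun p : TR * Om => (G' p.1 p.2)%:E) by exact/measurable_EFinP.
have G0E (p : TR * Om) : (0 <= (G' p.1 p.2)%:E)%E by rewrite lee_fin.
have m1 := measurable_fun_fubini_tonelli_F (m2 := Q) _ mEavg avg0.
have m2 := measurable_fun_fubini_tonelli_F (m2 := Q) _ mEG G0E.
have m3 := measurable_fun_fubini_tonelli_F (m2 := Q) _ mEP P0E.
rewrite /fubini_F/= in m1 m2 m3.
have c0 : 0 <= 12 * Num.sqrt h / h by rewrite divr_ge0//; exact: ltW h0.
have I0 (s : TR) : (0 <= \int[Q]_w \int[mu]_(r in `[s, (s + h)%R]) (G' r w)%:E)%E.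
  by apply: integral_ge0 => w _; apply: integral_ge0 => r _; rewrite lee_fin.
have sumE (s : TR) : (\int[Q]_w (`|avg n eps h s w - g n eps (s, w)|%:E + (G' s w)%:E) =
   \int[Q]_w `|avg n eps h s w - g n eps (s, w)|%:E + \int[Q]_w (G' s w)%:E)%E.
  rewrite ge0_integralD//.
  - exact: (measurableT_comp mEavg (measurable_pair1 s)).
  - by move=> w _; rewrite lee_fin.
  - exact: (measurableT_comp mEG (measurable_pair1 s)).
apply: (@le_trans _ _ (\int[mu]_s ((12 * Num.sqrt h / h)%:E * (\int[Q]_w \int[mu]_(r in `[s, (s + h)%R]) (G' r w)%:E)
 + (\int[Q]_w `|avg n eps h s w - g n eps (s, w)|%:E + \int[Q]_w (G' s w)%:E)))%E).
  apply: ge0_le_integral => //.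
  - by move=> s _; apply: integral_ge0 => w _; rewrite lee_fin.
  - by apply: emeasurable_funD; [exact: emeasurable_funM|exact: emeasurable_funD].
  - move=> s _; have [s0T|ns] := boolP (0 <= s <= T).
      by rewrite P_slice// -sumE; exact: (slice_le n eps1 h0 h2 s0T).
    rewrite integral0_eq.
      by apply: adde_ge0; [exact: mule_ge0|apply: adde_ge0; apply: integral_ge0 => w _; rewrite lee_fin].
    move=> w _; rewrite /P indicE memNset ?mul0r// => -[/= s0 ssg _].
    by move/negP: ns; apply; rewrite s0 (le_trans ssg)//; case/andP: (sg_itv n w).
rewrite ge0_integralD//; last 4 first.
- by move=> s _; rewrite mule_ge0// lee_fin.
- exact: emeasurable_funM.
- by move=> s _; rewrite adde_ge0//; apply: integral_ge0 => w _; rewrite lee_fin.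
- exact: emeasurable_funD.
rewrite ge0_integralD//; last 2 first.
- by move=> s _; apply: integral_ge0 => w _; rewrite lee_fin.
- by move=> s _; apply: integral_ge0 => w _; rewrite lee_fin.
rewrite ge0_integralZl//.
rewrite integral_strip_mean//; last exact: ltW h0.
rewrite -GE.
have -> : (\int[mu]_s \int[Q]_w (G' s w)%:E = N)%E.
  by rewrite (fubini_tonelli (m1 := mu) (m2 := Q) _ mEG G0E)/= -GE.
rewrite (fubini_tonelli (m1 := mu) (m2 := Q) _ mEavg avg0)/= addeA muleA -EFinM.
by rewrite divfK ?gt_eqF.
Qed.

(** As h tends to 0, the moving average of g tends to g in L1. *)
Let P_le n eps : `|eps| <= 1 ->
  (\int[Q]_w \int[mu]_s (P n eps s w)%:E <= double_integral Q setT 0 T G)%E.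
Proof.
move=> eps1.
(* The offset 2 makes every h_ m at most 1/2, as required by the oscillation bound. *)
pose h_ m : R := (m.+2%:R)^-1.
have h_gt0 m : 0 < h_ m by rewrite invr_gt0.
have h_le m : h_ m <= 2^-1 by rewrite lef_pV2 ?posrE// ler_nat.
have h_cvg : h_ m @[m --> \oo] --> (0 : R).
  by have := @cvg_harmonic R; rewrite -cvg_shiftS.
have r_cvg := forward_average_process_cvg h_gt0 h_cvg (region_integrable n eps1).
have bound m := P_bound n eps1 (h_gt0 m) (h_le m).
have NE : double_integral Q setT 0 T G = (fine (double_integral Q setT 0 T G))%:E.
  by rewrite fineK// ge0_fin_numE// double_integral_ge0.
move: bound r_cvg; rewrite /avg /= NE.
set N := fine _; set r_ := (fun m : nat => integral _ _ _); move=> bound r_cvg.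
have sqrt_cvg : 12 * Num.sqrt (h_ m) * N @[m --> \oo] --> (0 : R).
  have -> : 0 = 12 * Num.sqrt 0 * N by rewrite sqrtr0 mulr0 mul0r.
  apply: cvgM; last exact: cvg_cst.
  apply: cvgM; first exact: cvg_cst.
  by apply: (cvg_comp _ _ h_cvg); exact: sqrt_continuous.
have cvg : ((12 * Num.sqrt (h_ m) * N)%:E + r_ m + N%:E)%E @[m --> \oo] --> N%:E.
  rewrite -[X in _ --> X]add0e -[X in _ --> (X + _)%E]add0e.
  apply: cvgeD => //; last exact: cvg_cst.
  apply: cvgeD => //; apply/fine_cvgP; split; last exact: sqrt_cvg.
  by apply: nearW => m.
have near_bound : \forall m \near \oo, (\int[Q]_w \int[mu]_s (P n eps s w)%:E
    <= (12 * Num.sqrt (h_ m) * N)%:E + r_ m + N%:E)%E.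
  by exists 0%N => // m _ /=; rewrite EFinM; exact: bound.
exact: (cvge_ge near_bound cvg).
Qed.

(** Along almost every path the stopping time equals T from some n on. *)
Let pos_le eps : `|eps| <= 1 ->
  (\int[Q]_w \int[mu]_(s in `[0%R, T]) (Num.max (eps * Gam s w) 0)%:E <= double_integral Q setT 0 T G)%E.
Proof.
move=> eps1.
pose phi n w := (\int[mu]_s (P n eps s w)%:E)%E.
have phi0 n w : (0 <= phi n w)%E by apply: integral_ge0 => s _; rewrite lee_fin.
have mphi n : measurable_fun setT (phi n).
  have mEP : measurable_fun setT (fun p : TR * Om => (P n eps p.1 p.2)%:E) by exact/measurable_EFinP.
  have P0E (p : TR * Om) : (0 <= (P n eps p.1 p.2)%:E)%E by rewrite lee_fin.
  exact: (measurable_fun_fubini_tonelli_G (m1 := mu) _ mEP P0E).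
have mPs n w : measurable_fun setT (fun s : TR => (P n eps s w)%:E).
  by apply/measurable_EFinP; exact: (measurableT_comp (mP n eps) (measurable_pair2 w)).
have phi_nd w : nondecreasing_seq (phi^~ w).
  move=> n n' nn'; apply: ge0_le_integral => //.
  - by move=> s _; rewrite lee_fin.
  - move=> s _; rewrite lee_fin /P; apply: ler_wpM2r; first by rewrite le_max lexx orbT.
    rewrite !indicE ler_nat; have [/set_mem [/= s0 ss As]|//] := boolP ((s, w) \in region n).
    rewrite mem_set//; split => //=; last exact: A_mono As.
    exact: le_trans (sg_mono w nn').
have mc := @monotone_convergence _ _ _ Q setT measurableT phi mphi (fun n w _ => phi0 n w) (fun w _ => phi_nd w).
have -> : (\int[Q]_w \int[mu]_(s in `[0%R, T]) (Num.max (eps * Gam s w) 0)%:E =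
    \int[Q]_w limn (phi^~ w))%E.
  apply: ae_eq_integral => //.
  - have mm : measurable_fun setT (fun p : TR * Om => Num.max (eps * Gam p.1 p.2) 0).
      by apply: measurable_maxr => //; exact: measurable_funM.
    by apply: (@measurable_inner_integral _ _ _ (fun s w => Num.max (eps * Gam s w) 0)) => // r w; rewrite le_max lexx orbT.
  - by apply: measurable_fun_lim_esup || (apply: (emeasurable_fun_cvg phi) => // w _; apply: ereal_nondecreasing_is_cvgn; exact: phi_nd).
  apply: filterS sg_T => w [n0 sgE] _.
  have [n1 _ An1] : (\bigcup_n A n) w by rewrite A_cover.
  apply/esym/cvg_lim => //; apply: cvg_near_cst; exists (maxn n0 n1) => // n /= nn.
  rewrite [RHS]integral_mkcond; apply: eq_integral => s _; rewrite patchE /P mem_setE in_itv/=.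
  have nT : sg n w = T by apply: sgE; apply: leq_trans nn; exact: leq_maxl.
  case: ifP => [/andP[s0 sT]|ns].
    rewrite indicE mem_set ?mul1r//; split => //=; first by rewrite nT.
    by apply: A_mono An1; apply: leq_trans nn; exact: leq_maxr.
  by rewrite indicE memNset ?mul0r// => -[/= s0 ss _]; rewrite s0 -nT ss in ns.
rewrite mc; apply: lime_le.
  apply: ereal_nondecreasing_is_cvgn => n n' nn'; apply: ge0_le_integral => // w _.
  exact: phi_nd.
by apply: nearW => n; exact: P_le.
Qed.

(** The integrals of the positive parts of Gamma(u,v) and of -Gamma(u,v) are both at most
    the one of G. *)
Lemma carre_integrable : (double_integral Q setT 0 T (fun r w => `|Gam r w|)%R < +oo)%E.
Proof.
have e1 : `|1 : R| <= 1 by rewrite normr1.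
have e2 : `|-1 : R| <= 1 by rewrite normrN1.
apply: (@le_lt_trans _ _ (double_integral Q setT 0 T G + double_integral Q setT 0 T G)%E); last first.
  exact: lte_add_pinfty.
apply: le_trans (leeD (pos_le e1) (pos_le e2)).
have mm eps : measurable_fun setT (fun p : TR * Om => Num.max (eps * Gam p.1 p.2) 0).
  by apply: measurable_maxr => //; exact: measurable_funM.
have m0 eps r w : 0 <= Num.max (eps * Gam r w) 0 by rewrite le_max lexx orbT.
rewrite -[leRHS](@double_integralD _ _ _ Q setT 0 T (fun s w => Num.max (1 * Gam s w) 0) (fun s w => Num.max (-1 * Gam s w) 0))//.
apply: le_double_integral => //.
- exact: measurableT_comp.
- exact: measurable_funD.
- move=> r w; have [|] := leP 0 (Gam r w) => G_.
    by rewrite ger0_norm// mul1r max_l// lerDl.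
  by rewrite ltr0_norm// mulN1r addrC max_l ?lerDl// oppr_ge0 ltW.
Qed.

End carre_integrable.

(** * From test events to the L1 norm *)

Section contraction.
Context d (S : measurableType d) (R : realType).
Variable m : {measure set S -> \bar R}.
Variables (FF : set (set S)) (A : nat -> set S) (D : S -> R) (Y : S -> \bar R).
Hypothesis FF_mes : forall B, FF B -> measurable B.
Hypothesis FFI : forall B B', FF B -> FF B' -> FF (B `&` B').
Hypothesis FF_pos : FF [set w | 0 <= D w].
Hypothesis FF_neg : FF [set w | D w < 0].
Hypothesis A_F : forall n, FF (A n).
Hypothesis A_fin : forall n, (m (A n) < +oo)%E.
Hypothesis A_mono : nondecreasing_seq A.
Hypothesis A_cover : \bigcup_n A n = setT.
Hypothesis mY : measurable_fun setT Y.
Hypothesis Y0 : forall w, (0 <= Y w)%E.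
Hypothesis D_test : forall B, FF B -> (m B < +oo)%E ->
  m.-integrable B (EFin \o D) /\ (`|\int[m]_(w in B) (D w)%:E| <= \int[m]_(w in B) Y w)%E.

(** Test on the events {0 <= D} and {D < 0} inside A_n, and let A_n increase to
    the whole space. *)
Lemma integral_norm_le_test : (\int[m]_w `|D w|%:E <= \int[m]_w Y w)%E.
Proof.
have mP := FF_mes FF_pos; have mN := FF_mes FF_neg.
have part n (f : S -> \bar R) : measurable_fun (A n) f -> (forall w, A n w -> 0 <= f w)%E ->
    (\int[m]_(w in A n) f w = \int[m]_(w in A n `&` [set w | 0 <= D w]%R) f w
      + \int[m]_(w in A n `&` [set w | D w < 0]%R) f w)%E.
  move=> mf f0; have mA := FF_mes (A_F n).
  have AE : A n = (A n `&` [set w | 0 <= D w]) `|` (A n `&` [set w | D w < 0]).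
    apply/seteqP; split=> [w Aw|w [[]|[]]//].
    by have [Dw|Dw] := leP 0 (D w); [left|right].
  rewrite -ge0_integral_setU//.
  - by rewrite -AE.
  - exact: measurableI.
  - exact: measurableI.
  - by rewrite -AE.
  - by rewrite -AE.
  - apply/eqP/seteqP; split => // w [[_ /= D0] [_ /=]].
    by rewrite ltNge D0.
have fin n B : FF B -> (m (A n `&` B) < +oo)%E.
  move=> FB; apply: le_lt_trans (A_fin n); apply: le_measure; rewrite ?inE; last exact: subIsetl.
    by apply: FF_mes; exact: FFI.
  exact: FF_mes.
have step n : (\int[m]_(w in A n) `|D w|%:E <= \int[m]_(w in A n) Y w)%E.
  have [iD _] := D_test (A_F n) (A_fin n).
  rewrite (part n _ (measurable_funTS mY))// (part n (fun w => `|D w|%:E)); last 2 first.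
  - by have := measurableT_comp (@abse_measurable R setT) (measurable_int _ iD); apply: eq_measurable_fun.
  - by move=> w _; rewrite lee_fin.
  have FP := FFI (A_F n) FF_pos; have FN := FFI (A_F n) FF_neg.
  have [_ bP] := D_test FP (fin n _ FF_pos); have [iN bN] := D_test FN (fin n _ FF_neg).
  apply: leeD.
    apply: le_trans bP; apply: le_trans (lee_abs _).
    rewrite le_eqVlt; apply/orP; left; apply/eqP; apply: eq_integral => w /set_mem[_ /= D0].
    by rewrite ger0_norm.
  apply: le_trans bN; rewrite -abseN; apply: le_trans (lee_abs _).
  have mB := FF_mes FN; have zl := integralZl mB iN (-1); rewrite /= in zl.
  rewrite -mulN1e -zl le_eqVlt; apply/orP; left; apply/eqP; apply: eq_integral => w /set_mem[_ /= D0].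
  by rewrite ltr0_norm// -EFinM mulN1r.
have mD : measurable_fun setT (fun w => `|D w|%:E).
  rewrite -A_cover; apply/measurable_fun_bigcup; first by move=> n; exact: FF_mes.
  move=> n; have [iD _] := D_test (A_F n) (A_fin n).
  by have := measurableT_comp (@abse_measurable R setT) (measurable_int _ iD); apply: eq_measurable_fun.
have lim := @ge0_nondecreasing_set_cvg_integral _ _ _ A (fun w => `|D w|%:E) m A_mono
  (fun n => FF_mes (A_F n)) (fun n => measurable_funTS mD).
rewrite -A_cover; apply: (cvge_le _ (lim _)).
  exists 0%N => // n _ /=; apply: (le_trans (step n)).
  apply: ge0_subset_integral => //.
  - by apply: FF_mes.
  - by rewrite A_cover.
  - by rewrite A_cover.
  - by rewrite A_cover.
by move=> n w _; rewrite lee_fin.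
Qed.

End contraction.

Section exhaustion.
Context {R : realType} {T : R} {X : ptopologicalType}.
Local Notation Om := (cadlag_path T X).
Variable Q : {sigma_finite_measure set Om -> \bar R}.

(** Preimages under X_t of sets of finite measure for the law of X_t. *)
Lemma conditionable_exhaustion t : conditionable Q -> 0 <= t <= T ->
  exists A : nat -> set Om, [/\ forall n, <<s @position_gen R T X [set t] >> (A n),
    forall n, (Q (A n) < +oo)%E, nondecreasing_seq A & \bigcup_n A n = setT].
Proof.
move=> condQ t0T; have [F FT Ffin] := condQ t t0T.
have FF n : <<s @position_gen R T X [set t] >> (position t @^-1` F n).
  apply: sub_sigma_algebra; exists t => //; exists (F n); last by rewrite setTI.
  by have [] := Ffin n.
have mF n : measurable (position t @^-1` F n : set Om).
  by apply: position_gen_measurable (FF n) => r /= ->; rewrite in_itv.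
exists (fun n => \big[setU/set0]_(i < n.+1) (position t @^-1` F i)); split.
- move=> n; apply: (@bigsetU_measurable _ (g_sigma_algebraType (@position_gen R T X [set t]))) => i _.
  exact: FF.
- move=> n; apply: (@le_lt_trans _ _ (\sum_(i < n.+1) Q (position t @^-1` F i))%E).
    apply: (@Boole_inequality _ _ _ Q (fun i => position t @^-1` F i)) => i _; exact: mF.
  by apply: lte_sum_pinfty => i _; have [] := Ffin i.
- by move=> n n' nn'; apply/subsetPset; apply: (@subset_bigsetU _ (fun i => position t @^-1` F i) n.+1 n'.+1); rewrite ltnS.
- apply/seteqP; split => // w _.
  have [k _ Fk] : (\bigcup_n F n) (position t w) by rewrite -FT.
  by exists k => //; exact: (@bigsetU_sup _ _ _ (fun i => position t @^-1` F i) (ltnSn k) _ Fk).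
Qed.

End exhaustion.

(** * The rate at a fixed time *)

Section rate.
Context {R : realType} {T : R} {X : ptopologicalType}.
Hypothesis T_gt0 : 0 < T.
Local Notation Om := (cadlag_path T X).
Local Notation TR := (measurableTypeR R).
Local Notation mu := (@lebesgue_measure R).
Local Notation Ft t := (<<s @position_gen R T X `[0, t] >>).
Variable Q : {sigma_finite_measure set Om -> \bar R}.

Variables (C : R) (u v : X -> R) (Ku Kuu Kv Kvv Kuv G : R -> Om -> R).
Hypothesis en_u : energetic Q C u Ku Kuu.
Hypothesis en_v : energetic Q C v Kv Kvv.
Hypothesis obs_uv : observable_of Q (C * C) (u \* v) Kuv.
Hypothesis gen_uv : stopped_generator Q (cst T) (u \* v) Kuv.
Hypothesis mG : measurable_fun setT (fun p : TR * Om => G p.1 p.2).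
Hypothesis G_ge : forall r w, 2 * (energy_density u Ku Kuu r w + energy_density v Kv Kvv r w) <= G r w.

Local Notation Gam := (carre u v Kuv Ku Kv).

(** An upper bound, before integration over w, for the distance at time t: the
    defect of the moving average, and the error terms divided by h. *)
Definition rate_bound (h t : R) (w : Om) : \bar R :=
  (`|forward_average h (Gam ^~ w) t - Gam t w|%:E
   + (h^-1 * (4 * Num.sqrt h))%:E * \int[mu]_(r in `[t, (t + h)%R]) (G r w)%:E)%E.

Let G0 r w : 0 <= G r w := G_ge0 G_ge r w.

Lemma measurable_carre_uv : measurable_fun setT (fun p : TR * Om => Gam p.1 p.2).
Proof.
have [mu_ cu _ mKu _] := en_obs en_u; have [mv cv _ mKv _] := en_obs en_v.
by apply: measurable_carre => //; exact: obs_process obs_uv.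
Qed.

Lemma measurable_average_gap h :
  measurable_fun setT (fun p : TR * Om => `|forward_average h (Gam ^~ p.2) p.1 - Gam p.1 p.2|).
Proof.
apply: measurableT_comp => //; apply: measurable_funB; last exact: measurable_carre_uv.
exact: (measurable_forward_average h measurable_carre_uv).
Qed.

Lemma measurable_rate_bound h : measurable_fun setT (fun p : TR * Om => rate_bound h p.1 p.2).
Proof.
apply: emeasurable_funD.
  by apply/measurable_EFinP; exact: measurable_average_gap.
apply: emeasurable_funM => //.
exact: (measurable_strip_integral (g := fun p => G p.1 p.2) h mG).
Qed.

Lemma rate_bound_ge0 h t w : 0 < h -> (0 <= rate_bound h t w)%E.
Proof.
move=> h0; apply: adde_ge0 => //; apply: mule_ge0.
  by rewrite lee_fin mulr_ge0// ?invr_ge0 ?(ltW h0)// mulr_ge0// sqrtr_ge0.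
by apply: integral_ge0 => r _; rewrite lee_fin.
Qed.

(** Divide the energy identity by h and subtract Gamma_t; the integral of Gamma
    becomes a moving average, and the error terms are bounded by
    [carre_error_le]. *)
Lemma increment_test_le h t B : 0 < h -> h <= 2^-1 -> 0 <= t -> t + h <= T ->
  Ft t B -> (Q B < +oo)%E ->
  Q.-integrable B (EFin \o incr_quotient u v h t) -> Q.-integrable B (EFin \o Gam t) ->
  (`|\int[Q]_(w in B) (incr_quotient u v h t w - Gam t w)%:E| <= \int[Q]_(w in B) rate_bound h t w)%E.
Proof.
move=> h0 h2 t0 thT FB QB iq iGam.
have tT : t <= T by apply: le_trans thT; rewrite lerDl ltW.
have tth : t <= t + h by rewrite lerDl ltW.
have mB : measurable B by apply: position_gen_le_measurable FB.
have [mu_ cu bu mKu iKu] := en_obs en_u; have [mv cv bv mKv iKv] := en_obs en_v.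
have [_ _ _ mKuv iKuv] := obs_uv.
pose err := carre_error u v Ku Kv t.
pose Y w := h^-1 * \int[mu]_(r in `[t, t + h]) (Gam r w + err r w).
have merr : measurable_fun setT (fun p : TR * Om => err p.1 p.2) by exact: measurable_carre_error.
have mGam := measurable_carre_uv.
have mz : mean_zero Q B (fun w => incr_quotient u v h t w - Y w).
  have := energy_identity T_gt0 (measurable_cst T) mu_ cu bu mv cv bv mKu mKv mKuv iKu iKv iKuv
    (en_gen en_u) (en_gen en_v) gen_uv t0 tth thT FB QB (fun _ _ => tT).
  move/(mean_zeroZ h^-1 mB); apply: mean_zero_eq => // w _ /=.
  by rewrite /incr_quotient /Y min_r// mulrBr mulrA.
have [iY eY] := mean_zero_split mB iq mz.
have mw (w : Om) (f : R -> Om -> R) : measurable_fun setT (fun p : TR * Om => f p.1 p.2) ->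
  measurable_fun `[t, t + h] (fun r : TR => (f r w)%:E) by move=> mf; exact: measurable_inner.
have mY : measurable_fun B Y by apply/measurable_EFinP; exact: measurable_int iY.
have -> : (\int[Q]_(w in B) (incr_quotient u v h t w - Gam t w)%:E = \int[Q]_(w in B) (Y w - Gam t w)%:E)%E.
  have e1 := integralB_EFin mB iq iGam; have e2 := integralB_EFin mB iY iGam.
  by rewrite /= in e1 e2; rewrite e1 e2 eY.
have mGt : measurable_fun setT (Gam t) by exact: (measurableT_comp mGam (measurable_pair1 (t : TR))).
have mYG : measurable_fun B (fun w => Y w - Gam t w).
  by apply: measurable_funB => //; exact: measurable_funTS.
apply: le_trans (le_abse_integral _ mB _) _; first exact/measurable_EFinP.
have mgap : measurable_fun setT (fun w => `|forward_average h (Gam ^~ w) t - Gam t w|%:E).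
  apply/measurable_EFinP; exact: (measurableT_comp (measurable_average_gap h) (measurable_pair1 (t : TR))).
have merr_in : measurable_fun setT (fun w => \int[mu]_(r in `[t, (t + h)%R]) `|err r w|%:E)%E.
  by apply: (@measurable_inner_integral _ _ _ (fun r w => `|err r w|)) => //; exact: measurableT_comp.
have mG_in : measurable_fun setT (fun w => \int[mu]_(r in `[t, (t + h)%R]) (G r w)%:E)%E.
  exact: (@measurable_inner_integral _ _ _ G).
have err0 w : (0 <= \int[mu]_(r in `[t, (t + h)%R]) `|err r w|%:E)%E.
  by apply: integral_ge0 => r _; rewrite lee_fin.
have G_in0 w : (0 <= \int[mu]_(r in `[t, (t + h)%R]) (G r w)%:E)%E.
  by apply: integral_ge0 => r _; rewrite lee_fin.
have hV0 : 0 <= h^-1 by rewrite invr_ge0 ltW.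
have c0 : 0 <= h^-1 * (4 * Num.sqrt h) by rewrite mulr_ge0.
apply: (@le_trans _ _ (\int[Q]_(w in B) (`|forward_average h (Gam ^~ w) t - Gam t w|%:E
    + (h^-1)%:E * \int[mu]_(r in `[t, (t + h)%R]) `|err r w|%:E))%E).
  apply: ae_ge0_le_integral => //.
  - by apply/measurableT_comp => //; exact/measurable_EFinP.
  - by move=> w _; rewrite adde_ge0// mule_ge0// lee_fin.
  - by apply: measurable_funTS; apply: emeasurable_funD => //; exact: emeasurable_funM.
  apply: filterS3 iKu iKv iKuv => w iKuw iKvw iKuvw Bw.
  have mT : measurable (`[0, T] : set TR) by exact: measurable_itv.
  have mI : measurable (`[t, t + h] : set TR) by exact: measurable_itv.
  have sub : `[t, t + h] `<=` (`[0, T] : set R).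
    by move=> r; rewrite /= !in_itv/= => /andP[tr rth]; rewrite (le_trans t0)// (le_trans rth).
  have iG := integrableS mT mI sub (carre_path_integrable T_gt0 (en_obs en_u) (en_obs en_v) iKuw iKvw iKuvw).
  have ie := integrableS mT mI sub (carre_error_path_integrable T_gt0 t (en_obs en_u) (en_obs en_v) iKuw iKvw).
  have YE : Y w = forward_average h (Gam ^~ w) t + h^-1 * \int[mu]_(r in `[t, t + h]) err r w.
    by rewrite /Y RintegralD// mulrDr.
  have nE := norm_Rintegral_le mu mI (measurable_funTS (measurableT_comp merr (measurable_pair2 w))).
  rewrite abse_EFin YE; apply: (@le_trans _ _ ((`|forward_average h (Gam ^~ w) t - Gam t w|
      + h^-1 * `|\int[mu]_(r in `[t, t + h]) err r w|)%:E)).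
    rewrite lee_fin addrAC (le_trans (ler_normD _ _))// lerD2l normrM ger0_norm//.
  by rewrite EFinD EFinM; apply: leeD => //; apply: lee_wpmul2l.
have DI := carre_error_le T_gt0 en_u en_v mG (density_le_uv G_ge) (density_le_vu G_ge) t0 tth thT h0
  (ltac:(by rewrite addrC addKr) : t + h - t <= h) h2 FB QB.
rewrite ge0_integralD//; last 3 first.
- exact: measurable_funTS.
- by move=> w _; rewrite mule_ge0.
- by apply: measurable_funTS; exact: emeasurable_funM.
rewrite /rate_bound ge0_integralD//; last 3 first.
- exact: measurable_funTS.
- by move=> w _; rewrite mule_ge0.
- by apply: measurable_funTS; exact: emeasurable_funM.
apply: leeD => //.
rewrite ge0_integralZl//; last exact: measurable_funTS.
rewrite ge0_integralZl//; last exact: measurable_funTS.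
by rewrite EFinM -muleA; apply: lee_wpmul2l.
Qed.

(** The conditional expectations e and g have the same integrals as the increment
    quotient and Gamma_t over the events of I, which belong to the past of t. *)
Lemma cond_exp_rate_le h t (I : set R) (e g : Om -> R) : conditionable Q ->
  0 < h -> h <= 2^-1 -> 0 <= t -> t + h <= T -> I t -> I `<=` `[0, t] ->
  cond_exp Q I (incr_quotient u v h t) e -> cond_exp Q I (Gam t) g ->
  (\int[Q]_w `|e w - g w|%:E <= \int[Q]_w rate_bound h t w)%E.
Proof.
move=> condQ h0 h2 t0 thT It It0 [me e_exp] [mg g_exp].
have tT : t <= T by apply: le_trans thT; rewrite lerDl ltW.
have t0T : 0 <= t <= T by rewrite t0.
have [A [A_F A_fin A_mono A_cover]] := conditionable_exhaustion condQ t0T.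
have FtI B : <<s @position_gen R T X I >> B -> Ft t B by exact: position_gen_sub.
have mD : position_measurable I (fun w => e w - g w) by apply: measurable_funB.
apply: (@integral_norm_le_test _ _ _ Q <<s @position_gen R T X I >> A) => //.
- by move=> B /FtI; exact: position_gen_le_measurable.
- by move=> B B'; exact: position_genI.
- have -> : [set w | 0 <= e w - g w] = setT `&` (fun w => e w - g w) @^-1` `[0, +oo[.
    by rewrite setTI; apply/seteqP; split=> w /=; rewrite in_itv/= andbT.
  by apply: mD => //; exact: measurable_itv.
- have -> : [set w | e w - g w < 0] = setT `&` (fun w => e w - g w) @^-1` `]-oo, 0[.
    by rewrite setTI; apply/seteqP; split=> w /=; rewrite in_itv/=.
  by apply: mD => //; exact: measurable_itv.
- by move=> n; apply: position_gen_sub (A_F n) => r /= ->.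
- exact: (measurableT_comp (measurable_rate_bound h) (measurable_pair1 (t : TR))).
- by move=> w; exact: rate_bound_ge0.
move=> B FB QB; have [iq ie eE] := e_exp B FB QB; have [iG ig gE] := g_exp B FB QB.
have mB : measurable B by apply: position_gen_le_measurable (FtI _ FB).
split; first exact: (integrableB mB ie ig).
have e1 := integralB_EFin mB ie ig; have e2 := integralB_EFin mB iq iG.
rewrite /= in e1 e2; rewrite e1 eE gE -e2.
exact: increment_test_le (FtI _ FB) QB iq iG.
Qed.

End rate.

(** * A continuous function along the paths *)

Lemma continuous_borel {R : realType} (X : ptopologicalType) (f : X -> R) :
  continuous f -> measurable_fun setT (f : borel X -> R).
Proof.
move=> cf; apply: (measurability (@RGenOInfty.G R)); first exact: RGenOInfty.measurableE.
move=> _ [_ [x ->] <-]; rewrite setTI; apply: sub_sigma_algebra.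
by move/continuousP: cf; apply; rewrite set_itvE; exact: open_gt.
Qed.

Section along_path.
Context {R : realType} {T : R} {X : ptopologicalType}.
Hypothesis T_gt0 : 0 < T.
Local Notation Om := (cadlag_path T X).
Local Notation TR := (measurableTypeR R).
Local Notation mu := (@lebesgue_measure R).
Local Notation clampT := (@clamp R T).
Variable Q : {sigma_finite_measure set Om -> \bar R}.
Variable gamma : R -> X -> R.
Hypothesis gamma_cont : {within `[0, T] `*` [set: X], continuous (fun p : R * X => gamma p.1 p.2)}.

Let gamma_cvg (p : R * X) : 0 <= p.1 <= T ->
  gamma q.1 q.2 @[q --> within (`[0, T] `*` [set: X]) (nbhs p)] --> gamma p.1 p.2.
Proof.
by move=> p0T; move/subspace_continuousP: gamma_cont; apply; split; rewrite //= in_itv.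
Qed.

Let clamp_cvg (t : R) : clampT s @[s --> t^'+] --> clampT t.
Proof.
have dist s : `|clampT t - clampT s| <= `|t - s|.
  rewrite /clamp.
  have T0 := T_gt0; have ts := ler_norm (t - s); have st := ler_norm (s - t); rewrite distrC in st.
  rewrite ler_norml.
  by have [?|?] := leP t T; have [?|?] := leP s T; have [?|?] := leP 0 T;
     have [?|?] := leP 0 t; have [?|?] := leP 0 s; lra.
apply/cvgrPdist_lt => e e0; near=> s; apply: (le_lt_trans (dist s)).
near: s; apply: cvgr_dist_lt => //; exact: cvg_at_right_filter (@cvg_id _ _).
Unshelve. all: by end_near. Qed.

(** Defined for all times by clamping, so that it is right-continuous on the
    whole line. *)
Definition along_path (t : R) (w : Om) : R := gamma (clampT t) (position t w).

Lemma along_path_right_cvg w t : along_path s w @[s --> t^'+] --> along_path t w.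
Proof.
have c : (clampT s, path_fun w s) @[s --> t^'+] --> (clampT t, path_fun w t).
  exact: (cvg_pair (@clamp_cvg t) (@path_right_cvg _ _ _ w t)).
have cw : (clampT s, path_fun w s) @[s --> t^'+] -->
    within (`[0, T] `*` [set: X]) (nbhs (clampT t, path_fun w t)).
  move=> U /c /= cU; suff : \forall s \near t^'+, U (clampT s, path_fun w s) by [].
  have {}cU : \forall s \near t^'+, (`[0, T] `*` [set: X]) (clampT s, path_fun w s) ->
      U (clampT s, path_fun w s) by exact: cU.
  by apply: filterS cU => s; apply; split => //=; rewrite in_itv/= (clampP T_gt0).
exact: (cvg_comp _ _ cw (@gamma_cvg (clampT t, path_fun w t) (clampP T_gt0 t))).
Qed.

Lemma measurable_along_path : measurable_fun setT (fun p : TR * Om => along_path p.1 p.2).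
Proof.
apply: measurable_right_continuous; last exact: along_path_right_cvg.
move=> t; apply: (measurable_comp_position T_gt0 t (u := gamma (clampT t))).
apply: continuous_borel => x.
have c : (clampT t, y) @[y --> x] --> (clampT t, x).
  exact: (cvg_pair (cvg_cst (clampT t)) (@cvg_id _ (nbhs x))).
have cw : (clampT t, y) @[y --> x] --> within (`[0, T] `*` [set: X]) (nbhs (clampT t, x)).
  move=> U /c /= cU; suff : \forall y \near x, U (clampT t, y) by [].
  have {}cU : \forall y \near x, (`[0, T] `*` [set: X]) (clampT t, y) -> U (clampT t, y) by exact: cU.
  by apply: filterS cU => y; apply; split => //=; rewrite in_itv/= (clampP T_gt0).
exact: (cvg_comp _ _ cw (@gamma_cvg (clampT t, x) (clampP T_gt0 t))).
Qed.

(** Set to 0 outside [0,T[: with the right endpoint excluded it is still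
    right-continuous everywhere, and it becomes integrable over the line. *)
Definition live_path (t : R) (w : Om) : R := if 0 <= t < T then along_path t w else 0.

Lemma measurable_live_path : measurable_fun setT (fun p : TR * Om => live_path p.1 p.2).
Proof.
have -> : (fun p : TR * Om => live_path p.1 p.2) =
    (fun p => \1_(`[0, T[%classic : set TR) p.1 * along_path p.1 p.2).
  apply/funext => p; rewrite /live_path indicE mem_setE in_itv/=.
  by case: ifP; rewrite ?mul1r ?mul0r.
apply: measurable_funM; last exact: measurable_along_path.
by apply: measurableT_comp => //; exact: measurable_indic.
Qed.

Lemma live_path_right_cvg w t : live_path s w @[s --> t^'+] --> live_path t w.
Proof.
have [/andP[t0 tT]|tN] := boolP (0 <= t < T).
  have -> : live_path t w = along_path t w by rewrite /live_path t0 tT.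
  have near_eq : \forall s \near t^'+, along_path s w = live_path s w.
    near=> s; rewrite /live_path ifT//; apply/andP; split.
      by rewrite (le_trans t0)//; near: s; exact: nbhs_right_ge.
    by near: s; exact: nbhs_right_lt.
  apply: cvg_trans (@along_path_right_cvg w t); exact: near_eq_cvg.
have -> : live_path t w = 0 by rewrite /live_path (negbTE tN).
have [t0|t0] := ltP t 0; apply: cvg_near_cst; near=> s; rewrite /live_path ifF//.
  have s0 : s < 0 by near: s; exact: nbhs_right_lt.
  by rewrite leNgt s0.
have ts : t < s by near: s; exact: nbhs_right_gt.
by apply/negP => /andP[_ sT]; move: tN; rewrite t0 (lt_trans ts).
Unshelve. all: by end_near. Qed.

(** Pointwise convergence is right-continuity, and a translation in time preserves the L1
    norm. *)
Lemma live_path_drift_cvg (h_ : nat -> R) :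
  (mu \x Q)%E.-integrable setT (fun p : TR * Om => (live_path p.1 p.2)%:E) ->
  (forall n, 0 < h_ n) -> h_ n @[n --> \oo] --> 0 ->
  (\int[mu]_t \int[Q]_w `|live_path (t + h_ n)%R w - live_path t w|%:E)%E @[n --> \oo] --> 0%E.
Proof.
move=> gi h_gt0 h_cvg.
have mg := measurable_live_path.
have mshift (h : R) : measurable_fun setT (fun p : TR * Om => live_path (p.1 + h)%R p.2).
  have mp : measurable_fun setT (fun p : TR * Om => (p.1 + h : TR, p.2)).
    by apply/measurable_fun_pair => //; exact: measurable_funD.
  exact: (measurableT_comp mg mp).
have S : (\int[(mu \x Q)%E]_p `|live_path (p.1 + h_ n)%R p.2 - live_path p.1 p.2|%:E)%E
    @[n --> \oo] --> 0%E.
  apply: (@scheffe _ _ _ (mu \x Q)%E (fun n p => live_path (p.1 + h_ n)%R p.2)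
    (fun p => live_path p.1 p.2) (fun n => mshift (h_ n)) gi).
  - apply: aeW => -[t w] /=.
    move/cvg_at_rightP: (@live_path_right_cvg w t); apply; split => [n|]; first by rewrite ltrDl.
    rewrite -[X in _ --> X]addr0; apply: cvgD => //; exact: cvg_cst.
  - move=> n.
    have mE (h : R) : measurable_fun setT (fun p : TR * Om => `|live_path (p.1 + h)%R p.2|%:E).
      by apply/measurable_EFinP; exact: measurableT_comp.
    have m0E : measurable_fun setT (fun p : TR * Om => `|live_path p.1 p.2|%:E).
      by apply/measurable_EFinP; exact: measurableT_comp.
    rewrite (fubini_tonelli1 (m1 := mu) (m2 := Q) _ (mE (h_ n)))// (fubini_tonelli1 (m1 := mu) (m2 := Q) _ m0E)//.
    rewrite /fubini_F/= le_eqVlt; apply/orP; left; apply/eqP.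
    apply: (ge0_integral_shift (h_ n) (f := fun t => \int[Q]_w `|live_path t w|%:E)%E).
      exact: (measurable_fun_fubini_tonelli_F (m2 := Q) _ m0E).
    by move=> t; apply: integral_ge0 => w _; rewrite lee_fin.
have := S.
have -> // : (fun n => \int[(mu \x Q)%E]_p `|live_path (p.1 + h_ n)%R p.2 - live_path p.1 p.2|%:E)%E =
  (fun n => \int[mu]_t \int[Q]_w `|live_path (t + h_ n)%R w - live_path t w|%:E)%E.
apply/funext => n; rewrite (fubini_tonelli1 (m1 := mu) (m2 := Q))//.
apply/measurable_EFinP; apply: measurableT_comp => //; exact: measurable_funB.
Qed.

End along_path.

(** * Passage to the limit *)

(** The limits at 0+ are tested along sequences, where dominated convergence is
    available. *)
Lemma at_right_squeeze {R : realType} (a b : R -> \bar R) (c : R) : 0 < c ->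
  (forall h, 0 < h < c -> (0 <= a h <= b h)%E) ->
  (forall h_ : nat -> R, (forall n, 0 < h_ n) -> h_ n @[n --> \oo] --> 0 ->
     b (h_ n) @[n --> \oo] --> 0%E) ->
  a h @[h --> 0^'+] --> 0%E.
Proof.
move=> c0 ab bcvg; apply/cvge_at_rightP => h_ [h_gt0 h_cvg].
apply: (@squeeze_cvge _ _ _ _ (fun=> 0%E) _ (fun n => b (h_ n))).
- near=> n; apply: ab; rewrite h_gt0/=; near: n.
  exact: (cvgr_lt _ h_cvg).
- exact: cvg_cst.
- exact: bcvg.
Unshelve. all: by end_near. Qed.

Section limits.
Context {R : realType} {T : R} {X : ptopologicalType}.
Hypothesis T_gt0 : 0 < T.
Local Notation Om := (cadlag_path T X).
Local Notation TR := (measurableTypeR R).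
Local Notation mu := (@lebesgue_measure R).
Variable Q : {sigma_finite_measure set Om -> \bar R}.
Hypothesis condQ : conditionable Q.

Variables (C : R) (u v : X -> R) (Ku Kuu Kv Kvv Kuv G : R -> Om -> R).
Hypothesis en_u : energetic Q C u Ku Kuu.
Hypothesis en_v : energetic Q C v Kv Kvv.
Hypothesis obs_uv : observable_of Q (C * C) (u \* v) Kuv.
Hypothesis gen_uv : stopped_generator Q (cst T) (u \* v) Kuv.
Hypothesis mG : measurable_fun setT (fun p : TR * Om => G p.1 p.2).
Hypothesis G_ge : forall r w, 2 * (energy_density u Ku Kuu r w + energy_density v Kv Kvv r w) <= G r w.
Hypothesis G_fin : (\int[Q]_w \int[mu]_r (G r w)%:E < +oo)%E.

Local Notation Gam := (carre u v Kuv Ku Kv).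
Local Notation rate := (rate_bound u v Ku Kv Kuv G).
Hypothesis Gam_int : (mu \x Q)%E.-integrable setT (fun p : TR * Om => (Gam p.1 p.2)%:E).

Let G0 r w : 0 <= G r w := G_ge0 G_ge r w.
Let mGam := measurable_carre_uv T_gt0 en_u en_v obs_uv.
Let mrate h := measurable_rate_bound T_gt0 en_u en_v obs_uv mG h.
Let rate0 h t w (h0 : 0 < h) := rate_bound_ge0 Kuv G_ge t w h0.

Let total_rate h := (\int[mu]_t \int[Q]_w rate h t w)%E.

Let total_rateE h : 0 < h -> (total_rate h =
  \int[Q]_w \int[mu]_t `|forward_average h (Gam ^~ w) t - Gam t w|%:E
  + (4 * Num.sqrt h)%:E * \int[Q]_w \int[mu]_r (G r w)%:E)%E.
Proof.
move=> h0.
have mgap : measurable_fun setT (fun p : TR * Om => `|forward_average h (Gam ^~ p.2) p.1 - Gam p.1 p.2|%:E).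
  by apply/measurable_EFinP; exact: (measurable_average_gap T_gt0 en_u en_v obs_uv).
have gap0 (p : TR * Om) : (0 <= `|forward_average h (Gam ^~ p.2) p.1 - Gam p.1 p.2|%:E)%E by rewrite lee_fin.
have mS := measurable_strip_mean Q h mG G0.
have c0 : 0 <= h^-1 * (4 * Num.sqrt h) by rewrite mulr_ge0// invr_ge0 ltW.
have mst := measurable_strip_integral (g := fun p => G p.1 p.2) h mG.
have st0 (t : TR) w : (0 <= \int[mu]_(r in `[t, (t + h)%R]) (G r w)%:E)%E.
  by apply: integral_ge0 => r _; rewrite lee_fin.
have -> : total_rate h = (\int[mu]_t ((\int[Q]_w `|forward_average h (Gam ^~ w) t - Gam t w|%:E)
   + (h^-1 * (4 * Num.sqrt h))%:E * \int[Q]_w \int[mu]_(r in `[t, (t + h)%R]) (G r w)%:E))%E.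
  apply: eq_integral => t _; rewrite /rate_bound ge0_integralD//.
  - by congr (_ + _)%E; rewrite ge0_integralZl//; exact: (measurableT_comp mst (measurable_pair1 t)).
  - exact: (measurableT_comp mgap (measurable_pair1 t)).
  - by move=> w _; rewrite mule_ge0.
  - by apply: emeasurable_funM => //; exact: (measurableT_comp mst (measurable_pair1 t)).
rewrite ge0_integralD//; last 4 first.
- by move=> t _; apply: integral_ge0.
- exact: (measurable_fun_fubini_tonelli_F (m2 := Q) _ mgap gap0).
- by move=> t _; apply: mule_ge0 => //; apply: integral_ge0.
- exact: emeasurable_funM.
congr (_ + _)%E; first exact: (fubini_tonelli (m1 := mu) (m2 := Q) _ mgap gap0).
rewrite ge0_integralZl//; last by move=> t _; apply: integral_ge0.
rewrite integral_strip_mean//; last exact: ltW.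
by rewrite muleA -EFinM -mulrA mulrC -mulrA mulfV ?mulr1// gt_eqF.
Qed.

(** The integral over t is the L1 distance of Gamma(u,v) to its moving
    average plus 4 sqrt h times the integral of G. *)
Lemma total_rate_cvg (h_ : nat -> R) : (forall n, 0 < h_ n) -> h_ n @[n --> \oo] --> 0 ->
  total_rate (h_ n) @[n --> \oo] --> 0%E.
Proof.
move=> h_gt0 h_cvg.
have G_ge0E : (0 <= \int[Q]_w \int[mu]_r (G r w)%:E)%E.
  by apply: integral_ge0 => w _; apply: integral_ge0 => r _; rewrite lee_fin.
set N := fine (\int[Q]_w \int[mu]_r (G r w)%:E)%E.
have NE : (\int[Q]_w \int[mu]_r (G r w)%:E = N%:E)%E by rewrite fineK// ge0_fin_numE.
have sqrt_cvg : 4 * Num.sqrt (h_ m) * N @[m --> \oo] --> (0 : R).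
  have -> : 0 = 4 * Num.sqrt 0 * N by rewrite sqrtr0 mulr0 mul0r.
  apply: cvgM; last exact: cvg_cst.
  apply: cvgM; first exact: cvg_cst.
  by apply: (cvg_comp _ _ h_cvg); exact: sqrt_continuous.
have gap_cvg := forward_average_process_cvg (g := fun p => Gam p.1 p.2) h_gt0 h_cvg Gam_int.
have sqrt_cvgE : (4 * Num.sqrt (h_ m) * N)%:E @[m --> \oo] --> 0%E.
  by apply/fine_cvgP; split; [exact: nearW|exact: sqrt_cvg].
have -> : (fun n => total_rate (h_ n)) = (fun n =>
    (\int[Q]_w \int[mu]_t `|forward_average (h_ n) (Gam ^~ w) t - Gam t w|%:E)
    + (4 * Num.sqrt (h_ n) * N)%:E)%E.
  by apply/funext => n; rewrite total_rateE// NE EFinM.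
have := cvgeD _ gap_cvg sqrt_cvgE; rewrite add0e; exact.
Qed.

Lemma carre_slice_integrable : {ae mu, forall t, Q.-integrable setT (fun w => (Gam t w)%:E)}.
Proof.
have := ae_integrable1 Gam_int.
by move=> H; apply: filterS H => t.
Qed.

Section forward.
Variable E : R -> R -> Om -> R.
Hypothesis E_exp : forall h, 0 < h < T ->
  measurable_process `[0, T - h] (E h) /\
  forall t, 0 <= t <= T - h -> cond_exp Q `[0, t] (incr_quotient u v h t) (E h t).
Hypothesis Gam_adapted : forall t, 0 <= t <= T -> position_measurable `[0, t] (Gam t).

Lemma forward_rate_cvg :
  (\int[Q]_w \int[mu]_(t in `[0%R, (T - h)%R]) `|E h t w - Gam t w|%:E)%E @[h --> 0^'+] --> 0%E.
Proof.
apply: (@at_right_squeeze _ _ total_rate (Num.min T 2^-1)).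
- by rewrite lt_min T_gt0/= invr_gt0.
- move=> h /andP[h0]; rewrite lt_min => /andP[hT h2].
  apply/andP; split; first by apply: integral_ge0 => w _; apply: integral_ge0 => t _; rewrite lee_fin.
  have hT' : 0 < h < T by rewrite h0.
  have [mE cE] := E_exp hT'.
  pose F (p : TR * Om) := ((fun p => `|E h p.1 p.2 - Gam p.1 p.2|%:E) \_ (`[0%R, (T - h)%R] `*` setT)) p.
  have mI : measurable (`[0, T - h] : set TR) by exact: measurable_itv.
  have mF : measurable_fun setT F.
    have mIT : measurable (`[0, T - h] `*` setT : set (TR * Om)) by exact: measurableX.
    apply/(measurable_restrict _ mIT measurableT); rewrite setTI.
    apply/measurable_EFinP; apply: measurableT_comp => //; apply: measurable_funB; first exact: mE.
    exact: measurable_funTS.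
  have F0 p : (0 <= F p)%E by rewrite /F patchE; case: ifP => // _; rewrite lee_fin.
  have FE t w : `[0, T - h]%classic t -> F (t, w) = `|E h t w - Gam t w|%:E.
    by move=> It; rewrite /F patchE mem_set.
  have -> : (\int[Q]_w \int[mu]_(t in `[0%R, (T - h)%R]) `|E h t w - Gam t w|%:E =
     \int[mu]_(t in `[0%R, (T - h)%R]) \int[Q]_w F (t, w))%E.
    rewrite -(tonelli_on mu Q mI measurableT mF F0).
    by apply: eq_integral => w _; apply: eq_integral => t /set_mem It; rewrite FE.
  have mFI := measurable_fun_fubini_tonelli_F (m2 := Q) _ mF F0.
  have rate0' (p : TR * Om) : (0 <= rate h p.1 p.2)%E by exact: rate0.
  have mrI := measurable_fun_fubini_tonelli_F (m2 := Q) _ (mrate h) rate0'.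
  apply: (@le_trans _ _ (\int[mu]_(t in `[0%R, (T - h)%R]) \int[Q]_w rate h t w)%E); last first.
    by apply: ge0_subset_integral => // t _; apply: integral_ge0 => w _; exact: rate0.
  apply: ae_ge0_le_integral => //.
  - by move=> t _; exact: integral_ge0.
  - exact: measurable_funTS.
  - by move=> t _; apply: integral_ge0 => w _; exact: rate0.
  - exact: measurable_funTS.
  move: carre_slice_integrable; apply: filterS; first exact: (ae_filter_ringOfSetsType mu).
  move=> t iG It; have /andP[t0 tTh] : 0 <= t <= T - h by move: It; rewrite /= in_itv.
  have thT : t + h <= T by rewrite -lerBrDr.
  have tT : 0 <= t <= T by rewrite t0 (le_trans tTh)// gerBl ltW.
  have cG : cond_exp Q `[0, t] (Gam t) (Gam t).
    split; first exact: Gam_adapted.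
    move=> B FB QB; have mB : measurable B by apply: position_gen_le_measurable FB; case/andP: tT.
    by split=> //; apply: integrableS iG.
  apply: le_trans (cond_exp_rate_le T_gt0 en_u en_v obs_uv gen_uv mG G_ge condQ h0 (ltW h2) t0 thT _ _ (cE t _) cG); last 3 first.
  - by rewrite /= in_itv/= t0 lexx.
  - by [].
  - by rewrite t0.
  by rewrite le_eqVlt; apply/orP; left; apply/eqP; apply: eq_integral => w _; rewrite FE.
- exact: total_rate_cvg.
Qed.

End forward.

Section backward.
Variable gamma : R -> X -> R.
Hypothesis gamma_cont : {within `[0, T] `*` [set: X], continuous (fun p : R * X => gamma p.1 p.2)}.
Hypothesis gamma_at : {ae mu, forall t, 0 <= t <= T ->
  cond_exp Q [set t] (Gam t) (fun w => gamma t (position t w))}.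

Local Notation along := (@along_path R T X gamma).
Local Notation live := (@live_path R T X gamma).

Let mlive := measurable_live_path T_gt0 gamma_cont.
Let malong := measurable_along_path T_gt0 gamma_cont.

Let alongE t w : 0 <= t <= T -> along t w = gamma t (position t w).
Proof.
move=> /andP[t0 tT]; rewrite /along_path (_ : @clamp R T t = t)//.
by rewrite /clamp min_l// max_r.
Qed.

Let liveE t w : 0 <= t < T -> live t w = gamma t (position t w).
Proof. by move=> tT; rewrite /live_path tT alongE//; case/andP: tT => -> /ltW. Qed.

(** For almost every t, E |gamma_t(X_t)| is at most E |Gamma_t(u,v)|, by
    [integral_norm_le_test]. *)
Lemma live_path_integrable : (mu \x Q)%E.-integrable setT (fun p : TR * Om => (live p.1 p.2)%:E).
Proof.
apply/integrable12ltyP; first exact/measurable_EFinP.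
have mEGam : measurable_fun setT (fun p : TR * Om => (Gam p.1 p.2)%:E) by exact/measurable_EFinP.
move/(integrable12ltyP mu Q mEGam): Gam_int; apply: le_lt_trans.
have mabs (f : TR -> Om -> R) : measurable_fun setT (fun p : TR * Om => f p.1 p.2) ->
    measurable_fun setT (fun t : TR => \int[Q]_w `|(f t w)%:E|)%E.
  move=> mf; have mE : measurable_fun setT (fun p : TR * Om => `|(f p.1 p.2)%:E|%E).
    by apply: measurableT_comp => //; exact/measurable_EFinP.
  exact: (measurable_fun_fubini_tonelli_F (m2 := Q) _ mE (fun=> abse_ge0 _)).
apply: ae_ge0_le_integral => //.
- by move=> t _; apply: integral_ge0.
- exact: mabs.
- by move=> t _; apply: integral_ge0.
- exact: (mabs Gam).
move: gamma_at; apply: filterS; first exact: (ae_filter_ringOfSetsType mu).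
move=> t /= gt _; have [t0T|tN] := boolP (0 <= t < T); last first.
  rewrite integral0_eq; first by apply: integral_ge0.
  move=> w _; by rewrite /live_path (negbTE tN) normr0.
have tT : 0 <= t <= T by case/andP: t0T => -> /ltW.
have [mg g_exp] := gt tT.
have [A [A_F A_fin A_mono A_cover]] := conditionable_exhaustion condQ tT.
have sub : [set t] `<=` `[0, T] by move=> r ->; rewrite /= in_itv.
have -> : (\int[Q]_w `|(live t w)%:E| = \int[Q]_w `|gamma t (position t w)|%:E)%E.
  by apply: eq_integral => w _; rewrite liveE.
apply: (@integral_norm_le_test _ _ _ Q <<s @position_gen R T X [set t] >> A) => //.
- by move=> B; exact: position_gen_measurable.
- by move=> B B'; exact: position_genI.
- have -> : [set w : Om | 0 <= gamma t (position t w)] =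
      setT `&` (fun w => gamma t (position t w)) @^-1` `[0, +oo[.
    by rewrite setTI; apply/seteqP; split=> w /=; rewrite in_itv/= andbT.
  by apply: mg => //; exact: measurable_itv.
- have -> : [set w : Om | gamma t (position t w) < 0] =
      setT `&` (fun w => gamma t (position t w)) @^-1` `]-oo, 0[.
    by rewrite setTI; apply/seteqP; split=> w /=; rewrite in_itv/=.
  by apply: mg => //; exact: measurable_itv.
- apply/measurable_EFinP; apply: measurableT_comp => //.
  exact: (measurableT_comp mGam (measurable_pair1 (t : TR))).
move=> B FB QB; have [iG ig gE] := g_exp B FB QB.
have mB : measurable B by apply: position_gen_measurable FB.
split=> //; rewrite gE; exact: (le_abse_integral _ mB (measurable_int _ iG)).
Qed.

Variable E : R -> R -> Om -> R.
Hypothesis E_exp : forall h, 0 < h < T ->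
  measurable_process `[h, T] (E h) /\
  forall t, h <= t <= T -> cond_exp Q [set t - h] (incr_quotient u v h (t - h)) (E h t).

Let drift h := (\int[mu]_t \int[Q]_w `|live (t + h)%R w - live t w|%:E)%E.

Let mlive_gap h : measurable_fun setT (fun p : TR * Om => `|live (p.1 + h) p.2 - live p.1 p.2|%:E).
Proof.
have mp : measurable_fun setT (fun p : TR * Om => (p.1 + h : TR, p.2)).
  by apply/measurable_fun_pair => //; exact: measurable_funD.
apply/measurable_EFinP; apply: measurableT_comp => //; apply: measurable_funB => //.
exact: (measurableT_comp mlive mp).
Qed.

(** Translate time by h, then pass through gamma_t(X_t). The time t = T - h is
    excluded since live_path vanishes at T. *)
Lemma backward_rate_le h : 0 < h -> h < T -> h <= 2^-1 ->
  (\int[Q]_w \int[mu]_(t in `[h, T]) `|E h t w - gamma t (position t w)|%:E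
   <= total_rate h + drift h)%E.
Proof.
move=> h0 hT h2; have hT' : 0 < h < T by rewrite h0.
have [mE cE] := E_exp hT'.
pose F (p : TR * Om) := ((fun p => `|E h p.1 p.2 - along p.1 p.2|%:E) \_ (`[h, T] `*` setT)) p.
have mI : measurable (`[h, T] : set TR) by exact: measurable_itv.
have mF : measurable_fun setT F.
  have mIT : measurable (`[h, T] `*` setT : set (TR * Om)) by exact: measurableX.
  apply/(measurable_restrict _ mIT measurableT); rewrite setTI.
  apply/measurable_EFinP; apply: measurableT_comp => //; apply: measurable_funB; first exact: mE.
  exact: measurable_funTS.
have F0 p : (0 <= F p)%E by rewrite /F patchE; case: ifP => // _; rewrite lee_fin.
have FE t w : h <= t <= T -> F (t, w) = `|E h t w - gamma t (position t w)|%:E.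
  move=> It; rewrite /F patchE mem_set/=; last by split => //=; rewrite in_itv.
  by rewrite alongE//; case/andP: It => ht ->; rewrite (le_trans (ltW h0)).
have F_out t w : ~~ (h <= t <= T) -> F (t, w) = 0%E.
  by move=> tN; rewrite /F patchE memNset// => -[/=]; rewrite in_itv/= (negbTE tN).
have -> : (\int[Q]_w \int[mu]_(t in `[h, T]) `|E h t w - gamma t (position t w)|%:E =
   \int[mu]_t \int[Q]_w F (t, w))%E.
  rewrite (fubini_tonelli (m1 := mu) (m2 := Q) _ mF F0)/=.
  apply: eq_integral => w _; rewrite integral_mkcond; apply: eq_integral => t _.
  rewrite patchE mem_setE in_itv/=; case: ifP => [It|/negbT tN]; first by rewrite FE.
  by rewrite F_out.
have mFI := measurable_fun_fubini_tonelli_F (m2 := Q) _ mF F0.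
have mslice t : measurable_fun setT (fun w => F (t, w)) by exact: (measurableT_comp mF (measurable_pair1 t)).
have FI0 (t : TR) : (0 <= \int[Q]_w F (t, w))%E by exact: integral_ge0.
rewrite -(ge0_integral_shift h mFI FI0).
have mrI := measurable_fun_fubini_tonelli_F (m2 := Q) _ (mrate h) (fun p => rate0 p.1 p.2 h0).
have gap0 (p : TR * Om) : (0 <= `|live (p.1 + h)%R p.2 - live p.1 p.2|%:E)%E by rewrite lee_fin.
have mdI := measurable_fun_fubini_tonelli_F (m2 := Q) _ (mlive_gap h) gap0.
have rI0 t : (0 <= \int[Q]_w rate h t w)%E by apply: integral_ge0 => w _; exact: rate0.
have dI0 t : (0 <= \int[Q]_w `|live (t + h)%R w - live t w|%:E)%E.
  by apply: integral_ge0 => w _; rewrite lee_fin.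
rewrite /total_rate /drift -ge0_integralD//.
(* At t = T - h the shifted time is T, where live_path is 0. *)
have not_end : {ae mu, forall t, t != T - h}.
  exists [set T - h]; split => //; first exact: lebesgue_measure_set1.
  by move=> t /=; case: eqP => // ->.
apply: ae_ge0_le_integral => //.
- by move=> t _; exact: FI0.
- by apply: (measurableT_comp mFI); exact: measurable_shift.
- by move=> t _; rewrite adde_ge0.
- exact: emeasurable_funD.
move: gamma_at not_end; apply: filterS2; first exact: (ae_filter_ringOfSetsType mu).
move=> t gt tNend _; rewrite /fubini_F.
have [tI|tN] := boolP (0 <= t <= T - h); last first.
  rewrite [leLHS]integral0_eq; first by rewrite adde_ge0.
  move=> w _; apply: F_out; apply: contra tN => /andP[t1 t2].
  by rewrite lerBrDr t2 andbT; move: t1; rewrite lerDr.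
have /andP[t0 tTh] := tI; have thT : t + h <= T by rewrite -lerBrDr.
have th_lt : t + h < T by rewrite -ltrBrDr lt_neqAle tNend.
have tT : t < T by apply: le_lt_trans th_lt; rewrite lerDl ltW.
have t0T : 0 <= t <= T by rewrite t0 ltW.
have htT : h <= t + h <= T by rewrite thT lerDr t0.
have cE' := cE _ htT; rewrite addrK in cE'.
have rate_le := cond_exp_rate_le T_gt0 en_u en_v obs_uv gen_uv mG G_ge condQ h0 h2 t0 thT
  (erefl t : [set t] t) (ltac:(by move=> r ->; rewrite /= in_itv/= t0 lexx) : [set t] `<=` `[0, t])
  cE' (gt t0T).
have mEt : measurable_fun setT (E h (t + h)).
  case: cE' => + _; apply: position_measurable_measurable.
  by move=> r ->; rewrite /= in_itv.
have mlt s : measurable_fun setT (live s) by exact: (measurableT_comp mlive (measurable_pair1 (s : TR))).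
apply: (@le_trans _ _ (\int[Q]_w (`|E h (t + h)%R w - live t w|%:E + `|live (t + h)%R w - live t w|%:E))%E).
  apply: ge0_le_integral => //.
  - apply: emeasurable_funD; apply/measurable_EFinP; apply: measurableT_comp => //;
      exact: measurable_funB.
  - move=> w _; rewrite FE// -EFinD lee_fin -liveE; last by rewrite th_lt addr_ge0// ltW.
    by have := ler_distD (live t w) (E h (t + h) w) (live (t + h) w); rewrite (distrC (live t w)).
rewrite ge0_integralD//; last 2 first.
- by apply/measurable_EFinP; apply: measurableT_comp => //; exact: measurable_funB.
- by apply/measurable_EFinP; apply: measurableT_comp => //; exact: measurable_funB.
apply: leeD => //; apply: le_trans rate_le.
rewrite le_eqVlt; apply/orP; left; apply/eqP; apply: eq_integral => w _.
by rewrite liveE// t0.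
Qed.

Lemma backward_rate_cvg :
  (\int[Q]_w \int[mu]_(t in `[h, T]) `|E h t w - gamma t (position t w)|%:E)%E @[h --> 0^'+] --> 0%E.
Proof.
apply: (@at_right_squeeze _ _ (fun h => total_rate h + drift h)%E (Num.min T 2^-1)).
- by rewrite lt_min T_gt0/= invr_gt0.
- move=> h /andP[h0]; rewrite lt_min => /andP[hT /ltW h2].
  apply/andP; split; last exact: backward_rate_le.
  by apply: integral_ge0 => w _; apply: integral_ge0 => t _; rewrite lee_fin.
move=> h_ h_gt0 h_cvg.
have c1 := total_rate_cvg h_gt0 h_cvg.
have c2 := live_path_drift_cvg T_gt0 gamma_cont live_path_integrable h_gt0 h_cvg.
by have := cvgeD _ c1 c2; rewrite add0e; exact.
Qed.

End backward.

End limits.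

(** * Generators of the functions of the class *)

Section versions.
Context {R : realType} {T : R} {X : ptopologicalType}.
Hypothesis T_gt0 : 0 < T.
Local Notation Om := (cadlag_path T X).
Local Notation TR := (measurableTypeR R).
Local Notation mu := (@lebesgue_measure R).
Variable Q : {sigma_finite_measure set Om -> \bar R}.

Lemma observable_cut (f : X -> R) (K : R -> Om -> R) (C : R) :
  measurable_fun setT (f : borel X -> R) -> continuous f -> (forall x, `|f x| <= C) ->
  generator_version Q f K -> observable_of Q C f (time_cut K).
Proof.
move=> mf cf bf [adK fK _]; split => //; first exact: measurable_time_cut adK.1.
have mI : measurable (`[0, T] : set TR) by exact: measurable_itv.
apply: filterS fK => w Kw; apply/integrableP; split.
  exact: measurable_inner (measurable_time_cut adK.1).
apply: le_lt_trans Kw; rewrite le_eqVlt; apply/orP; left; apply/eqP.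
by apply: eq_integral => t; rewrite inE/= in_itv/= => t0T; rewrite time_cutE.
Qed.

Lemma integrable_process_cut (K : R -> Om -> R) : integrable_process Q K ->
  (mu \x Q)%E.-integrable setT (fun p : TR * Om => (time_cut K p.1 p.2)%:E).
Proof.
have mIT : measurable (`[0, T] `*` setT : set (TR * Om)).
  by apply: measurableX => //; exact: measurable_itv.
move/(integrable_mkcond _ mIT); apply: eq_integrable => // p _.
rewrite patchE /time_cut; case: ifP => [/set_mem[/=]|/negP pN]; first by rewrite in_itv/= => ->.
by case: ifP => // p0T; case: pN; apply/mem_set; split; rewrite //= in_itv.
Qed.

Lemma double_integral_norm_lty (f : R -> Om -> R) :
  (mu \x Q)%E.-integrable setT (fun p : TR * Om => (f p.1 p.2)%:E) ->
  (double_integral Q setT 0 T (fun r w => `|f r w|)%R < +oo)%E.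
Proof.
move=> fi; have mEf := measurable_int _ fi.
have mf : measurable_fun setT (fun p : TR * Om => f p.1 p.2) by exact/measurable_EFinP.
move/(integrable21ltyP mu Q mEf): fi; apply: le_lt_trans; apply: ge0_le_integral => //.
- by move=> w _; apply: integral_ge0 => r _; rewrite lee_fin.
- by apply: (@measurable_inner_integral _ _ _ (fun r w => `|f r w|)) => //; exact: measurableT_comp.
- have mE : measurable_fun setT (fun p : TR * Om => `|(f p.1 p.2)%:E|%E).
    by apply/measurable_EFinP; apply: measurableT_comp.
  have E0 (p : TR * Om) : (0 <= `|(f p.1 p.2)%:E|)%E by exact: abse_ge0.
  exact: (measurable_fun_fubini_tonelli_G (m1 := mu) _ mE E0).
- move=> w _; apply: ge0_subset_integral => //.
  apply/measurable_EFinP; apply: measurableT_comp => //.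
  exact: (measurableT_comp mf (measurable_pair2 w)).
Qed.

Lemma integrable_of_double_integral (f : R -> Om -> R) :
  measurable_fun setT (fun p : TR * Om => f p.1 p.2) ->
  (forall r w, ~~ (0 <= r <= T) -> f r w = 0) ->
  (double_integral Q setT 0 T (fun r w => `|f r w|)%R < +oo)%E ->
  (mu \x Q)%E.-integrable setT (fun p : TR * Om => (f p.1 p.2)%:E).
Proof.
move=> mf f_out fin; apply/integrable21ltyP; first exact/measurable_EFinP.
apply: le_lt_trans fin; rewrite le_eqVlt; apply/orP; left; apply/eqP.
apply: eq_integral => w _; rewrite [RHS]integral_mkcond; apply: eq_integral => r _.
rewrite patchE mem_setE in_itv/=; case: ifP => // /negbT rN.
by rewrite f_out// normr0.
Qed.

(** A constant is integrable over B x [0,T] when B has finite measure, so that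
    K need only be bounded by c + H with H integrable. *)
Lemma stopped_generator_dominated (f : X -> R) (K H : R -> Om -> R) (C c : R) :
  measurable_fun setT (f : borel X -> R) -> continuous f -> (forall x, `|f x| <= C) ->
  generator_version Q f K -> 0 <= c ->
  measurable_fun setT (fun p : TR * Om => H p.1 p.2) -> (forall r w, 0 <= H r w) ->
  (double_integral Q setT 0 T H < +oo)%E ->
  (forall r w, `|time_cut K r w| <= c + H r w) ->
  stopped_generator Q (cst T) f (time_cut K).
Proof.
move=> mf cf bf genK c0 mH H0 Hfin KH.
have [[mproc _] _ _] := genK; have mK := measurable_time_cut mproc.
apply: stopped_generator_cut; apply: (stopped_generator_full T_gt0 mf cf bf genK) => B mB QB.
apply: (@le_lt_trans _ _ (double_integral Q B 0 T (fun r w => c + H r w)%R)).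
  apply: (@le_trans _ _ (double_integral Q B 0 T (fun r w => `|time_cut K r w|)%R)).
    rewrite le_eqVlt; apply/orP; left; apply/eqP; apply: eq_integral => w _.
    by apply: eq_integral => r; rewrite inE/= in_itv/= => r0T; rewrite time_cutE.
  apply: le_double_integral => //; first exact: measurableT_comp.
  exact: measurable_funD.
rewrite (@double_integralD _ _ _ Q B 0 T (fun=> fun=> c) H)//; apply: lte_add_pinfty.
  have mI : measurable (`[0, T] : set TR) by exact: measurable_itv.
  have cT : (\int[mu]_(r in `[0%R, T]) c%:E = (c * T)%:E)%E.
    by rewrite integral_cst//= lebesgue_measure_itv/= lte_fin T_gt0 -EFinD -EFinM subr0.
  have -> : double_integral Q B 0 T (fun=> fun=> c) = (\int[Q]_(w in B) (c * T)%:E)%E.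
    by apply: eq_integral => w _; rewrite cT.
  by rewrite integral_cst// lte_mul_pinfty// lee_fin mulr_ge0// ltW.
by apply: le_lt_trans Hfin; apply: subset_double_integral.
Qed.

End versions.

Section classes.
Context {R : realType} {T : R} {X : ptopologicalType}.
Hypothesis T_gt0 : 0 < T.
Local Notation Om := (cadlag_path T X).
Local Notation TR := (measurableTypeR R).
Local Notation mu := (@lebesgue_measure R).
Local Notation Ft t := (<<s @position_gen R T X `[0, t] >>).
Variable Q : {sigma_finite_measure set Om -> \bar R}.
Hypothesis condQ : conditionable Q.
Variables (L : (X -> R) -> R -> Om -> R) (U : set (X -> R)).
Hypothesis genL : extended_generator Q L.
Hypothesis admU : admissible_class Q U.

Local Notation K f := (@time_cut R T X (L f)).

Let U_version f : U f -> generator_version Q f (L f).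
Proof. by move=> Uf; apply: genL; have [Udom _ _] := admU; exact: Udom. Qed.

Let U_measurable f : U f -> measurable_fun setT (f : borel X -> R).
Proof. by move=> Uf; have [Udom _ _] := admU; have [] := Udom f Uf. Qed.

Let U_continuous f : U f -> continuous f.
Proof. by move=> Uf; have [_ Ubc _] := admU; have [] := Ubc f Uf. Qed.

Let U_mul f g : U f -> U g -> U (f \* g).
Proof. by have [_ _ Um] := admU; exact: Um. Qed.

Let bound_mul (f g : X -> R) C : (forall x, `|f x| <= C) -> (forall x, `|g x| <= C) ->
  forall x, `|(f \* g) x| <= C * C.
Proof. by move=> bf bg x; rewrite normrM ler_pM. Qed.

Let observable_U f C : U f -> (forall x, `|f x| <= C) -> observable_of Q C f (K f).
Proof.
move=> Uf bf; apply: observable_cut => //; first exact: U_measurable.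
  exact: U_continuous.
exact: U_version.
Qed.

(** Cutting L(fg), Lf and Lg separately amounts to cutting the carre du champ. *)
Lemma carre_cut f g r w :
  carre f g (K (f \* g)) (K f) (K g) r w = time_cut (carre_du_champ L f g) r w.
Proof.
rewrite /carre /time_cut /carre_du_champ; case: ifP => // _.
by rewrite !mulr0 !subr0.
Qed.

Let sq_le1 (x : R) : `|x| <= 1 + x ^+ 2.
Proof.
have := sqr_ge0 (`|x| - 2^-1); rewrite sqrrB real_normK ?num_real// => h.
have : 0 <= x ^+ 2 by exact: sqr_ge0.
by lra.
Qed.

Lemma class2_square_integrable f : class2 Q L U f ->
  (mu \x Q)%E.-integrable setT (fun p : TR * Om => (K f p.1 p.2 ^+ 2)%:E).
Proof.
move=> [_ /integrable_process_cut H _]; apply: eq_integrable H => // p _.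
by rewrite /time_cut; case: ifP => // _; rewrite expr0n.
Qed.

Lemma class2_carre_integrable f : class2 Q L U f ->
  (mu \x Q)%E.-integrable setT
    (fun p : TR * Om => (carre f f (K (f \* f)) (K f) (K f) p.1 p.2)%:E).
Proof.
move=> [_ _ /integrable_process_cut H]; apply: eq_integrable H => // p _.
by rewrite carre_cut.
Qed.

(** |Lf| is at most 1 + (Lf)^2, and |L(ff)| at most |Gamma(f,f)| + 2C |Lf|. *)
Lemma class2_energetic f C : class2 Q L U f -> (forall x, `|f x| <= C) ->
  energetic Q C f (K f) (K (f \* f)).
Proof.
move=> f2 bf; have [Uf _ _] := f2; have Uff := U_mul Uf Uf; have bff := bound_mul bf bf.
have C0 : 0 <= C := le_trans (normr_ge0 _) (bf point).
have i1 := class2_square_integrable f2; have i2 := class2_carre_integrable f2.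
have m1 : measurable_fun setT (fun p : TR * Om => K f p.1 p.2 ^+ 2).
  by apply/measurable_EFinP; exact: measurable_int i1.
have m2 : measurable_fun setT (fun p : TR * Om => carre f f (K (f \* f)) (K f) (K f) p.1 p.2).
  by apply/measurable_EFinP; exact: measurable_int i2.
have sqE : (fun r w => `|K f r w ^+ 2|) = (fun r w => K f r w ^+ 2).
  by apply/funext => r; apply/funext => w; rewrite ger0_norm// sqr_ge0.
have fin1 := double_integral_norm_lty (f := fun r w => K f r w ^+ 2) i1; rewrite sqE in fin1.
have fin2 := double_integral_norm_lty (f := fun r w => carre f f (K (f \* f)) (K f) (K f) r w) i2.
split; [exact: observable_U|exact: observable_U| |].
  exact: (@stopped_generator_dominated _ _ _ T_gt0 Q f _ (fun r w => K f r w ^+ 2) C 1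
    (U_measurable Uf) (U_continuous Uf) bf (U_version Uf) ler01 m1 (fun r w => sqr_ge0 _) fin1
    (fun r w => sq_le1 _)).
have m2C : measurable_fun setT (fun p : TR * Om => (2 * C) * K f p.1 p.2 ^+ 2).
  exact: measurable_funM.
have m2n : measurable_fun setT (fun p : TR * Om => `|carre f f (K (f \* f)) (K f) (K f) p.1 p.2|).
  exact: measurableT_comp.
have C20 : 0 <= 2 * C by rewrite mulr_ge0.
have sq0 r w : 0 <= K f r w ^+ 2 by exact: sqr_ge0.
have sqC0 r w : 0 <= (2 * C) * K f r w ^+ 2 by rewrite mulr_ge0.
have mD := measurable_funD m2n m2C.
have sum_fin : (double_integral Q setT 0 T
    (fun r w => `|carre f f (K (f \* f)) (K f) (K f) r w| + (2 * C) * K f r w ^+ 2)%R < +oo)%E.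
  have eD := @double_integralD _ _ _ Q setT 0 T (fun r w => `|carre f f (K (f \* f)) (K f) (K f) r w|)
    (fun r w => (2 * C) * K f r w ^+ 2) measurableT m2n m2C (fun r w => normr_ge0 _) sqC0.
  have eZ := @double_integralZ _ _ _ Q setT 0 T (2 * C) (fun r w => K f r w ^+ 2) measurableT m1 sq0 C20.
  rewrite eD eZ; apply: lte_add_pinfty; first exact: fin2.
  by apply: lte_mul_pinfty; [rewrite lee_fin|rewrite fin_numE|exact: fin1].
apply: (@stopped_generator_dominated _ _ _ T_gt0 Q (f \* f) _
  (fun r w => `|carre f f (K (f \* f)) (K f) (K f) r w| + (2 * C) * K f r w ^+ 2) (C * C) (2 * C)
  (U_measurable Uff) (U_continuous Uff) bff (U_version Uff) C20 mD
  (fun r w => addr_ge0 (normr_ge0 _) (sqC0 r w)) sum_fin).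
move=> r w; set a := carre _ _ _ _ _ r w.
have -> : K (f \* f) r w = a + f (position r w) * K f r w + f (position r w) * K f r w.
  by rewrite /a /carre; ring.
have b1 : `|f (position r w) * K f r w| <= C * (1 + K f r w ^+ 2).
  by rewrite normrM ler_pM.
have := ler_normD (a + f (position r w) * K f r w) (f (position r w) * K f r w).
have := ler_normD a (f (position r w) * K f r w).
by lra.
Qed.

Variables (u v : X -> R).
Hypothesis u2 : class2 Q L U u.
Hypothesis v2 : class2 Q L U v.

Let G r w := 2 * (energy_density u (K u) (K (u \* u)) r w + energy_density v (K v) (K (v \* v)) r w).

Local Notation Gam := (carre u v (K (u \* v)) (K u) (K v)).

Let Uu : U u. Proof. by case: u2. Qed.
Let Uv : U v. Proof. by case: v2. Qed.
Let Uuv : U (u \* v) := U_mul Uu Uv.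

Lemma density_integrable : (mu \x Q)%E.-integrable setT (fun p : TR * Om => (G p.1 p.2)%:E).
Proof.
have ed f : class2 Q L U f ->
    (mu \x Q)%E.-integrable setT (EFin \o (fun p : TR * Om => energy_density f (K f) (K (f \* f)) p.1 p.2)).
  move=> f2; have i1 := class2_square_integrable f2; have i2 := class2_carre_integrable f2.
  exact: (integrableD measurableT (integrable_norm i2) i1).
exact: (integrableZl measurableT 2 (integrableD measurableT (ed _ u2) (ed _ v2))).
Qed.

Let common_bound : exists C, (forall x, `|u x| <= C) /\ (forall x, `|v x| <= C).
Proof.
have [_ Ubc _] := admU; have [_ [Cu bu]] := Ubc u Uu; have [_ [Cv bv]] := Ubc v Uv.
by exists (Num.max Cu Cv); split => x; rewrite le_max ?bu// bv orbT.
Qed.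

Let G_fin : (double_integral Q setT 0 T G < +oo)%E.
Proof.
have := double_integral_norm_lty (f := G) density_integrable.
rewrite (_ : (fun r w => `|G r w|) = G)//; apply/funext => r; apply/funext => w.
by rewrite ger0_norm// mulr_ge0// addr_ge0// energy_density_ge0.
Qed.

Let G_total : (\int[Q]_w \int[mu]_r (G r w)%:E < +oo)%E.
Proof.
have mG := measurable_int _ density_integrable.
have := (integrable21ltyP mu Q mG).1 density_integrable.
have GE r w : `|(G r w)%:E|%E = (G r w)%:E.
  by rewrite gee0_abs// lee_fin mulr_ge0// addr_ge0// energy_density_ge0.
by under eq_integral do under eq_integral do rewrite GE.
Qed.

Lemma carre_adapted t : 0 <= t <= T -> position_measurable `[0, t] (Gam t).
Proof.
move=> t0T.
have mK f : U f -> position_measurable `[0, t] (K f t).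
  move=> Uf; have [[_ aK] _ _] := U_version Uf.
  rewrite (_ : K f t = L f t); first exact: aK.
  by apply/funext => w; rewrite time_cutE.
have mp f : U f -> position_measurable `[0, t] (fun w : Om => f (position t w)).
  move=> Uf; apply: position_measurable_comp; last exact: U_measurable.
  by rewrite /= in_itv/= lexx; case/andP: t0T => ->.
apply: measurable_funB; [apply: measurable_funB; first exact: mK|];
  by apply: measurable_funM; [exact: mp|exact: mK].
Qed.

(** The clock has to dominate the five generators at once, so that all energy
    identities can be stopped at the same times. *)
Let kappa (r : R) (w : Om) : R := `|L u r w| + `|L v r w| + `|L (u \* u) r w|
  + `|L (v \* v) r w| + `|L (u \* v) r w|.

Let good_clock (k : R -> Om -> R) := [/\ forall r w, 0 <= k r w, adapted_process k &
  {ae Q, forall w, (clock k T w < +oo)%E}].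

Let good_clockD k1 k2 : good_clock k1 -> good_clock k2 -> good_clock (fun r w => k1 r w + k2 r w).
Proof.
move=> [p1 [m1 a1] f1] [p2 [m2 a2] f2]; split.
- by move=> r w; rewrite addr_ge0.
- split; first exact: measurable_funD.
  by move=> t t0T; apply: measurable_funD; [exact: a1|exact: a2].
apply: filterS2 f1 f2 => w f1 f2; rewrite /clock.
under eq_integral do rewrite EFinD.
rewrite ge0_integralD//; first exact: lte_add_pinfty.
- by move=> r _; rewrite lee_fin.
- by apply/measurable_EFinP; exact: (measurable_process_section w m1).
- by move=> r _; rewrite lee_fin.
- by apply/measurable_EFinP; exact: (measurable_process_section w m2).
Qed.

Let good_clock_norm f : U f -> good_clock (fun r w => `|L f r w|).
Proof. by move=> /U_version[adf ff _]; split => //; exact: adapted_norm. Qed.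

Let kappa_good : good_clock kappa.
Proof.
by do 4 (apply: good_clockD; last by apply: good_clock_norm => //; exact: U_mul); exact: good_clock_norm.
Qed.

Let kappa_ge0 := let: And3 p _ _ := kappa_good in p.
Let kappa_adapted := let: And3 _ a _ := kappa_good in a.
Let kappa_fin := let: And3 _ _ f := kappa_good in f.

Let sg n w := exit_time kappa n w.

Let sg_itv n w : 0 <= sg n w <= T := exit_time_itv T_gt0 kappa n w.

Let sg_T n w : sg n w <= T.
Proof. by case/andP: (sg_itv n w). Qed.

Let kappa_le f r w : f \in [:: u; v; u \* u; v \* v; u \* v] -> `|L f r w| <= kappa r w.
Proof.
have := normr_ge0 (L u r w); have := normr_ge0 (L v r w); have := normr_ge0 (L (u \* u) r w).
have := normr_ge0 (L (v \* v) r w); have := normr_ge0 (L (u \* v) r w).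
by rewrite /kappa !inE => ? ? ? ? ? /or4P[/eqP->|/eqP->|/eqP->|/orP[]/eqP->]; lra.
Qed.

Let gen_sg n f C : U f -> (forall x, `|f x| <= C) -> (forall r w, `|L f r w| <= kappa r w) ->
  stopped_generator Q (sg n) f (K f).
Proof.
move=> Uf bf fk; apply: stopped_generator_cut => s t B s0 st tT FB QB Bs.
have clock_le : {ae Q, forall w, (clock kappa (sg n w) w <= (n.+1%:R)%:E)%E}.
  by apply: filterS kappa_fin => w; exact: clock_exit_le.
apply: (generator_stop T_gt0 kappa_ge0 kappa_adapted (U_measurable Uf) (U_continuous Uf) bf
  (U_version Uf) (fun r w _ => fk r w) (measurable_exit_time T_gt0 kappa_ge0 kappa_adapted n)
  (sg_T n) _ kappa_fin clock_le s0 st tT FB QB Bs).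
by move=> r r0T; exact: exit_time_optional.
Qed.

Lemma class2_mixed_carre_fin : (double_integral Q setT 0 T (fun r w => `|Gam r w|)%R < +oo)%E.
Proof.
have [C [bu bv]] := common_bound.
have [A [A_F A_fin A_mono A_cover]] := conditionable_exhaustion condQ
  (ltac:(by rewrite lexx ltW) : 0 <= 0 <= T).
have F0A n : Ft 0 (A n) by apply: position_gen_sub (A_F n) => r ->; rewrite /= in_itv/= lexx.
have mG : measurable_fun setT (fun p : TR * Om => G p.1 p.2).
  by apply/measurable_EFinP; exact: measurable_int density_integrable.
apply: (@carre_integrable _ _ _ T_gt0 Q C u v (K u) (K (u \* u)) (K v) (K (v \* v)) (K (u \* v)) G
  (class2_energetic u2 bu) (class2_energetic v2 bv) (observable_U Uuv (bound_mul bu bv)) mG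
  (fun r w => lexx _) G_fin carre_adapted sg (fun n => n.+1%:R) A) => //.
- exact: measurable_exit_time.
- move=> n s s0T; rewrite (_ : [set w | _] = ~` [set w | sg n w < s]).
    by apply: position_genC; exact: exit_time_optional.
  by apply/seteqP; split=> w /=; rewrite leNgt => /negP.
- move=> n; apply: filterS kappa_fin => w cT.
  apply: le_trans (clock_exit_le T_gt0 kappa_ge0 kappa_adapted n cT).
  have mks f : U f -> measurable_fun `[0, sg n w] (fun r : TR => K f r w).
    move=> Uf; apply/measurable_EFinP; apply: measurable_inner.
    by apply: measurable_time_cut; have [[]] := U_version Uf.
  have msum : measurable_fun `[0, sg n w] (fun r : TR =>
      `|K (u \* v) r w| + `|K u r w| + `|K v r w|).
    by apply: measurable_funD; [apply: measurable_funD|];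
      apply: measurableT_comp => //; exact: mks.
  apply: ge0_le_integral => //.
  + exact/measurable_EFinP.
  + apply/measurable_EFinP; apply: measurable_funS (measurable_process_section w kappa_adapted.1).
      exact: measurable_itv.
    by apply: subset_itvl; rewrite bnd_simp.
  + move=> r; rewrite /= in_itv/= => /andP[r0 rs]; rewrite lee_fin.
    rewrite !time_cutE ?r0 ?(le_trans rs)//.
    have := normr_ge0 (L (u \* u) r w); have := normr_ge0 (L (v \* v) r w); rewrite /kappa; lra.
- exact: exit_time_ae_T.
- by move=> n n' w; exact: le_exit_time.
- by move=> n; apply: (@gen_sg n _ _ Uu bu) => r w; apply: kappa_le; rewrite !inE eqxx ?orbT.
- by move=> n; apply: (@gen_sg n _ _ Uv bv) => r w; apply: kappa_le; rewrite !inE eqxx ?orbT.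
- by move=> n; apply: (@gen_sg n _ _ (U_mul Uu Uu) (bound_mul bu bu)) => r w; apply: kappa_le; rewrite !inE eqxx ?orbT.
- by move=> n; apply: (@gen_sg n _ _ (U_mul Uv Uv) (bound_mul bv bv)) => r w; apply: kappa_le; rewrite !inE eqxx ?orbT.
- by move=> n; apply: (@gen_sg n _ _ Uuv (bound_mul bu bv)) => r w; apply: kappa_le; rewrite !inE eqxx ?orbT.
- by move=> n n' nn'; apply/subsetPset; exact: A_mono.
Qed.

Lemma class2_mixed_carre_integrable :
  (mu \x Q)%E.-integrable setT (fun p : TR * Om => (Gam p.1 p.2)%:E).
Proof.
have [C [bu bv]] := common_bound.
apply: integrable_of_double_integral; last exact: class2_mixed_carre_fin.
  exact: (measurable_carre_uv T_gt0 (class2_energetic u2 bu) (class2_energetic v2 bv)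
    (observable_U Uuv (bound_mul bu bv))).
by move=> r w /negbTE rN; rewrite carre_cut /time_cut rN.
Qed.

(** Now that Gamma(u,v) is integrable, |L(uv)| is at most
    |Gamma(u,v)| + C |Lu| + C |Lv|, and stopping is no longer necessary. *)
Lemma class2_mixed_generator : stopped_generator Q (cst T) (u \* v) (K (u \* v)).
Proof.
have [C [bu bv]] := common_bound.
have C0 : 0 <= C := le_trans (normr_ge0 _) (bu point).
have mH : measurable_fun setT (fun p : TR * Om => `|Gam p.1 p.2| + C * G p.1 p.2).
  apply: measurable_funD.
    apply: measurableT_comp => //; apply/measurable_EFinP; exact: measurable_int class2_mixed_carre_integrable.
  by apply: measurable_funM => //; apply/measurable_EFinP; exact: measurable_int density_integrable.
have G0 r w : 0 <= G r w by rewrite mulr_ge0// addr_ge0// energy_density_ge0.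
have mG : measurable_fun setT (fun p : TR * Om => G p.1 p.2).
  by apply/measurable_EFinP; exact: measurable_int density_integrable.
have mn : measurable_fun setT (fun p : TR * Om => `|Gam p.1 p.2|).
  by apply: measurableT_comp => //; apply/measurable_EFinP; exact: measurable_int class2_mixed_carre_integrable.
have mC : measurable_fun setT (fun p : TR * Om => C * G p.1 p.2) by exact: measurable_funM.
have GC0 r w : 0 <= C * G r w by rewrite mulr_ge0.
have H_fin : (double_integral Q setT 0 T (fun r w => `|Gam r w| + C * G r w)%R < +oo)%E.
  have eD := @double_integralD _ _ _ Q setT 0 T (fun r w => `|Gam r w|) (fun r w => C * G r w)
    measurableT mn mC (fun r w => normr_ge0 _) GC0.
  have eZ := @double_integralZ _ _ _ Q setT 0 T C G measurableT mG G0 C0.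
  rewrite eD eZ; apply: lte_add_pinfty; first exact: class2_mixed_carre_fin.
  by apply: lte_mul_pinfty; [rewrite lee_fin|rewrite fin_numE|exact: G_fin].
apply: (@stopped_generator_dominated _ _ _ T_gt0 Q (u \* v) _ (fun r w => `|Gam r w| + C * G r w)
  (C * C) (C + C) (U_measurable Uuv) (U_continuous Uuv) (bound_mul bu bv) (U_version Uuv)
  (addr_ge0 C0 C0) mH (fun r w => addr_ge0 (normr_ge0 _) (GC0 r w)) H_fin).
move=> r w; set a := Gam r w.
have -> : K (u \* v) r w = a + u (position r w) * K v r w + v (position r w) * K u r w.
  by rewrite /a /carre; ring.
have b1 : `|u (position r w) * K v r w| <= C * (1 + K v r w ^+ 2) by rewrite normrM ler_pM.
have b2 : `|v (position r w) * K u r w| <= C * (1 + K u r w ^+ 2) by rewrite normrM ler_pM.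
have n1 := ler_normD (a + u (position r w) * K v r w) (v (position r w) * K u r w).
have n2 := ler_normD a (u (position r w) * K v r w).
have GE : C * (K u r w ^+ 2 + K v r w ^+ 2) <= C * G r w.
  apply: ler_wpM2l => //; rewrite /G /energy_density.
  have := normr_ge0 (carre u u (K (u \* u)) (K u) (K u) r w).
  have := normr_ge0 (carre v v (K (v \* v)) (K v) (K v) r w).
  by have := sqr_ge0 (K u r w); have := sqr_ge0 (K v r w); lra.
by rewrite mulrDr in GE; rewrite !mulrDr !mulr1 in b1 b2; lra.
Qed.

Lemma forward_backward_rates :
  (forall E : R -> R -> Om -> R,
     (forall h, 0 < h < T ->
        measurable_process `[0, T - h] (E h) /\
        forall t, 0 <= t <= T - h -> cond_exp Q `[0, t] (incr_quotient u v h t) (E h t)) ->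
     (\int[Q]_w \int[mu]_(t in `[0%R, (T - h)%R])
        `|E h t w - carre_du_champ L u v t w|%:E)%E @[h --> 0^'+] --> 0%E)
  /\
  (forall gamma : R -> X -> R,
     carre_du_champ_at Q L u v gamma ->
     {within `[0, T] `*` [set: X], continuous (fun p : R * X => gamma p.1 p.2)} ->
   forall E : R -> R -> Om -> R,
     (forall h, 0 < h < T ->
        measurable_process `[h, T] (E h) /\
        forall t, h <= t <= T ->
          cond_exp Q [set t - h] (incr_quotient u v h (t - h)) (E h t)) ->
     (\int[Q]_w \int[mu]_(t in `[h, T])
        `|E h t w - gamma t (position t w)|%:E)%E @[h --> 0^'+] --> 0%E).
Proof.
have [C [bu bv]] := common_bound.
have mG : measurable_fun setT (fun p : TR * Om => G p.1 p.2).
  by apply/measurable_EFinP; exact: measurable_int density_integrable.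
have en_u := class2_energetic u2 bu; have en_v := class2_energetic v2 bv.
have obs_uv := observable_U Uuv (bound_mul bu bv).
have GamE t w : 0 <= t <= T -> Gam t w = carre_du_champ L u v t w.
  by move=> t0T; rewrite carre_cut time_cutE.
split=> [E E_exp|gamma gamma_at gamma_cont E E_exp].
  have lim := forward_rate_cvg T_gt0 condQ en_u en_v obs_uv class2_mixed_generator mG
    (fun r w => lexx _) G_total class2_mixed_carre_integrable E_exp carre_adapted.
  apply: cvg_trans lim; apply: near_eq_cvg; near=> h.
  have h0 : 0 < h by near: h; exact: nbhs_right_gt.
  apply: eq_integral => w _; apply: eq_integral => t; rewrite inE/= in_itv/= => /andP[t0 tT].
  by rewrite GamE// t0 (le_trans tT)// gerBl ltW.
apply: (backward_rate_cvg T_gt0 condQ en_u en_v obs_uv class2_mixed_generator mG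
    (fun r w => lexx _) G_total class2_mixed_carre_integrable gamma_cont _ E_exp).
move: gamma_at; apply: filterS; first exact: (ae_filter_ringOfSetsType mu).
move=> t gt t0T; have := gt t0T; rewrite (_ : carre_du_champ L u v t = Gam t)//.
by apply/funext => w; rewrite GamE.
Unshelve. all: by end_near. Qed.

End classes.

Theorem lemma3p9 (R : realType) (T : R) (T_gt0 : 0 < T)
    (X : ptopologicalType) (polX : polish_space R X)
    (Q : {sigma_finite_measure set (cadlag_path T X) -> \bar R})
    (condQ : conditionable Q)
    (L : (X -> R) -> R -> cadlag_path T X -> R) (genL : extended_generator Q L)
    (U : set (X -> R)) (admU : admissible_class Q U)
    (u v : X -> R) (u2 : class2 Q L U u) (v2 : class2 Q L U v) :
  (forall E : R -> R -> cadlag_path T X -> R,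
     (forall h, 0 < h < T ->
        measurable_process `[0, T - h] (E h) /\
        forall t, 0 <= t <= T - h ->
          cond_exp Q `[0, t] (incr_quotient u v h t) (E h t)) ->
     (\int[Q]_w \int[lebesgue_measure]_(t in `[0%R, (T - h)%R])
        `|E h t w - carre_du_champ L u v t w|%:E)%E @[h --> 0^'+] --> 0%E)
  /\
  (markov_measure Q ->
   forall gamma : R -> X -> R,
     carre_du_champ_at Q L u v gamma ->
     {within `[0, T] `*` [set: X],
        continuous (fun p : R * X => gamma p.1 p.2)} ->
   forall E : R -> R -> cadlag_path T X -> R,
     (forall h, 0 < h < T ->
        measurable_process `[h, T] (E h) /\
        forall t, h <= t <= T ->
          cond_exp Q [set t - h] (incr_quotient u v h (t - h)) (E h t)) ->
     (\int[Q]_w \int[lebesgue_measure]_(t in `[h, T])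
        `|E h t w - gamma t (position t w)|%:E)%E @[h --> 0^'+] --> 0%E).
Proof.
have [forward backward] := forward_backward_rates T_gt0 condQ genL admU u2 v2.
by split=> // _; exact: backward.
Qed.
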